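(* Let $f:E\times\mathbb R\to\mathbb R$ satisfy conditions Car), Sig) and Int), and let $\mu\in\mathcal M_\rho$. Assume that there exist a subsolution $\underline u$ and a supersolution $\overline u$ to $$-Au=f(\cdot,u)+\mu$$ such that $\underline u\le\overline u$ $m$-a.e. Then there exists a maximal solution $u$ to this equation such that $\underline u\le u\le\overline u$ $m$-a.e.; that is, $u$ is a solution lying $m$-a.e. between $\underline u$ and $\overline u$, and every solution $v$ with $\underline u\le v\le\overline u$ $m$-a.e. satisfies $v\le u$ $m$-a.e.
   Context: Setting. $E$ is a locally compact separable metric space, $m$ a positive Radon measure on $E$ with full support, $(A,D(A))$ a self-adjoint operator on $L^2(E;m)$ generating a strongly continuous Markov semigroup $(T_t)_{t\ge0}$. The associated symmetric Dirichlet form is $\mathcal E(u,v)=(\sqrt{-A}u,\sqrt{-A}v)_{L^2(E;m)}$, $D(\mathcal E)=D(\sqrt{-A})$; it is assumed regular ($C_c(E)\cap D(\mathcal E)$ is dense in $D(\mathcal E)$ for the norm $(\mathcal E(u,u)+\|u\|_{L^2}^2)^{1/2}$ and in $C_c(E)$ for the uniform norm). $(T_t)$ is assumed transient: there is a strictly positive $g\in L^2(E;m)$ with $\operatorname{ess\,sup}_{n\ge1}\int_0^nT_tg\,dt<\infty$ $m$-a.e. Let $\mathbb X=(X_t,P_x)$ be the Hunt process on $E\cup\{\partial\}$ associated with $A$ (so $T_th(x)=\mathbb E_xh(X_t)$ $m$-a.e. for bounded Borel $h\in L^2(E;m)$; functions on $E$ are extended by $0$ at the cemetery $\partial$), $P_th(x)=\mathbb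 E_xh(X_t)$, $Rh(x)=\mathbb E_x\int_0^\infty h(X_s)\,ds$ for Borel $h\ge0$. A nonnegative Borel function $h$ is excessive if $\sup_{t>0}P_th(x)=h(x)$ for all $x\in E$. It is assumed that the Green function for $-A$ exists: a Borel function $G:E\times E\to[0,\infty]$ with $G(x,\cdot),G(\cdot,y)$ excessive for all $x,y$ and $Rh(x)=\int_EG(x,y)h(y)\,m(dy)$ for all $x\in E$ and all Borel $h\ge0$. For a measure $\mu$, $R\mu(x)=\int_EG(x,y)\,\mu(dy)$. Fix a strictly positive excessive function $\rho:E\to(0,\infty)$ and a strictly positive bounded Borel function $\varrho\in L^1(E;m)\cap L^2(E;m)$ such that $R\varrho$ is bounded and $R\varrho\le\rho$ $m$-a.e. $\mathcal M_\rho$ is the set of signed Borel measures $\mu=\mu^+-\mu^-$ on $E$ (with $\mu^\pm$ possibly infinite) with $\|\mu\|_\rho:=\int_E\rho\,d|\mu|<\infty$. Solutions. For $\mu\in\mathcal M_\rho$, a solution to $-Au=f(\cdot,u)+\mu$ is a Borel function $u$ (finite $m$-a.e.) with $f(\cdot,u)\in L^1(E;\rho\cdot m)$ and $u=Rf(\cdot,u)+R\mu$ $m$-a.e. A subsolution (resp. supersolution) is a Borel function $u$ with $f(\cdot,u)\in L^1(E;\rho\cdot m)$ such that for some positive $\nu\in\mathcal M_\rho$, $u=Rf(\cdot,u)+R\mu-R\nu$ (resp. $u=Rf(\cdot,u)+R\mu+R\nu$) $m$-a.e. Conditions on $f$. Car): $x\mapsto f(x,y)$ is Borel for every $y$ and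 $y\mapsto f(x,y)$ is continuous for $m$-a.e. $x$. Sig): for every $u\in\mathbb R$, $f(x,u)u\le0$ for $m$-a.e. $x$. Int): for all $\underline u,\overline u\in L^1(E;\varrho\cdot m)$ with $f(\cdot,\underline u),f(\cdot,\overline u)\in L^1(E;\rho\cdot m)$, the function $x\mapsto\sup_{y\in[\underline u(x),\overline u(x)]}|f(x,y)|$ belongs to $L^1(E;\rho\cdot m)$ (sup over the empty set is $0$). *)

(* Defs.v *)
From HB Require Import structures.
From mathcomp Require Import all_boot all_order all_algebra.
From mathcomp Require Import all_classical all_reals all_analysis.
From mathcomp Require Import measurable_realfun.

Set Implicit Arguments.
Unset Strict Implicit.
Unset Printing Implicit Defensive.

Import Order.TTheory GRing.Theory Num.Theory.
Import numFieldNormedType.Exports.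

Local Open Scope classical_set_scope.
Local Open Scope ring_scope.

(* The library builds generated sigma-algebras on pointed types only, so metric
   spaces are taken pointed, i.e. nonempty. *)
#[short(type="pmetricType")]
HB.structure Definition PointedMetric (K : numDomainType) :=
  {T of isPointed T & Metric K T}.

Notation borel E := (g_sigma_algebraType (@open E)).

Section Space.
Context {R : realType} (E : pmetricType R).

Definition separable_space : Prop := exists2 D : set E, countable D & dense D.

Definition lc_separable : Prop := locally_compact [set: E] /\ separable_space.

Variable m : {measure set (borel E) -> \bar R}.

Definition radon : Prop :=
  (forall K : set E, compact K -> (m K < +oo)%E) /\
  (forall B : set (borel E), measurable B ->
     m B = ereal_sup [set m K | K in [set K : set E | compact K /\ K `<=` B]]).

Definition full_support : Prop :=
  forall U : set E, open U -> U !=set0 -> (0 < m U)%E.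

Definition Cc (v : E -> R) : Prop :=
  continuous v /\ compact (closure [set x | v x != 0]).

End Space.

(* Elements of L^2(mu) are represented by functions; operators act on
   representatives and are required to be compatible with equality a.e. *)
Section L2Operators.
Context d {T : measurableType d} {R : realType} (mu : {measure set T -> \bar R}).
Implicit Types (u v w : T -> R) (D : set (T -> R)) (A B : (T -> R) -> (T -> R)).

Definition L2 : set (T -> R) := [set u | u \in Lfun mu 2%:E].

Definition normL2 u : \bar R := 'N[mu]_2%:E[EFin \o u]%E.

Definition dotL2 u v : R := \int[mu]_x (u x * v x).

Record linear_operator D A : Prop := {
  op_domain : D `<=` L2 ;
  op_codomain : forall u, D u -> L2 (A u) ;
  op_ae : forall u v, D u -> L2 v -> u = v %[ae mu] ->
    D v /\ A u = A v %[ae mu] ;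
  op_linear : forall (c : R) u v, D u -> D v ->
    D (fun x => c * u x + v x) /\
    A (fun x => c * u x + v x) = (fun x => c * A u x + A v x) %[ae mu] }.

Definition dense_domain D : Prop :=
  forall u, L2 u -> forall e : R, 0 < e ->
    exists2 v, D v & (normL2 (u \- v)%R < e%:E)%E.

(* The last clause says that the graph of A is the graph of its adjoint. *)
Definition self_adjoint D A : Prop :=
  [/\ linear_operator D A,
      dense_domain D &
      forall u w, L2 u -> L2 w ->
        (D u /\ A u = w %[ae mu]) <->
        (forall v, D v -> dotL2 (A v) u = dotL2 v w)].

Record markov_semigroup (S : R -> (T -> R) -> (T -> R)) : Prop := {
  semigroup_op : forall t : R, 0 <= t -> linear_operator L2 (S t) ;
  semigroup_contraction : forall (t : R) u, 0 <= t -> L2 u ->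
    (normL2 (S t u) <= normL2 u)%E ;
  semigroup0 : forall u, L2 u -> S 0 u = u %[ae mu] ;
  semigroupD : forall (s t : R) u, 0 <= s -> 0 <= t -> L2 u ->
    S (s + t) u = S s (S t u) %[ae mu] ;
  semigroup_continuous : forall u, L2 u ->
    normL2 (S t u \- u)%R @[t --> 0^'+] --> 0%E ;
  semigroup_markov : forall (t : R) u, 0 <= t -> L2 u ->
    (\forall x \ae mu, 0 <= u x <= 1) ->
    \forall x \ae mu, 0 <= S t u x <= 1 }.

Definition generator D A (S : R -> (T -> R) -> (T -> R)) : Prop :=
  forall u w, L2 u -> L2 w ->
    (D u /\ A u = w %[ae mu]) <->
    (normL2 (fun x => t^-1 * (S t u x - u x) - w x) @[t --> 0^'+] --> 0%E).

(* (DB, B) is the nonnegative self-adjoint square root of -A; by the spectral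
   theorem it is unique up to equality a.e. *)
Definition sqrt_opp D A DB B : Prop :=
  [/\ self_adjoint DB B,
      forall u, DB u -> 0 <= dotL2 (B u) u,
      forall u, D u <-> DB u /\ DB (B u) &
      forall u, D u -> B (B u) = (\- A u) %[ae mu]].

Definition dirichlet_form B u v : R := dotL2 (B u) (B v).

(* w is the L^2-valued integral of S_s g over [0, t], as a limit of Riemann
   sums (s |-> S_s g is continuous with values in L^2). *)
Definition time_integral (S : R -> (T -> R) -> (T -> R)) g (t : R) w : Prop :=
  L2 w /\
  normL2 (fun x => (t / k.+1%:R) *
                     (\sum_(i < k.+1) S (t * i%:R / k.+1%:R) g x) - w x)
    @[k --> \oo] --> 0%E.

(* The family (I n) is countable, so its essential supremum is its pointwise
   supremum. *)
Definition transient (S : R -> (T -> R) -> (T -> R)) : Prop :=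
  exists2 g : T -> R, L2 g /\ (forall x, 0 < g x) &
    exists2 I : nat -> T -> R,
      (forall n, time_integral S g n.+1%:R (I n)) &
      \forall x \ae mu, (ereal_sup (range (fun n => (I n x)%:E)) < +oo)%E.

End L2Operators.

Section Regular.
Context {R : realType} (E : pmetricType R).
Variable m : {measure set (borel E) -> \bar R}.

Definition regular (DB : set (E -> R)) (B : (E -> R) -> (E -> R)) : Prop :=
  (forall u, DB u -> forall e : R, 0 < e ->
     exists2 v : E -> R, Cc v /\ DB v &
       Num.sqrt (dirichlet_form m B (u \- v)%R (u \- v)%R
                 + dotL2 m (u \- v)%R (u \- v)%R) < e) /\
  (forall u : E -> R, Cc u -> forall e : R, 0 < e ->
     exists2 v : E -> R, Cc v /\ DB v & forall x, `|u x - v x| < e).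

End Regular.

(* The state space is the one-point compactification of E, None being the
   cemetery (an isolated point when E is compact).  X t is only meaningful for
   0 <= t; at t = +oo the process sits at the cemetery, so that the strong
   Markov property need only be stated on {tau < +oo}. *)
Section Hunt.
Context {R : realType} (E : pmetricType R).
Local Notation state := (one_point_compactification E).
Context dO (Omega : measurableType dO).
Variables (X : R -> Omega -> state) (P : state -> probability Omega R).

Record admissible_filtration (F : R -> set (set Omega)) : Prop := {
  filtration_sigma : forall t : R, 0 <= t -> sigma_algebra setT (F t) ;
  filtration_sub : forall t : R, 0 <= t -> F t `<=` measurable ;
  filtration_right : forall t : R, 0 <= t ->
    F t = \bigcap_(s in [set s | t < s]) F s ;
  filtration_adapted : forall (t : R) (B : set (borel state)), 0 <= t ->
    measurable B -> F t (X t @^-1` B) }.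

Definition stopping_time (F : R -> set (set Omega)) (tau : Omega -> \bar R) :
    Prop :=
  (forall w, (0 <= tau w)%E) /\
  (forall t : R, 0 <= t -> F t [set w | (tau w <= t%:E)%E]).

Definition stopped_events (F : R -> set (set Omega)) (tau : Omega -> \bar R) :
    set (set Omega) :=
  [set L | measurable L /\
           forall t : R, 0 <= t -> F t (L `&` [set w | (tau w <= t%:E)%E])].

(* Stated for each P_x; the property for an arbitrary initial law follows by
   integration. *)
Definition strong_markov (F : R -> set (set Omega)) : Prop :=
  forall (x : state) (tau : Omega -> \bar R) (s : R) (B : set (borel state))
    (L : set Omega),
  stopping_time F tau -> 0 <= s -> measurable B -> stopped_events F tau L ->
  P x (L `&` [set w | (tau w < +oo)%E /\ B (X (fine (tau w) + s) w)]) =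
  (\int[P x]_(w in L `&` [set w | tau w < +oo])
     P (X (fine (tau w)) w) (X s @^-1` B))%E.

Definition quasi_left_continuous (F : R -> set (set Omega)) : Prop :=
  forall (x : state) (tau_ : nat -> Omega -> \bar R) (tau : Omega -> \bar R),
  (forall n, stopping_time F (tau_ n)) ->
  (forall n w, (tau_ n w <= tau_ n.+1 w)%E) ->
  (forall w, tau w = ereal_sup (range (tau_ ^~ w))) ->
  \forall w \ae P x, (tau w < +oo)%E ->
    X (fine (tau_ n w)) w @[n --> \oo] --> X (fine (tau w)) w.

Record hunt_process : Prop := {
  hunt_measurable : forall t : R, 0 <= t ->
    measurable_fun [set: Omega] (X t : Omega -> borel state) ;
  hunt_transition : forall (t : R) (B : set (borel state)), 0 <= t -> measurable B ->
    measurable_fun [set: borel E]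
      ((fun x => P (Some x) (X t @^-1` B)) : borel E -> \bar R) ;
  hunt_normal : forall x : state, P x (X 0 @^-1` [set x]) = 1%E ;
  hunt_cemetery : forall (s t : R) w, 0 <= s -> s <= t ->
    X s w = None -> X t w = None ;
  hunt_shift : exists theta : R -> Omega -> Omega,
    forall (s t : R) w, 0 <= s -> 0 <= t -> X s (theta t w) = X (s + t) w ;
  hunt_right_continuous : forall (t : R) w, 0 <= t ->
    X s w @[s --> t^'+] --> X t w ;
  hunt_left_limits : forall (t : R) w, 0 < t ->
    exists l : state, X s w @[s --> t^'-] --> l ;
  hunt_strong_markov : exists F : R -> set (set Omega),
    [/\ admissible_filtration F, strong_markov F & quasi_left_continuous F] }.

Definition cemetery_ext (h : E -> \bar R) (y : state) : \bar R :=
  if y is Some x then h x else 0%E.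

Definition transition (t : R) (h : E -> \bar R) (x : E) : \bar R :=
  (\int[P (Some x)]_w cemetery_ext h (X t w))%E.

Definition potential (h : E -> \bar R) (x : E) : \bar R :=
  (\int[P (Some x)]_w \int[lebesgue_measure]_(s in `[0%R, +oo[)
     cemetery_ext h (X s w))%E.

Definition potential_signed (h : E -> R) (x : E) : \bar R :=
  (potential (EFin \o h)^\+ x - potential (EFin \o h)^\- x)%E.

Definition excessive (h : E -> \bar R) : Prop :=
  [/\ measurable_fun [set: borel E] (h : borel E -> \bar R),
      forall x, (0 <= h x)%E &
      forall x, ereal_sup [set transition t h x | t in [set t | 0 < t]] = h x].

Variable m : {measure set (borel E) -> \bar R}.

Definition associated (S : R -> (E -> R) -> (E -> R)) : Prop :=
  forall (t : R) (h : borel E -> R), 0 <= t ->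
    measurable_fun [set: borel E] h -> (exists C, forall x, `|h x| <= C) ->
    L2 m h ->
    \forall x \ae m, (S t h x)%:E = transition t (EFin \o h) x.

Definition green_function (G : E * E -> \bar R) : Prop :=
  [/\ measurable_fun [set: borel E * borel E]
        (G : borel E * borel E -> \bar R),
      forall z, (0 <= G z)%E,
      forall x, excessive (fun y => G (x, y)),
      forall y, excessive (fun x => G (x, y)) &
      forall h : borel E -> \bar R, measurable_fun [set: borel E] h ->
        (forall y, (0 <= h y)%E) ->
        forall x, potential h x = (\int[m]_y (G (x, y) * h y))%E].

End Hunt.

(* Both parts may be infinite; mutual singularity makes them the Jordan
   decomposition, so that |mu| = pos_part + neg_part. *)
Record signed_measure (R : realType) d (T : measurableType d) := {
  pos_part : {measure set T -> \bar R} ;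
  neg_part : {measure set T -> \bar R} ;
  parts_singular : exists N : set T,
    [/\ measurable N, pos_part N = 0%E & neg_part (~` N) = 0%E] }.

Section Equation.
Context {R : realType} (E : pmetricType R) dO (Omega : measurableType dO).
Local Notation state := (one_point_compactification E).
Variables (m : {measure set (borel E) -> \bar R})
  (X : R -> Omega -> state) (P : state -> probability Omega R)
  (G : E * E -> \bar R) (rho varrho : E -> R) (f : E -> R -> R).
Implicit Types (mu : signed_measure R (borel E)) (u : E -> \bar R).

Definition M_rho mu : Prop :=
  (\int[pos_part mu]_x (rho x)%:E + \int[neg_part mu]_x (rho x)%:E < +oo)%E.

Definition potential_measure (nu : {measure set (borel E) -> \bar R}) (x : E) :
    \bar R := (\int[nu]_y G (x, y))%E.

Definition potential_signed_measure mu (x : E) : \bar R :=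
  (potential_measure (pos_part mu) x - potential_measure (neg_part mu) x)%E.

(* h is a Borel function in L^1(E; w.m). *)
Definition L1w (w h : E -> R) : Prop :=
  measurable_fun [set: borel E] (h : borel E -> R) /\
  m.-integrable [set: borel E] (fun x : borel E => (h x * w x)%:E).

Definition Car : Prop :=
  (forall y, measurable_fun [set: borel E] (f ^~ y : borel E -> R)) /\
  (\forall x \ae m, continuous (f x)).

Definition Sig : Prop := forall y, \forall x \ae m, f x y * y <= 0.

Definition sup_between (lo hi : E -> R) (x : E) : \bar R :=
  maxe 0%E (ereal_sup [set `|f x y|%:E | y in [set y | lo x <= y <= hi x]]).

(* As y |-> f x y is continuous only for m-a.e. x, the functions f(., u) and
   sup_between lo hi need only agree m-a.e. with a Borel function. *)
Definition L1w_class (w : E -> R) (g : E -> \bar R) : Prop :=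
  exists2 h : E -> R, L1w w h & g = EFin \o h %[ae m].

Definition Int : Prop :=
  forall lo hi : E -> R, L1w varrho lo -> L1w varrho hi ->
    L1w_class rho (fun x => (f x (lo x))%:E) ->
    L1w_class rho (fun x => (f x (hi x))%:E) ->
    L1w_class rho (sup_between lo hi).

(* h is a Borel representative of f(., u) in L^1(E; rho.m); R h does not depend
   on its choice, R having a kernel with respect to m. *)
Definition rhs_representative u (h : E -> R) : Prop :=
  [/\ measurable_fun [set: borel E] (u : borel E -> \bar R),
      \forall x \ae m, u x \is a fin_num,
      L1w rho h &
      \forall x \ae m, h x = f x (fine (u x))].

Definition solution mu u : Prop :=
  exists2 h, rhs_representative u h &
    \forall x \ae m,
      u x = (potential_signed X P h x + potential_signed_measure mu x)%E.

Definition subsolution mu u : Prop :=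
  exists2 nu : {measure set (borel E) -> \bar R},
    (\int[nu]_x (rho x)%:E < +oo)%E &
    exists2 h, rhs_representative u h &
      \forall x \ae m,
        u x = (potential_signed X P h x + potential_signed_measure mu x
               - potential_measure nu x)%E.

Definition supersolution mu u : Prop :=
  exists2 nu : {measure set (borel E) -> \bar R},
    (\int[nu]_x (rho x)%:E < +oo)%E &
    exists2 h, rhs_representative u h &
      \forall x \ae m,
        u x = (potential_signed X P h x + potential_signed_measure mu x
               + potential_measure nu x)%E.

End Equation.

(* Main.v *)
Require Import Defs.
From HB Require Import structures.
From mathcomp Require Import all_boot all_order all_algebra.
From mathcomp Require Import all_classical all_reals all_analysis.
From mathcomp Require Import measurable_realfun.
From mathcomp Require Import ring lra.

Set Implicit Arguments.
Unset Strict Implicit.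
Unset Printing Implicit Defensive.

Import Order.TTheory GRing.Theory Num.Theory.
Import numFieldNormedType.Exports.

Local Open Scope classical_set_scope.
Local Open Scope ring_scope.

(** Write V for the potential operator of the process, V_k for its resolvent at
    k > 0 and U nu for the potential of a measure nu. Solutions are found as the
    limit of the largest solutions of regularized equations, which an order
    preserving iteration produces because the regularized right-hand side
    satisfies a one-sided Lipschitz condition.

    Potential theory. Since the generator is self-adjoint, its semigroup is
    symmetric ([semigroup_symmetric]), and so is V. Symmetry bounds the integral
    of varrho * U nu by that of rho with respect to nu, so that every potential
    in the equation is finite almost everywhere ([process_kernels]). With a
    bound H for |f| between the two barriers, the equation
    u = V f(.,u) + U mu becomes u = V (f(.,u) + H) + K with a fixed function K
    and a nonnegative source, so that z = u - K is a nonnegative unknown.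

    Comparison. The resolvent equation reads V h = k V_k (V h + h / k), and a
    nonnegative function d below a finite potential with d <= k V_k d vanishes,
    since the powers of k V_k exhaust any finite potential
    ([resolvent_vanish]). Applied to d = (z - a)^+ this compares subsolutions
    z and supersolutions a of equations written with V_k
    ([resolvent_comparison]).

    Regularization. With k = n+1, replace f(x,.) on the interval between the
    barriers by its least majorant F_n for which F_n(y) + k y is nondecreasing
    ([running_sup]). Then z |-> k V_k (z + source(z) / k) is order preserving,
    and iterating it from a large potential gives a decreasing sequence. As F_n
    is continuous from the right, the limit z_n is a fixed point and hence, by
    comparison, a solution z_n = V (source(z_n)). It dominates every solution
    of the original equation, as well as the lower barrier, because F_n >= f
    makes these subsolutions ([regularized_solution]).

    Limit. F_n decreases with n, so z_n decreases; F_n(y_n) tends to f(y) when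
    y_n decreases to y, so dominated convergence shows that the limit solves
    the original equation. Comparison with the upper barrier keeps it below
    this barrier, and it still dominates every solution between the barriers
    ([maximal_solution_between]). *)

Local Open Scope ereal_scope.

(** * Nonnegative measurable functions *)

Definition nnmfun d (T : measurableType d) (R : realType) (h : T -> \bar R) :=
  measurable_fun [set: T] h /\ forall x, 0 <= h x.

Section NonnegativeMeasurable.
Context d (T : measurableType d) (R : realType).
Implicit Types (g h : T -> \bar R) (mu : {measure set T -> \bar R}).

Lemma nnmfunD g h : nnmfun g -> nnmfun h -> nnmfun (fun x => g x + h x).
Proof.
move=> [mg g0] [mh h0]; split; first exact: emeasurable_funD.
by move=> x; exact: adde_ge0.
Qed.

Lemma nnmfunM g h : nnmfun g -> nnmfun h -> nnmfun (fun x => g x * h x).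
Proof.
move=> [mg g0] [mh h0]; split; first exact: emeasurable_funM.
by move=> x; exact: mule_ge0.
Qed.

Lemma nnmfun_cst (c : \bar R) : 0 <= c -> nnmfun (fun _ : T => c).
Proof. by move=> c0; split. Qed.

Lemma nnmfun_indic (B : set T) : measurable B -> nnmfun (fun x => (\1_B x)%:E : \bar R).
Proof.
move=> mB; split; first exact/measurable_EFinP/measurable_indic.
by move=> x; rewrite lee_fin.
Qed.

Lemma nnmfun_cvg (u_ : nat -> T -> \bar R) h : (forall n, nnmfun (u_ n)) ->
  (forall x, u_ n x @[n --> \oo] --> h x) -> nnmfun h.
Proof.
move=> u_nn uh; split.
  by apply: (emeasurable_fun_cvg u_) => [n|x _]; [have [] := u_nn n|exact: uh].
move=> x; rewrite -(cvg_lim _ (uh x))//; apply: lime_ge.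
  by apply/cvg_ex; exists (h x); exact: uh.
by apply: nearW => n; have [] := u_nn n.
Qed.

Lemma nnint_le mu g h : nnmfun g -> nnmfun h -> (forall x, g x <= h x) ->
  \int[mu]_x g x <= \int[mu]_x h x.
Proof. by move=> [mg g0] [mh h0] gh; exact: ge0_le_integral. Qed.

Lemma nnintD mu g h : nnmfun g -> nnmfun h ->
  \int[mu]_x (g x + h x) = \int[mu]_x g x + \int[mu]_x h x.
Proof. by move=> [mg g0] [mh h0]; exact: ge0_integralD. Qed.

Lemma nnintZ mu (c : \bar R) h : 0 <= c -> nnmfun h ->
  \int[mu]_x (c * h x) = c * \int[mu]_x h x.
Proof. by move=> c0 [mh h0]; exact: ge0_integralZl. Qed.

Lemma nnint_ge0 mu h : nnmfun h -> 0 <= \int[mu]_x h x.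
Proof. by move=> [_ h0]; exact: integral_ge0. Qed.

Lemma nnint_ae_le mu g h : nnmfun g -> nnmfun h -> (\forall x \ae mu, g x <= h x) ->
  \int[mu]_x g x <= \int[mu]_x h x.
Proof.
move=> [mg g0] [mh h0] gh; apply: ae_ge0_le_integral => //.
by apply: filterS gh => x + _.
Qed.

Lemma nnint_ae_eq mu g h : nnmfun g -> nnmfun h -> (\forall x \ae mu, g x = h x) ->
  \int[mu]_x g x = \int[mu]_x h x.
Proof.
move=> gn hn gh; apply/eqP; rewrite eq_le; apply/andP.
by split; apply: nnint_ae_le => //; apply: filterS gh => x ->.
Qed.

Lemma nnint_fin_ae mu h : nnmfun h -> \int[mu]_x h x < +oo ->
  \forall x \ae mu, h x \is a fin_num.
Proof.
move=> [mh h0] ih.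
have /integrable_ae : mu.-integrable setT h.
  by apply/integrableP; split => //; under eq_integral do rewrite gee0_abs//.
by move=> /(_ measurableT); apply: filterS => x; exact.
Qed.

Lemma nnint_mct mu (u_ : nat -> T -> \bar R) h : (forall n, nnmfun (u_ n)) ->
  (forall x, nondecreasing_seq (u_ ^~ x)) ->
  (forall x, u_ n x @[n --> \oo] --> h x) ->
  \int[mu]_x u_ n x @[n --> \oo] --> \int[mu]_x h x.
Proof.
move=> u_nn und uh.
rewrite [X in _ --> X](_ : _ = \int[mu]_x limn (u_ ^~ x)); last first.
  by apply: eq_integral => x _; apply/esym/cvg_lim => //; exact: uh.
apply: cvg_monotone_convergence => //.
- by move=> n; have [] := u_nn n.
- by move=> n x _; have [] := u_nn n.
Qed.

Lemma nnint_dct mu (u_ : nat -> T -> \bar R) h g : (forall n, nnmfun (u_ n)) ->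
  nnmfun h -> nnmfun g ->
  (\forall x \ae mu, u_ n x @[n --> \oo] --> h x) ->
  (forall n x, u_ n x <= g x) -> \int[mu]_x g x < +oo ->
  \int[mu]_x u_ n x @[n --> \oo] --> \int[mu]_x h x.
Proof.
move=> u_nn [mh h0] [mg g0] uh ug ig.
have mu_ n : measurable_fun setT (u_ n) by have [] := u_nn n.
have ig' : mu.-integrable setT g.
  by apply/integrableP; split => //; under eq_integral do rewrite gee0_abs//.
have uh' : {ae mu, forall x, setT x -> u_ n x @[n --> \oo] --> h x}.
  by apply: filterS uh => x + _.
have ug' : {ae mu, forall x n, setT x -> `|u_ n x| <= g x}.
  by apply: nearW => x n _; rewrite gee0_abs ?ug//; have [] := u_nn n.
by have [] := dominated_convergence measurableT mu_ mh uh' ig' ug'.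
Qed.

End NonnegativeMeasurable.

Lemma nnmfun_comp d1 d2 (T1 : measurableType d1) (T2 : measurableType d2)
    (R : realType) (p : T1 -> T2) (h : T2 -> \bar R) :
  measurable_fun [set: T1] p -> nnmfun h -> nnmfun (h \o p).
Proof.
by move=> mp [mh h0]; split => [|x]; [exact: measurableT_comp|exact: h0].
Qed.

(** Sigma-finiteness is a hypothesis rather than part of a bundled structure,
    because for most measures below it has to be deduced, from the total mass or
    from the integrability of a positive function. *)
Lemma tonelli d1 d2 (T1 : measurableType d1) (T2 : measurableType d2)
    (R : realType) (m1 : {measure set T1 -> \bar R})
    (m2 : {measure set T2 -> \bar R}) (f : T1 * T2 -> \bar R) :
  sigma_finite setT m1 -> sigma_finite setT m2 -> nnmfun f ->
  [/\ nnmfun (fun x => \int[m2]_y f (x, y)), nnmfun (fun y => \int[m1]_x f (x, y)) &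
  \int[m1]_x \int[m2]_y f (x, y) = \int[m2]_y \int[m1]_x f (x, y)].
Proof.
move=> s1 s2 [mf f0].
pose G1 := isSFinite.Build _ _ _ _ (sfinite_measure_sigma_finite s1).
pose G2 := isSFinite.Build _ _ _ _ (sfinite_measure_sigma_finite s2).
pose H1 := isSigmaFinite.Build _ _ _ _ s1.
pose H2 := isSigmaFinite.Build _ _ _ _ s2.
pose m1' := HB.pack_for (SigmaFiniteMeasure.type T1 R) (Measure.sort m1) G1 H1.
pose m2' := HB.pack_for (SigmaFiniteMeasure.type T2 R) (Measure.sort m2) G2 H2.
have -> : m1 = m1' :> {measure set T1 -> \bar R} by exact: eq_measure.
have -> : m2 = m2' :> {measure set T2 -> \bar R} by exact: eq_measure.
split.
- split; last by move=> x; exact: integral_ge0.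
  exact: (@measurable_fun_fubini_tonelli_F _ _ _ _ _ m2' _ mf f0).
- split; last by move=> x; exact: integral_ge0.
  exact: (@measurable_fun_fubini_tonelli_G _ _ _ _ _ m1' _ mf f0).
- exact: (@fubini_tonelli _ _ _ _ _ m1' m2' _ mf f0).
Qed.

Lemma sigma_finite_le1 d (T : measurableType d) (R : realType)
    (m : {measure set T -> \bar R}) : m setT <= 1 -> sigma_finite setT m.
Proof.
move=> m1; apply: fin_num_fun_sigma_finite => [|]; first by rewrite measure0.
move=> U mU; rewrite ge0_fin_numE//; apply: (le_lt_trans _ (ltry 1)).
by apply: le_trans m1; apply: le_measure; rewrite ?inE.
Qed.

(** A measure integrating a positive function is carried by the increasing
    sets where this function exceeds 1/n. *)
Lemma sigma_finite_integrable_gt0 d (T : measurableType d) (R : realType)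
    (m : {measure set T -> \bar R}) (w : T -> R) :
  measurable_fun setT w -> (forall x, (0 < w x)%R) ->
  \int[m]_x (w x)%:E < +oo -> sigma_finite setT m.
Proof.
move=> mw w0 iw.
exists (fun n => [set x | (n.+1%:R^-1 <= w x)%R]).
  apply/seteqP; split => // x _; exists (Num.truncn (w x)^-1) => //=.
  rewrite -[leRHS]invrK lef_pV2 ?posrE ?invr_gt0 ?ltr0n//.
  by apply/ltW/truncnS_gt; rewrite ?invr_ge0 ?ltW.
move=> n; have mA : measurable [set x | (n.+1%:R^-1 <= w x)%R].
  rewrite -[X in measurable X]setTI.
  rewrite [X in _ `&` X](_ : _ = w @^-1` `[(n.+1%:R^-1)%R, +oo[%classic); last first.
    by apply/seteqP; split => x/=; rewrite in_itv/= andbT.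
  exact: mw.
split => //.
have : (n.+1%:R^-1)%R%:E * m [set x | (n.+1%:R^-1 <= w x)%R] <= \int[m]_x (w x)%:E.
  have := @le_integral_abse _ _ _ m setT measurableT (EFin \o w) (n.+1%:R^-1)%R.
  rewrite (eq_integral (EFin \o w)); last first.
    by move=> x _; rewrite gee0_abs//= lee_fin ltW.
  rewrite setTI (_ : [set x | _] = [set x | (n.+1%:R^-1 <= w x)%R]).
    by apply; [exact/measurable_EFinP|rewrite invr_gt0].
  by apply/seteqP; split => x/=; rewrite lee_fin ger0_norm// ltW.
move=> /le_lt_trans/(_ iw); case: (m _) => /= [r _||].
- exact: ltry.
- by rewrite mulry gtr0_sg ?invr_gt0 ?ltr0n// mul1e ltxx.
- by move=> _; rewrite ltNye.
Qed.

Section PositiveFunctional.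
Context d (T : measurableType d) (R : realType).

(** The properties that single out integration against a measure among the
    functionals on nonnegative measurable functions. *)
Record positive_functional (I : (T -> \bar R) -> \bar R) : Prop := {
  functional_ge0 : forall h, nnmfun h -> 0 <= I h ;
  functionalD : forall g h, nnmfun g -> nnmfun h ->
    I (fun x => g x + h x) = I g + I h ;
  functionalZ : forall (c : R) h, (0 <= c)%R -> nnmfun h ->
    I (fun x => c%:E * h x) = c%:E * I h ;
  functional_cvg : forall (u_ : nat -> T -> \bar R) h, (forall n, nnmfun (u_ n)) ->
    (forall x, nondecreasing_seq (u_ ^~ x)) ->
    (forall x, u_ n x @[n --> \oo] --> h x) -> I (u_ n) @[n --> \oo] --> I h }.

Lemma integral_positive_functional (mu : {measure set T -> \bar R}) :
  positive_functional (fun h => \int[mu]_x h x).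
Proof.
split.
- exact: nnint_ge0.
- exact: nnintD.
- by move=> c h c0; exact: nnintZ.
- exact: nnint_mct.
Qed.

Lemma functional0 I : positive_functional I -> I (fun _ => 0) = 0.
Proof.
move=> II; have := @functionalZ _ II 0%R (fun _ => 0) (lexx _) (nnmfun_cst _ (lexx _)).
by under eq_fun do rewrite mule0; rewrite mul0e.
Qed.

Lemma functional_sum I (A : eqType) (r : seq A) (h : A -> T -> \bar R) :
  positive_functional I -> (forall i, i \in r -> nnmfun (h i)) ->
  I (fun x => \sum_(i <- r) h i x) = \sum_(i <- r) I (h i).
Proof.
move=> II; elim: r => [|i r IHr] hr.
  by under eq_fun do rewrite big_nil; rewrite big_nil functional0.
have hr' j : j \in r -> nnmfun (h j) by move=> jr; apply: hr; rewrite inE jr orbT.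
have nr : nnmfun (fun x => \sum_(j <- r) h j x).
  split; last by move=> x; rewrite big_seq; apply: sume_ge0 => j /hr'[_ +]; exact.
  have -> : (fun x => \sum_(j <- r) h j x) =
      (fun x => \sum_(j <- r) (if j \in r then h j else fun=> 0) x).
    by apply/funext => x; rewrite [LHS]big_seq_cond [RHS]big_seq_cond;
      apply: eq_bigr => j /andP[->].
  apply: emeasurable_sum => j; case: ifPn => [/hr'[]//|_].
  exact: measurable_cst.
under eq_fun do rewrite big_cons.
rewrite (functionalD II)//; last by apply: hr; rewrite inE eqxx.
by rewrite big_cons IHr.
Qed.

Import HBNNSimple.

(** Increasing limits of simple functions reach every nonnegative measurable
    function. *)
Lemma functional_unique I J : positive_functional I -> positive_functional J ->
  (forall B, measurable B -> I (EFin \o \1_B) = J (EFin \o \1_B)) ->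
  forall h, nnmfun h -> I h = J h.
Proof.
move=> II JJ IJ h [mh h0].
have simple (f : {nnsfun T >-> R}) : I (EFin \o f) = J (EFin \o f).
  have f0 x : (0 <= f x)%R by exact: fun_ge0.
  pose r := [seq y <- finmap.enum_fset (fset_set (range f)) | (0 <= y)%R].
  have fE : EFin \o f = (fun x => \sum_(y <- r) (y%:E * (\1_(f @^-1` [set y]) x)%:E)).
    apply/funext => x /=; rewrite fimfunE fsbig_finite//= -sumEFin.
    rewrite big_filter [LHS](bigID (fun y => 0 <= y)%R)/= [X in _ + X]big1 ?adde0//.
    move=> y; rewrite -ltNge => y0; rewrite indicE memNset ?mulr0//= => fxy.
    by have := f0 x; rewrite fxy leNgt y0.
  rewrite fE !functional_sum//; last 2 first.
  - move=> y; rewrite mem_filter => /andP[y0 _]; apply: nnmfunM.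
      by apply: nnmfun_cst; rewrite lee_fin.
    exact: nnmfun_indic.
  - move=> y; rewrite mem_filter => /andP[y0 _]; apply: nnmfunM.
      by apply: nnmfun_cst; rewrite lee_fin.
    exact: nnmfun_indic.
  rewrite !big_seq; apply: eq_bigr => y; rewrite mem_filter => /andP[y0 _].
  have n1 : nnmfun (EFin \o \1_(f @^-1` [set y]) : T -> \bar R) by exact: nnmfun_indic.
  by rewrite (functionalZ II y0 n1) (functionalZ JJ y0 n1) IJ.
pose f_ := nnsfun_approx measurableT mh.
have fn n : nnmfun (EFin \o f_ n).
  by split=> [|x]; [exact/measurable_EFinP|rewrite lee_fin].
have fnd x : nondecreasing_seq (fun n => (EFin \o f_ n) x).
  by move=> a b ab; rewrite lee_fin; exact/lefP/nd_nnsfun_approx.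
have fh x : (EFin \o f_ n) x @[n --> \oo] --> h x by exact: cvg_nnsfun_approx.
have If := functional_cvg II fn fnd fh.
have Jf := functional_cvg JJ fn fnd fh.
have IJf : (fun n => I (EFin \o f_ n)) = (fun n => J (EFin \o f_ n)).
  by apply/funext => n; exact: simple.
by rewrite IJf in If; exact: (cvg_unique _ If Jf).
Qed.

(** Applied to time integrals of transition operators, this turns the potential
    and resolvent operators into kernels. *)
Lemma functional_measure I : positive_functional I ->
  exists nu : {measure set T -> \bar R}, forall h, nnmfun h -> \int[nu]_x h x = I h.
Proof.
move=> II.
pose nu (B : set T) : \bar R := if pselect (measurable B) then I (EFin \o \1_B) else 0.
have nuE B : measurable B -> nu B = I (EFin \o \1_B).
  by rewrite /nu; case: pselect.
have nu0 : nu set0 = 0.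
  rewrite nuE// -[RHS](functional0 II); congr I.
  by apply/funext => x; rewrite /= indic0.
have nu_ge0 B : 0 <= nu B.
  rewrite /nu; case: pselect => // mB; apply: (functional_ge0 II).
  exact: nnmfun_indic.
have nu_add : semi_sigma_additive nu.
  move=> F mF tF mUF.
  have nF i : nnmfun (EFin \o \1_(F i) : T -> \bar R) by exact: nnmfun_indic.
  have -> : (fun n => \sum_(0 <= i < n) nu (F i)) =
      (fun n => I (fun x => \sum_(0 <= i < n) (\1_(F i) x)%:E)).
    apply/funext => n; rewrite (functional_sum II); last by move=> i _; exact: nF.
    by apply: eq_bigr => i _; rewrite nuE.
  rewrite nuE//; apply: (functional_cvg II).
  - move=> n; split; last by move=> x; apply: sume_ge0 => i _; rewrite lee_fin.
    by apply: emeasurable_sum => i; have [] := nF i.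
  - move=> x; apply/nondecreasing_seqP => n; rewrite big_nat_recr//=.
    by rewrite leeDl// lee_fin.
  - move=> x; rewrite /= indicE; have [xF|xF] := boolP (x \in _).
      have [k _ Fkx] : (\bigcup_n F n) x by rewrite inE in xF.
      apply: cvg_near_cst; exists k.+1 => //= n kn.
      rewrite (bigD1_seq k)/= ?iota_uniq ?mem_index_iota//.
      rewrite big1 ?adde0; first by rewrite indicE mem_set.
      move=> i ik; rewrite indicE memNset// => Fix.
      move/trivIsetP : tF => /(_ i k Logic.I Logic.I ik)/seteqP[+ _].
      by move=> /(_ x); apply.
    apply: cvg_near_cst; apply: nearW => n; rewrite big1// => i _.
    rewrite indicE memNset// => Fix; move: xF; rewrite notin_setE; apply.
    by exists i.
pose mixin := isMeasure.Build _ _ _ nu nu0 nu_ge0 nu_add.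
pose nu' : {measure set T -> \bar R} := HB.pack nu mixin.
exists nu' => h nh.
apply: (functional_unique (integral_positive_functional nu') II _ nh) => B mB.
by rewrite -(nuE _ mB) -[RHS]/(nu' B) -[in RHS](setIT B) -integral_indic.
Qed.

End PositiveFunctional.

Lemma mixture_measure d1 d2 (Y : measurableType d1) (Z : measurableType d2)
    (R : realType) (mu : {measure set Y -> \bar R})
    (k : Y -> {measure set Z -> \bar R}) :
  (forall U, measurable U -> measurable_fun setT (k ^~ U)) ->
  exists nu : {measure set Z -> \bar R},
    (forall U, measurable U -> nu U = \int[mu]_y k y U) /\
    (forall h, nnmfun h -> nnmfun (fun y => \int[k y]_z h z) /\
       \int[nu]_z h z = \int[mu]_y \int[k y]_z h z).
Proof.
move=> mk.
have nk h : nnmfun h -> nnmfun (fun y => \int[k y]_z h z).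
  move=> [mh h0]; split; last by move=> y; exact: integral_ge0.
  exact: measurable_fun_integral_kernel.
have [|nu nuE] := @functional_measure _ Z R (fun h => \int[mu]_y \int[k y]_z h z).
  split.
  - by move=> h /nk; exact: nnint_ge0.
  - move=> g h hg hh; rewrite -nnintD//; last 2 first.
      exact: nk.
      exact: nk.
    by apply: eq_integral => y _; exact: nnintD.
  - move=> c h c0 hh; rewrite -nnintZ//; last exact: nk.
    by apply: eq_integral => y _; exact: nnintZ.
  - move=> u_ h nu_ und uh; apply: nnint_mct.
    + by move=> n; exact: nk.
    + by move=> y m n mn; apply: nnint_le => // x; exact: und.
    + by move=> y; exact: nnint_mct.
exists nu; split => [U mU|h hh]; last by split; [exact: nk|exact: nuE].
rewrite -[U in LHS]setIT -integral_indic// nuE; last exact: nnmfun_indic.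
by apply: eq_integral => y _; rewrite integral_indic// setIT.
Qed.

Lemma lebesgue_integral_shift (R : realType) (h : R -> \bar R) (a : R) :
  nnmfun h ->
  \int[lebesgue_measure]_x h (x + a)%R = \int[lebesgue_measure]_x h x.
Proof.
move=> [mh h0].
pose sh : measurableTypeR R -> measurableTypeR R := fun x => (x + a)%R.
have msh : measurable_fun setT sh by exact: measurable_funD.
rewrite -[LHS](@ge0_integral_pushforward _ _ _ _ _ sh msh lebesgue_measure setT h)//.
pose mixin := isMeasurableFun.Build _ _ _ _ _ msh.
pose shp : {mfun _ >-> _} := HB.pack sh mixin.
have E (A : set (measurableTypeR R)) : measurable A -> lebesgue_measure A = pushforward lebesgue_measure shp A.
  apply: lebesgue_measure_unique => _ [[b c]] _ <-.
  have shE : sh @^-1` `]b, c]%classic = `](b - a)%R, (c - a)%R]%classic.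
    by apply/seteqP; split => x/=; rewrite /sh !in_itv/= ltrBlDr lerBrDr.
  rewrite -[RHS]/(lebesgue_measure (sh @^-1` `]b, c]%classic)) shE.
  by rewrite !lebesgue_measure_itv/= !lte_fin ltrD2r -!EFinD opprB addrA subrK.
by apply: eq_measure_integral => A mA _; exact/esym/E.
Qed.

(** Sampling the first variable at the next point of the grid of mesh 1/(n+1) gives
    countably many measurable pieces, and right continuity turns the samples
    into a pointwise convergent sequence. *)
Lemma right_continuous_measurable d (T : measurableType d) (R : realType)
    (f : R -> T -> R) :
  (forall t, measurable_fun setT (f t)) ->
  (forall x t, f s x @[s --> t^'+] --> f t x) ->
  measurable_fun setT (fun z : R * T => f z.1 z.2).
Proof.
move=> mf rcf.
pose s n (t : R) : R := ((Num.floor (t * n.+1%:R) + 1)%:~R / n.+1%:R)%R.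
apply: (@measurable_fun_cvg _ _ _ setT (fun n (z : R * T) => f (s n z.1) z.2)).
- move=> n.
  have mI (k : int) : measurable [set z : R * T | Num.floor (z.1 * n.+1%:R) = k].
    have -> : [set z : R * T | Num.floor (z.1 * n.+1%:R) = k] =
      fst @^-1` (`[(k%:~R / n.+1%:R)%R, ((k + 1)%:~R / n.+1%:R)%R[%classic : set R).
      apply/seteqP; split => z /=; rewrite in_itv/=.
        move=> <-; rewrite ler_pdivrMr ?ltr0n// ltr_pdivlMr ?ltr0n//.
        by rewrite floor_le floorD1_gt.
      rewrite ler_pdivrMr ?ltr0n// ltr_pdivlMr ?ltr0n// => kk.
      exact: floor_def.
    rewrite -[X in measurable X]setTI.
    exact: measurable_fst.
  move=> _ B mB; rewrite setTI.
  rewrite [X in measurable X](_ : _ = \bigcup_(k : int)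
    ([set z : R * T | Num.floor (z.1 * n.+1%:R) = k] `&`
     (snd @^-1` (f ((k + 1)%:~R / n.+1%:R)%R @^-1` B)))); last first.
    apply/seteqP; split => [z/= Bz|z [k _] /=].
      by exists (Num.floor (z.1 * n.+1%:R)).
    by rewrite /s => -[->].
  apply: countable_bigcupT_measurable => [|k]; first exact: countableP.
  apply: measurableI => //.
  rewrite -[X in measurable X]setTI.
  apply: measurable_snd => //.
  by rewrite -[X in measurable X]setTI; exact: mf.
- move=> [t x] _ /=.
  have st n : (t < s n t <= t + n.+1%:R^-1)%R.
    rewrite /s ltr_pdivlMr ?ltr0n// ler_pdivrMr ?ltr0n// mulrDl mulVf// floorD1_gt/=.
    by rewrite intrD lerD2r floor_le.
  have := (cvg_at_rightP (f ^~ x) t (f t x)).1 (rcf x t).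
  move=> /(_ (fun n => s n t)); apply; split.
    by move=> n; have /andP[] := st n.
  apply: (@squeeze_cvgr _ _ _ _ (cst t) (fun n => (t + n.+1%:R^-1)%R)).
  - by apply: nearW => n; have /andP[/ltW -> ->] := st n.
  - exact: cvg_cst.
  - rewrite -[X in _ --> X]addr0; apply: cvgD; first exact: cvg_cst.
    exact: cvg_harmonic.
Qed.

(** * The transition kernels of a Hunt process *)

Section OpenSets.
Context {R : realType} (E : pmetricType R).

(** The truncated distance to the complement of an open set is a continuous
    function that is positive exactly on this set; it replaces indicators of
    open sets wherever right continuity in time is needed. *)
Lemma open_positivity_set (U : set E) : open U ->
  exists phi : E -> R, [/\ continuous phi, (forall x, 0 <= phi x <= 1)%R &
    forall x, (0 < phi x)%R <-> U x].
Proof.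
move=> oU; pose dU := @edist_inf R E (~` U); pose phi x := fine (mine 1 (dU x)).
have phiE x : (phi x)%:E = mine 1 (dU x).
  rewrite fineK// ge0_fin_numE; first by rewrite gt_min ltry.
  by rewrite le_min lee01 edist_inf_ge0.
have phi0 x : (0 <= phi x)%R.
  by rewrite -lee_fin phiE le_min lee01 edist_inf_ge0.
have lip x y e : (0 < e)%R -> ball x e y -> (phi x <= e + phi y)%R.
  move=> e0 xy; rewrite -lee_fin EFinD !phiE.
  have xye : dU x <= e%:E + dU y.
    apply: (le_trans (edist_inf_triangle _ x y)).
    by apply: leeD2r; exact: edist_fin.
  rewrite [leRHS]addeC; have [dy|dy] := leP 1 (dU y).
    rewrite ge_min; apply/orP; left.
    by rewrite leeDl// lee_fin ltW.
  by rewrite ge_min; apply/orP; right; rewrite addeC.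
exists phi; split.
- move=> x; apply/cvgrPdist_le => e e0.
  have : nbhs x (ball x e) by exact: nbhsx_ballx.
  apply: filterS => y xy; have h1 := lip _ _ _ e0 xy.
  have h2 := lip _ _ _ e0 (ball_sym xy).
  by rewrite ler_norml; apply/andP; split; lra.
- by move=> x; rewrite phi0/= -lee_fin phiE ge_min lexx.
- move=> x; rewrite -lte_fin phiE lt_min lte01/=; split.
    by apply: contraPP => Ux; rewrite [dU x](@edist_inf0 _ _ (~` U) x)// ltxx.
  move=> Ux; have [r r0 rU] : exists2 r : R, (0 < r)%R & ball x r `<=` U.
    by have := oU; rewrite openE => /(_ _ Ux)/nbhs_ballP[r/= r0 rU]; exists r.
  apply: (@lt_le_trans _ _ r%:E); first by rewrite lte_fin.
  apply: le_ereal_inf_tmp => _ [a Ua <-]; rewrite leNgt; apply/negP => /edist_lt_ball/= xa.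
  exact/Ua/rU.
Qed.

End OpenSets.

Record markov_kernels d (T : measurableType d) (R : realType)
    (p : R -> T -> {measure set T -> \bar R}) : Prop := {
  kernel_le1 : forall t x, p t x setT <= 1 ;
  kernel_measurable : forall B, measurable B ->
    measurable_fun setT (fun z : R * T => p z.1 z.2 B) ;
  kernel_semigroup : forall s t x h, (0 <= s)%R -> (0 <= t)%R -> nnmfun h ->
    \int[p (s + t)%R x]_y h y = \int[p s x]_y \int[p t y]_z h z }.

Section HuntKernels.
Context {R : realType} (E : pmetricType R).
Local Notation state := (one_point_compactification E).
Context dO (Omega : measurableType dO).
Variables (X : R -> Omega -> state) (P : state -> probability Omega R).
Hypothesis HX : hunt_process X P.

(* Freezing the process at its initial position for negative times lets time
   range over the whole line. *)
Let Y (t : R) w := X (Num.max t 0)%R w.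

Lemma measurable_some_image (B : set (borel E)) : measurable B ->
  measurable (Some @` B : set (borel state)).
Proof.
pose C : set (set (borel E)) := [set B | measurable (Some @` B : set (borel state))].
suff : <<s @open E >> `<=` C by apply.
have mT : C setT.
  apply: sub_sigma_algebra; apply: one_point_compactification_open_some.
  exact: openT.
apply: smallest_sub; last first.
  by move=> U oU; apply: sub_sigma_algebra; exact: one_point_compactification_open_some.
split.
- by rewrite /C/= image_set0.
- move=> A CA; rewrite /C/=.
  rewrite (_ : Some @` _ = Some @` setT `\` Some @` A); first exact: measurableD.
  apply/seteqP; split => [_ [x [_ Ax] <-]|_ [[x _ <-] nA]].
    by split; [exists x|case=> y Ay [yx]; apply: Ax; rewrite -yx].
  by exists x => //; split => // Ax; apply: nA; exists x.
- move=> F CF; rewrite /C/= image_bigcup.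
  by apply: bigcupT_measurable.
Qed.

Let mY t (B : set (borel E)) : measurable B -> measurable (Y t @^-1` (Some @` B)).
Proof.
move=> mB; rewrite -[X in measurable X]setTI.
apply: (hunt_measurable HX) => //; first by rewrite le_max lexx orbT.
exact: measurable_some_image.
Qed.

Let ext (phi : E -> R) (y : state) : R := if y is Some x then phi x else 0%R.

Let ext_right_continuous (phi : E -> R) t w : continuous phi ->
  ext phi (Y s w) @[s --> t^'+] --> ext phi (Y t w).
Proof.
move=> cphi; have [t0|t0] := ltP t 0%R.
  apply: cvg_near_cst; near=> s.
  rewrite /Y (max_idPr (ltW t0)) (max_idPr _)//.
  by near: s; apply: nbhs_right_le.
have := @hunt_right_continuous _ _ _ _ _ _ HX t w t0.
rewrite {2}/Y (max_idPl t0).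
have near_Y : \forall s \near t^'+, X s w = Y s w.
  near=> s; rewrite /Y (max_idPl _)//; apply: (le_trans t0).
  by near: s; apply: nbhs_right_ge.
case XE : (X t w) => [y|] Xc /=.
  have : ext phi (X s w) @[s --> t^'+] --> phi y.
    move=> V /cphi/= Vy.
    have /Xc Xs : @nbhs _ state (Some y) (Some @` (phi @^-1` V)).
      exact: one_point_compactification_some_nbhs.
    have {}Xs : \forall s \near t^'+, (Some @` (phi @^-1` V)) (X s w) by exact: Xs.
    change (\forall s \near t^'+, V (ext phi (X s w))).
    by apply: filterS Xs => s [z Vz zs]; rewrite /= -zs.
  move=> Xphi; apply: cvg_trans Xphi; apply: near_eq_cvg; move: near_Y.
  by apply: filterS => s ->.
apply: cvg_near_cst; near=> s; rewrite /Y (max_idPl _)//; last first.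
  by apply: (le_trans t0); near: s; apply: nbhs_right_ge.
rewrite (hunt_cemetery HX t0 _ XE)//.
Unshelve. all: by end_near. Qed.

Let continuous_borel (phi : E -> R) : continuous phi ->
  measurable_fun setT (phi : borel E -> R).
Proof.
move=> cphi; apply: (measurability _ (RGenOpens.measurableE R)).
move=> _ [_ [a [b ->] <-]]; rewrite setTI.
apply: sub_sigma_algebra; apply: open_comp; first by move=> ? _; exact: cphi.
exact: interval_open.
Qed.

Let measurable_ext (phi : E -> R) t : continuous phi ->
  measurable_fun setT (ext phi \o Y t).
Proof.
move=> cphi _ B mB; rewrite setTI.
have mN : measurable (Y t @^-1` [set None]).
  rewrite (_ : _ @^-1` _ = ~` (Y t @^-1` (Some @` setT))).
    by apply: measurableC; exact: mY.
  apply/seteqP; split => w /=; first by move=> -> [].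
  by case: (Y t w) => // y []; exists y.
have mphi : measurable (phi @^-1` B : set (borel E)).
  by rewrite -[X in measurable X]setTI; exact: continuous_borel.
rewrite (_ : _ @^-1` B = Y t @^-1` (Some @` (phi @^-1` B)) `|`
  (Y t @^-1` [set None] `&` [set _ | B 0%R])).
  apply: measurableU; first exact: mY.
  have [B0|B0] := pselect (B 0%R).
    by rewrite (_ : [set _ | _] = setT) ?setIT//; apply/seteqP; split.
  by rewrite (_ : [set _ | _] = set0) ?setI0//; apply/seteqP; split.
apply/seteqP; split => w /=.
  by case: (Y t w) => [y|] /= By; [left; exists y|right].
by move=> [[y By <-]//|[-> B0]].
Qed.

(** Right continuity makes the position jointly measurable: an open set is the
    positivity set of a continuous function of the position, and these
    generate. *)
Let measurable_position (B : set (borel E)) : measurable B ->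
  measurable [set z : R * Omega | (Some @` B) (Y z.1 z.2)].
Proof.
pose C : set (set (borel E)) := [set B | measurable [set z : R * Omega | (Some @` B) (Y z.1 z.2)]].
suff : <<s @open E >> `<=` C by apply.
have oC : @open E `<=` C.
  move=> U /open_positivity_set[phi [cphi phi01 phiU]].
  have mf : measurable_fun setT (fun z : R * Omega => ext phi (Y z.1 z.2)).
    apply: (@right_continuous_measurable _ _ _ (fun t w => ext phi (Y t w))) => [t|w t]; first exact: measurable_ext.
    exact: ext_right_continuous.
  have := mf measurableT `]0%R, +oo[%classic (measurable_itv _).
  rewrite setTI; congr measurable; apply/seteqP; split => z /=; rewrite in_itv/= andbT.
    by case: (Y _ _) => [y|]/=; rewrite ?ltxx// => /phiU Uy; exists y.
  by move=> [y /phiU py <-].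
have CT : C setT by apply: oC; exact: openT.
apply: smallest_sub => //; split.
- rewrite /C/= (_ : [set _ | _] = set0)//.
  by apply/seteqP; split => // z [y []].
- move=> A CA; rewrite /C/=.
  rewrite (_ : [set _ | _] = [set z : R * Omega | (Some @` setT) (Y z.1 z.2)] `\`
    [set z : R * Omega | (Some @` A) (Y z.1 z.2)]); first exact: measurableD.
  apply/seteqP; split => z.
    move=> [x [_ Ax] xz]; split; first by exists x.
    by move=> [y Ay]; rewrite -xz => -[yx]; apply: Ax; rewrite -yx.
  by move=> [[x _ xz] nA]; exists x => //; split => // Ax; apply: nA; exists x.
- move=> F CF; rewrite /C/=.
  rewrite (_ : [set _ | _] = \bigcup_i [set z : R * Omega | (Some @` F i) (Y z.1 z.2)]).
    exact: bigcupT_measurable.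
  apply/seteqP; split => z.
    by move=> [y [i _ Fy] yz]; exists i => //; exists y.
  by move=> [i _ [y Fy yz]]; exists y => //; exists i.
Qed.

(* The zero measure at the cemetery makes integration against [pos y] the
   extension by 0 of functions on E. *)
Let pos (y : state) : {measure set (borel E) -> \bar R} :=
  if y is Some x then \d_ (x : borel E) else mzero.

Let posE (y : state) (B : set (borel E)) : pos y B = (\1_(Some @` B) y)%:E.
Proof.
rewrite indicE; case: y => [x|]/=.
  rewrite diracE; congr ((nat_of_bool _)%:R%:E); apply/idP/idP; rewrite !inE.
    by move=> Bx; exists x.
  by move=> [y By [<-]].
by rewrite /mzero memNset//= => -[].
Qed.

Let integral_pos y h : nnmfun (h : borel E -> \bar R) ->
  \int[pos y]_x h x = cemetery_ext h y.
Proof.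
move=> [mh h0]; case: y => [x|]/=; last by rewrite integral_measure_zero.
by rewrite integral_dirac// diracT mul1e.
Qed.

Let measurable_pos (B : set (borel E)) : measurable B ->
  measurable_fun setT (fun z : R * Omega => pos (Y z.1 z.2) B).
Proof.
move=> mB; rewrite (_ : (fun _ => _) =
  EFin \o \1_[set z : R * Omega | (Some @` B) (Y z.1 z.2)]).
  by apply/measurable_EFinP/measurable_indic; exact: measurable_position.
by apply/funext => z /=; rewrite posE !indicE; congr ((nat_of_bool _)%:R%:E); apply/idP/idP; rewrite !inE.
Qed.

Let measurable_pos_at t (B : set (borel E)) : measurable B ->
  measurable_fun setT (fun w => pos (Y t w) B).
Proof.
by move=> mB; apply: (measurableT_comp (measurable_pos mB) (pair1_measurable t)).
Qed.

Lemma position_law_exists (z : R * E) :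
  exists nu : {measure set (borel E) -> \bar R},
    (forall B : set (borel E), measurable B -> nu B = P (Some z.2) (Y z.1 @^-1` (Some @` B))) /\
    (forall h : borel E -> \bar R, nnmfun h -> nnmfun (fun w => cemetery_ext h (Y z.1 w)) /\
       \int[nu]_x h x = \int[P (Some z.2)]_w cemetery_ext h (Y z.1 w)).
Proof.
have [nu [nuE inu]] := @mixture_measure _ _ _ _ _ (P (Some z.2)) (pos \o Y z.1) (measurable_pos_at z.1).
exists nu; split => [B mB|h hh].
  rewrite nuE//=; under eq_integral do rewrite posE.
  rewrite -[X in _ = P _ X]setIT -integral_indic//; last exact: mY.
have [nh ->] := inu h hh.
have E1 : (fun w => cemetery_ext h (Y z.1 w)) = (fun w => \int[(pos \o Y z.1) w]_x h x).
  by apply/funext => w /=; rewrite integral_pos.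
by rewrite E1.
Qed.

Let none_absorbing t (B : set (borel E)) : measurable B -> (0 <= t)%R ->
  P None (X t @^-1` (Some @` B)) = 0.
Proof.
move=> mB t0; apply/eqP; rewrite -measure_le0.
have mN : measurable (Y 0 @^-1` (Some @` (setT : set (borel E)))) by exact: mY.
have X0 : X 0%R @^-1` [set None] = ~` (Y 0 @^-1` (Some @` (setT : set (borel E)))).
  rewrite /Y (max_idPl (lexx 0%R)); apply/seteqP; split => w /=.
    by move=> -> [].
  by case: (X 0%R w) => // y []; exists y.
have /(congr1 (fun z => 1 - z)) := hunt_normal HX None.
rewrite X0 probability_setC// subee//.
have -> : 1 - (1 - P None (Y 0 @^-1` (Some @` (setT : set (borel E))))) =
    P None (Y 0 @^-1` (Some @` (setT : set (borel E)))).
  have : P None (Y 0 @^-1` (Some @` (setT : set (borel E)))) \is a fin_num.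
    by rewrite fin_num_measure.
  by case: (P None _) => // r _; rewrite -!EFinB opprB addrC subrK.
move=> <-; apply: le_measure; rewrite ?inE//.
  by rewrite (_ : X t = Y t); [exact: mY|rewrite /Y (max_idPl t0)].
move=> w [y By Xy]; case XE : (Y 0 w) => [z|]; first by exists z.
move: XE; rewrite /Y (max_idPl (lexx 0%R)) => XE.
have XN := hunt_cemetery HX (lexx 0%R) t0 XE.
by move: Xy; rewrite XN.
Qed.

Let constant_time (F : R -> set (set Omega)) (s : R) : (0 <= s)%R ->
  admissible_filtration X F -> stopping_time F (fun _ => s%:E) /\
  stopped_events F (fun _ => s%:E) setT.
Proof.
move=> s0 aF.
have FT t (Q : Prop) : (0 <= t)%R -> F t [set _ | Q].
  move=> t0; have [F0 FC _] := filtration_sigma aF t0.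
  have [q|q] := pselect Q.
    by rewrite (_ : [set _ | _] = setT `\` set0);
      [exact: FC|rewrite setD0; apply/seteqP; split].
  by rewrite (_ : [set _ | _] = set0)//; apply/seteqP; split.
split; first by split => [w|t t0]; [rewrite lee_fin|exact: FT].
by split=> [//|t t0]; rewrite setTI; exact: FT.
Qed.

(** Chapman-Kolmogorov is the strong Markov property at constant times; the
    potential operator is the time integral of the kernels by Tonelli, for
    which right continuity of the paths provides joint measurability. *)
Lemma hunt_kernels :
  exists p : R -> E -> {measure set (borel E) -> \bar R},
  [/\ markov_kernels (T := borel E) p,
      forall t x (h : borel E -> \bar R), (0 <= t)%R -> nnmfun h ->
        transition X P t h x = \int[p t x]_y h y &
      forall x (h : borel E -> \bar R), nnmfun h ->
        potential X P h x =
        \int[lebesgue_measure]_s ((\1_(`[0%R, +oo[%classic) s)%:E * \int[p s x]_y h y)].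
Proof.
have [q qP] := choice position_law_exists.
pose p t x := q (t, x).
have pE t x (B : set (borel E)) : measurable B -> p t x B = P (Some x) (Y t @^-1` (Some @` B)).
  exact: (qP (t, x)).1.
have pn t (x : E) (h : borel E -> \bar R) : nnmfun h -> nnmfun (fun w => cemetery_ext h (Y t w)).
  by move=> hh; have [] := (qP (t, x)).2 h hh.
have pint t (x : E) (h : borel E -> \bar R) : nnmfun h ->
    \int[p t x]_y h y = \int[P (Some x)]_w cemetery_ext h (Y t w).
  by move=> hh; have [] := (qP (t, x)).2 h hh.
have p1 t x : p t x setT <= 1 by rewrite pE// probability_le1//; exact: mY.
have mp t (B : set (borel E)) : measurable B ->
    measurable_fun setT ((fun x => p t x B) : borel E -> \bar R).
  move=> mB; apply: (eq_measurable_fun (fun x : borel E => P (Some x) (Y t @^-1` (Some @` B)))).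
    by move=> x _; rewrite pE.
  apply: (hunt_transition HX); first by rewrite le_max lexx orbT.
  exact: measurable_some_image.
have mpint t (h : borel E -> \bar R) : nnmfun h ->
    measurable_fun setT ((fun x => \int[p t x]_y h y) : borel E -> \bar R).
  move=> [mh h0]; apply: (measurable_fun_integral_kernel (X := borel E)) => //.
  exact: mp.
have cont_meas (phi : E -> R) : continuous phi -> (forall x, 0 <= phi x <= 1)%R ->
    measurable_fun setT (fun z : R * borel E => \int[p z.1 z.2]_y (phi y)%:E).
  move=> cphi phi01.
  have nphi : nnmfun (EFin \o phi : borel E -> \bar R).
    split; first by apply/measurable_EFinP; exact: continuous_borel.
    by move=> x; rewrite lee_fin; have /andP[] := phi01 x.
  have phi_fin t x : \int[p t x]_y (phi y)%:E \is a fin_num.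
    rewrite ge0_fin_numE; last exact: (nnint_ge0 _ nphi).
    apply: (@le_lt_trans _ _ (\int[p t x]_y cst 1 y)).
      apply: (nnint_le _ nphi); first exact: nnmfun_cst.
      by move=> y; rewrite lee_fin; have /andP[] := phi01 y.
    by rewrite integral_cst// mul1e (le_lt_trans (p1 _ _))// ltry.
  apply: (eq_measurable_fun (fun z : R * borel E => (fine (\int[p z.1 z.2]_y (phi y)%:E))%:E)).
    by move=> z _; rewrite fineK.
  apply/measurable_EFinP.
  apply: (@right_continuous_measurable _ (borel E) _
    (fun t x => fine (\int[p t x]_y (phi y)%:E))) => [t|x t].
    exact: (measurableT_comp (fine_measurable measurableT) (mpint t _ nphi)).
  apply/cvg_at_rightP => u [ut tu].
  apply: fine_cvg; rewrite fineK//.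
  rewrite pint//; under eq_fun do rewrite pint//.
  apply: (@nnint_dct _ _ _ _ _ _ (cst 1)) => //.
  - by move=> n; exact: pn.
  - exact: pn.
  - apply: nearW => w.
    have extE s : cemetery_ext (EFin \o phi) (Y s w) = (ext phi (Y s w))%:E.
      by case: (Y s w).
    rewrite extE; under eq_fun do rewrite extE.
    apply: cvg_EFin; first exact: nearW.
    have := @ext_right_continuous phi t w cphi.
    by move=> /cvg_at_rightP; apply; split.
  - by move=> n w; case: (Y _ w) => [y|]//=; rewrite lee_fin; have /andP[] := phi01 y.
  - by rewrite integral_cst// mul1e (le_lt_trans (probability_le1 _ measurableT))// ltry.
have mp2 (B : set (borel E)) : measurable B ->
    measurable_fun setT (fun z : R * borel E => p z.1 z.2 B).
  have opens (U : set E) : open U ->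
      measurable_fun setT (fun z : R * borel E => p z.1 z.2 U).
    move=> /[dup] oU /open_positivity_set[phi [cphi phi01 phiU]].
    have mU : measurable (U : set (borel E)) by exact: sub_sigma_algebra.
    pose phin n (x : E) : R := Num.min 1%R (n%:R * phi x)%R.
    have phin01 n x : (0 <= phin n x <= 1)%R.
      have /andP[phi0 _] := phi01 x.
      by rewrite /phin le_min ler01 mulr_ge0//= ge_min lexx.
    have cphin n : continuous (phin n).
      move=> x; apply: (@continuous_min R E (fun=> 1%R) (fun x => n%:R * phi x)%R).
        exact: cvg_cst.
      by apply: cvgM; [exact: cvg_cst|exact: cphi].
    apply: (@emeasurable_fun_cvg _ _ _ _ (fun n (z : R * borel E) => \int[p z.1 z.2]_y (phin n y)%:E)).
      by move=> n; exact: cont_meas.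
    move=> z _; have := @nnint_mct _ (borel E) R (p z.1 z.2) (fun n => EFin \o phin n)
      (EFin \o \1_U); rewrite /= integral_indic// setIT; apply.
    - move=> n; split; first by apply/measurable_EFinP; exact: continuous_borel.
      by move=> x; rewrite lee_fin; have /andP[] := phin01 n x.
    - move=> x m n mn; rewrite lee_fin /phin.
      rewrite le_min ge_min lexx/= ge_min; apply/orP; right.
      by rewrite ler_wpM2r ?ler_nat//; have /andP[] := phi01 x.
    - move=> x; apply: cvg_EFin; first exact: nearW.
      rewrite indicE; have [xU|xU] := boolP (x \in U).
        have phix : (0 < phi x)%R by apply/phiU; rewrite inE in xU.
        apply: cvg_near_cst; near=> n; rewrite /phin/= (min_idPl _)//.
        rewrite -ler_pdivrMr// div1r; apply: (le_trans (ltW (truncnS_gt _))).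
        by rewrite ler_nat; near: n; exact: nbhs_infty_ge.
      apply: cvg_near_cst; apply: nearW => n; rewrite /phin/=.
      have -> : phi x = 0%R.
        apply/eqP; rewrite eq_le (andP (phi01 x)).1 andbT leNgt; apply/negP => /phiU.
        by move: xU; rewrite notin_setE.
      by rewrite mulr0 (min_idPr _).
  apply: (@dynkin_induction _ (borel E) (@open E)
    (fun B => measurable_fun setT (fun z : R * borel E => p z.1 z.2 B))) => //.
  - exact: openI.
  - by apply: opens; exact: openT.
  - move=> S mS pS.
    apply: (eq_measurable_fun (fun z : R * borel E => p z.1 z.2 setT - p z.1 z.2 S)).
      move=> z _; rewrite -setTD measureD// ?setTI//.
      by rewrite (le_lt_trans (p1 _ _))// ltry.
    by apply: emeasurable_funB => //; apply: opens; exact: openT.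
  - move=> F mF tF pF.
    apply: (@emeasurable_fun_cvg _ _ _ _
      (fun n (z : R * borel E) => \sum_(0 <= i < n) p z.1 z.2 (F i))).
      by move=> n; exact: emeasurable_sum.
    move=> z _; apply: measure_semi_sigma_additive => //.
    exact: bigcupT_measurable.
exists p; split.
- split => // s t x h s0 t0 hh.
  have [nu [nuE inu]] := @mixture_measure _ _ _ _ _ (p s x) (p t : borel E -> _) (mp t).
  rewrite -(inu h hh).2; apply: eq_measure_integral => B mB _.
  have st0 : (0 <= s + t)%R by exact: addr_ge0.
  have [F [aF sF _]] := hunt_strong_markov HX.
  have [ts ss] := constant_time s0 aF.
  have mB' : measurable (Some @` B : set (borel state)) by exact: measurable_some_image.
  have := sF (Some x) _ t _ _ ts t0 mB' ss.
  rewrite !setTI (_ : [set w | _] = Y (s + t)%R @^-1` (Some @` B)); last first.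
    by rewrite /Y (max_idPl st0)/=; apply/seteqP; split => [w []//|w]; split => //; exact: ltry.
  rewrite -pE// => ->.
  have hB : nnmfun ((fun y => p t y B) : borel E -> \bar R) by split; first exact: mp.
  rewrite [RHS]nuE// pint//.
  rewrite (_ : [set _ | _ < _] = setT); last by apply/seteqP; split => // w _ /=; exact: ltry.
  apply: eq_integral => w _ /=; rewrite /Y (max_idPl s0).
  case: (X s w) => [y|] /=; last exact: none_absorbing.
  by rewrite pE// /Y (max_idPl t0).
- by move=> t x h t0 hh; rewrite pint// /transition /Y (max_idPl t0).
- move=> x h hh; rewrite /potential.
  pose F (z : Omega * R) := (\1_(`[0%R, +oo[%classic) z.2)%:E * cemetery_ext h (Y z.2 z.1).
  have nF : nnmfun F.
    apply: nnmfunM.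
      exact: (nnmfun_comp measurable_snd (nnmfun_indic _ (measurable_itv _))).
    split; last by move=> z /=; case: (Y _ _) => //= y; case: hh.
    apply: (eq_measurable_fun (fun z : Omega * R => \int[pos (Y z.2 z.1)]_y h y)).
      by move=> z _; rewrite integral_pos.
    case: (hh) => mh h0; apply: (measurable_fun_integral_kernel (X := (Omega * R)%type)) => //.
    move=> U mU; apply: (measurableT_comp (measurable_pos mU) (g := fun z : Omega * R => (z.2, z.1))).
    exact: measurable_swap.
  have [_ _ tF] := @tonelli _ _ _ _ _ (P (Some x)) lebesgue_measure F
    (sigma_finite_le1 (probability_le1 _ measurableT)) (sigma_finiteT _) nF.
  transitivity (\int[P (Some x)]_w \int[lebesgue_measure]_s F (w, s)).
    apply: eq_integral => w _; rewrite integral_mkcond; apply: eq_integral => s _.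
    rewrite /F/= patchE indicE; case: ifPn => [s0|s0]; last by rewrite mul0e.
    by rewrite mul1e /Y (max_idPl _)//; move: s0; rewrite inE/= in_itv/= andbT.
  rewrite tF; apply: eq_integral => s _; rewrite /F/= nnintZ//; last exact: pn.
    by rewrite pint.
Unshelve. all: by end_near. Qed.

End HuntKernels.

(** * Resolvents *)

Lemma limn_einf_le (R : realType) (u v : (\bar R)^nat) :
  (forall n, u n <= v n) -> limn_einf u <= limn_einf v.
Proof.
move=> uv; rewrite !limn_einf_lim; apply: lee_lim.
- exact: is_cvg_einfs.
- exact: is_cvg_einfs.
- apply: nearW => n; apply: le_ereal_inf_tmp => _ [k/= nk <-].
  by apply: (le_trans _ (uv k)); apply: ereal_inf_lbound; exists k.
Qed.

Section HalfLine.
Context {R : realType}.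
Implicit Types (s t v : R) (n : nat).
Local Notation leb := (@lebesgue_measure R).

Definition halfline s : \bar R := (\1_(`[0%R, +oo[%classic) s)%:E.

Definition exp_density n s : \bar R := (exponential_pdf n.+1%:R s)%:E.

Definition convolution (a b : R -> \bar R) v : \bar R :=
  \int[leb]_s (a s * b (v - s)%R).

Definition exp_cdf n v : R := (1 - expR (- (n.+1%:R * v)))%R.

Lemma nnmfun_halfline : nnmfun halfline.
Proof. by apply: nnmfun_indic; exact: measurable_itv. Qed.

Lemma nnmfun_exp_density n : nnmfun (exp_density n).
Proof.
split; first by apply/measurable_EFinP; exact: measurable_exponential_pdf.
by move=> s; rewrite lee_fin exponential_pdf_ge0// ler0n.
Qed.

Lemma halfline_ge0 s : (0 <= s)%R -> halfline s = 1.
Proof. by move=> s0; rewrite /halfline indicE mem_set//= in_itv/= s0. Qed.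

Lemma halfline_lt0 s : (s < 0)%R -> halfline s = 0.
Proof. by move=> s0; rewrite /halfline indicE memNset//= in_itv/= andbT leNgt s0. Qed.

Lemma exp_density_lt0 n s : (s < 0)%R -> exp_density n s = 0.
Proof. by move=> s0; rewrite /exp_density lt0_exponential_pdf. Qed.

Lemma exp_cdf_ge0 n v : (0 <= v)%R -> (0 <= exp_cdf n v)%R.
Proof.
move=> v0; rewrite /exp_cdf subr_ge0 -[leRHS]expR0 ler_expR oppr_le0.
by rewrite mulr_ge0.
Qed.

Lemma exp_cdf_lt1 n v : (exp_cdf n v < 1)%R.
Proof. by rewrite /exp_cdf ltrBlDr ltrDl expR_gt0. Qed.

Lemma le_exp_cdf n v w : (v <= w)%R -> (exp_cdf n v <= exp_cdf n w)%R.
Proof.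
by move=> vw; rewrite /exp_cdf lerD2l lerN2 ler_expR lerN2 ler_wpM2l.
Qed.

Lemma measurable_exp_cdf n : measurable_fun setT (exp_cdf n).
Proof.
apply: measurable_funB => //; apply: measurableT_comp => //.
by apply: measurableT_comp => //; exact: measurable_funM.
Qed.

Lemma nnmfun_convolution (a b : R -> \bar R) :
  nnmfun a -> nnmfun b -> nnmfun (convolution a b).
Proof.
move=> na nb; pose f (z : R * R) := a z.2 * b (z.1 - z.2)%R.
have [mf f0] : nnmfun f.
  apply: nnmfunM; first exact: (nnmfun_comp measurable_snd na).
  by apply: (nnmfun_comp (p := fun z : R * R => (z.1 - z.2)%R) _ nb); exact: measurable_funB.
split; last by move=> v; apply: integral_ge0 => s _; exact: (f0 (v, s)).
exact: (@measurable_fun_fubini_tonelli_F _ _ _ _ _ leb f mf f0).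
Qed.

Lemma exp_density_halfline n v : convolution (exp_density n) halfline v =
  halfline v * (exp_cdf n v)%:E.
Proof.
rewrite /convolution; have [v0|v0] := ltP v 0%R.
  rewrite halfline_lt0// mul0e integral0_eq// => s _.
  have [s0|s0] := ltP s 0%R; first by rewrite exp_density_lt0// mul0e.
  by rewrite halfline_lt0 ?mule0// subr_lt0 (lt_le_trans v0).
rewrite halfline_ge0// mul1e.
transitivity (exponential_prob n.+1%:R `[0%R, v]%classic).
  rewrite /exponential_prob [RHS]integral_mkcond; apply: eq_integral => s _.
  rewrite patchE; case: ifPn => [|/negP]; rewrite inE/= in_itv/=.
    by move=> /andP[s0 sv]; rewrite halfline_ge0 ?mule1// subr_ge0.
  move=> /negP; rewrite negb_and -!ltNge => /orP[s0|vs].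
    by rewrite exp_density_lt0// mul0e.
  by rewrite halfline_lt0 ?mule0// subr_lt0.
move: v0; rewrite le_eqVlt => /predU1P[<-|v0].
  rewrite set_itv1 /exponential_prob integral_set1.
  by rewrite /exp_cdf mulr0 oppr0 expR0 subrr.
by rewrite exponential_prob_itv0c// mulNr EFinB.
Qed.

(** Convolving a power of the distribution function with the density raises
    the power, up to replacing the increasing power by its final value. *)
Lemma exp_density_cdf n k v :
  convolution (exp_density n) (fun s => halfline s * (exp_cdf n s ^+ k)%:E) v <=
  halfline v * (exp_cdf n v ^+ k.+1)%:E.
Proof.
have [v0|v0] := ltP v 0%R.
  rewrite halfline_lt0// mul0e /convolution integral0_eq// => s _.
  have [s0|s0] := ltP s 0%R; first by rewrite exp_density_lt0// mul0e.
  by rewrite halfline_lt0 ?mul0e ?mule0// subr_lt0 (lt_le_trans v0).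
have c0 : (0 <= exp_cdf n v ^+ k)%R by rewrite exprn_ge0// exp_cdf_ge0.
have ms : measurable_fun setT (fun s : R => v - s)%R by exact: measurable_funB.
have nh : nnmfun (fun s : R => halfline (v - s)%R).
  exact: (nnmfun_comp ms nnmfun_halfline).
apply: (@le_trans _ _ ((exp_cdf n v ^+ k)%:E * convolution (exp_density n) halfline v)).
  rewrite /convolution -nnintZ ?lee_fin//; last exact: nnmfunM (nnmfun_exp_density n) nh.
  apply: nnint_le.
  - apply: nnmfunM; first exact: nnmfun_exp_density.
    split; last first.
      move=> s; have [vs|vs] := ltP (v - s)%R 0%R; first by rewrite halfline_lt0// mul0e.
      by rewrite halfline_ge0// mul1e lee_fin exprn_ge0// exp_cdf_ge0.
    apply: emeasurable_funM; first by case: nh.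
    apply/measurable_EFinP; apply: measurable_funX.
    exact: (measurableT_comp (measurable_exp_cdf n) ms).
  - apply: nnmfunM; first by apply: nnmfun_cst; rewrite lee_fin.
    exact: nnmfunM (nnmfun_exp_density n) nh.
  - move=> s; have [s0|s0] := ltP s 0%R; first by rewrite exp_density_lt0// !mul0e mule0.
    rewrite [leRHS]muleCA; apply: lee_wpmul2l; first by have [] := nnmfun_exp_density n.
    have [vs|vs] := ltP (v - s)%R 0%R; first by rewrite halfline_lt0// mul0e mule0.
    rewrite halfline_ge0// mul1e mule1 lee_fin lerXn2r ?nnegrE ?exp_cdf_ge0//.
    by apply: le_exp_cdf; rewrite gerBl.
by rewrite exp_density_halfline halfline_ge0// !mul1e -EFinM exprSr.
Qed.

Lemma integral_exp_density n : \int[leb]_s exp_density n s = 1.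
Proof. by rewrite integral_exponential_pdf// ltr0n. Qed.

End HalfLine.

Section Resolvent.
Context d (T : measurableType d) (R : realType).
Variable p : R -> T -> {measure set T -> \bar R}.
Hypothesis Hp : markov_kernels p.
Local Notation leb := (@lebesgue_measure R).
Implicit Types (g h : T -> \bar R) (b : R -> \bar R).

Definition transition_op t h x : \bar R := \int[p t x]_y h y.

(** The potential operator for [b := halfline], n+1 times the resolvent at n+1
    for [b := exp_density n]. *)
Definition weighted_potential b h x : \bar R := \int[leb]_t (b t * transition_op t h x).

Lemma nnmfun_semigroup h : nnmfun h -> nnmfun (fun z : R * T => transition_op z.1 h z.2).
Proof.
move=> [mh h0]; split; last by move=> z; exact: integral_ge0.
apply: (measurable_fun_integral_kernel (X := (R * T)%type)
  (l := fun z : R * T => p z.1 z.2)) => // U mU.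
exact: (kernel_measurable Hp).
Qed.

Lemma nnmfun_semigroup_space t h : nnmfun h -> nnmfun (transition_op t h).
Proof.
by move=> /nnmfun_semigroup; exact: (nnmfun_comp (pair1_measurable t)).
Qed.

Lemma nnmfun_semigroup_time h x : nnmfun h -> nnmfun (fun t => transition_op t h x).
Proof.
by move=> /nnmfun_semigroup; exact: (nnmfun_comp (pair2_measurable x)).
Qed.

Let sf t x : sigma_finite setT (p t x).
Proof. exact/sigma_finite_le1/(kernel_le1 Hp). Qed.

Let nn_weighted b h : nnmfun b -> nnmfun h ->
  nnmfun (fun z : T * R => b z.2 * transition_op z.2 h z.1).
Proof.
move=> nb nh; apply: nnmfunM; first exact: (nnmfun_comp measurable_snd nb).
have sw : measurable_fun setT (fun z : T * R => (z.2, z.1)) by exact: measurable_swap.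
exact: (nnmfun_comp sw (nnmfun_semigroup nh)).
Qed.

Lemma nnmfun_weighted_potential b h : nnmfun b -> nnmfun h ->
  nnmfun (weighted_potential b h).
Proof.
move=> nb nh; split; last first.
  move=> x; apply: nnint_ge0; apply: nnmfunM => //; exact: nnmfun_semigroup_time.
have [mF F0] := nn_weighted nb nh.
exact: (@measurable_fun_fubini_tonelli_F _ _ _ _ _ leb _ mF F0).
Qed.

Lemma weighted_potential_functional b x :
  nnmfun b -> (forall t, b t \is a fin_num) ->
  positive_functional (fun h => weighted_potential b h x).
Proof.
move=> nb bfin.
have nF h : nnmfun h -> nnmfun (fun t => b t * transition_op t h x).
  by move=> nh; apply: nnmfunM => //; exact: nnmfun_semigroup_time.
have b0 t : 0 <= b t by have [] := nb.
rewrite /weighted_potential; split.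
- by move=> h nh; exact: (nnint_ge0 leb (nF h nh)).
- move=> g h ng nh; rewrite -(nnintD leb (nF g ng) (nF h nh)).
  apply: eq_integral => t _; rewrite /transition_op nnintD//.
  by rewrite ge0_muleDr ?(nnint_ge0 _ ng) ?(nnint_ge0 _ nh).
- move=> c h c0 nh; rewrite -(nnintZ leb _ (nF h nh))//.
  by apply: eq_integral => t _; rewrite /transition_op nnintZ// muleCA.
- move=> u_ h nu nd uh; apply: nnint_mct.
  + by move=> n; exact: nF.
  + by move=> t i j ij; apply: lee_wpmul2l => //; apply: nnint_le => // y; exact: nd.
  + by move=> t; apply: cvgeZl => //; exact: nnint_mct.
Qed.

(** Semigroup property and Tonelli: a resolvent of a time integral is again a
    time integral, with the convolved weight. *)
Lemma weighted_potential_comp (a b : R -> \bar R) h x :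
  nnmfun a -> nnmfun b -> nnmfun h ->
  (forall t, (t < 0)%R -> a t = 0) -> (forall t, (t < 0)%R -> b t = 0) ->
  weighted_potential a (weighted_potential b h) x =
  weighted_potential (convolution a b) h x.
Proof.
move=> na nb nh aneg bneg.
have a0 t : 0 <= a t by have [] := na.
have nFx := nnmfun_semigroup_time x nh.
have nshift (s : R) : nnmfun (fun v : R => b (v - s)%R * transition_op v h x).
  apply: nnmfunM => //; apply: (nnmfun_comp (p := fun v : R => (v - s)%R) _ nb); exact: measurable_funB.
transitivity (\int[leb]_s (a s * \int[leb]_v (b (v - s)%R * transition_op v h x))).
  apply: eq_integral => s _; have [s0|s0] := ltP s 0%R; first by rewrite aneg// !mul0e.
  congr (_ * _); rewrite /transition_op /weighted_potential.
  have [_ _ ->] := tonelli (sf s x) (@sigma_finiteT _ _ _ leb) (nn_weighted nb nh).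
  rewrite -(lebesgue_integral_shift s (nshift s)); apply: eq_integral => u _ /=.
  rewrite addrK nnintZ; [|by have [] := nb|exact: nnmfun_semigroup_space].
  have [u0|u0] := ltP u 0%R; first by rewrite bneg// !mul0e.
  by rewrite [(u + s)%R]addrC /transition_op (kernel_semigroup Hp).
have nab : nnmfun (fun z : R * R => a z.1 * (b (z.2 - z.1)%R * transition_op z.2 h x)).
  apply: nnmfunM; first exact: (nnmfun_comp measurable_fst na).
  apply: nnmfunM; last exact: (nnmfun_comp measurable_snd nFx).
  apply: (nnmfun_comp (p := fun z : R * R => (z.2 - z.1)%R) _ nb).
  exact: measurable_funB.
have [_ _ tF] := tonelli (@sigma_finiteT _ _ _ leb) (@sigma_finiteT _ _ _ leb) nab.
transitivity (\int[leb]_s \int[leb]_v (a s * (b (v - s)%R * transition_op v h x))).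
  by apply: eq_integral => s _; rewrite (nnintZ leb (a0 s) (nshift s)).
rewrite tF; apply: eq_integral => v _.
have nbv : nnmfun (fun s : R => b (v - s)%R).
  by apply: (nnmfun_comp (p := fun s : R => (v - s)%R) _ nb); exact: measurable_funB.
have F0 : 0 <= transition_op v h x by have [] := nFx.
rewrite /convolution muleC -(nnintZ leb F0 (nnmfunM na nbv)).
by apply: eq_integral => s _; rewrite /= muleA muleC.
Qed.

Definition green_operator h x : \bar R := weighted_potential halfline h x.

Lemma nnmfun_green_operator h : nnmfun h -> nnmfun (green_operator h).
Proof. exact/nnmfun_weighted_potential/nnmfun_halfline. Qed.

(** [Q n x] is the law of the position at an independent exponential time of
    rate n+1, started at x: n+1 times the resolvent kernel at n+1. *)
Definition resolvent_kernels (Q : nat -> T -> {measure set T -> \bar R}) : Prop :=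
  forall n x h, nnmfun h -> \int[Q n x]_y h y = weighted_potential (exp_density n) h x.

Lemma resolvent_kernels_exist : exists Q, resolvent_kernels Q.
Proof.
have ex (z : nat * T) : exists nu : {measure set T -> \bar R},
    forall h, nnmfun h -> \int[nu]_y h y = weighted_potential (exp_density z.1) h z.2.
  apply/functional_measure/weighted_potential_functional => //.
  exact: nnmfun_exp_density.
have [q qP] := choice ex.
by exists (fun n x => q (n, x)) => n x h; exact: (qP (n, x)).
Qed.

Variable Q : nat -> T -> {measure set T -> \bar R}.
Hypothesis HQ : resolvent_kernels Q.

Lemma nnmfun_resolvent n h : nnmfun h -> nnmfun (fun x => \int[Q n x]_y h y).
Proof.
move=> nh; have [mW W0] := nnmfun_weighted_potential (nnmfun_exp_density n) nh.
have E : (fun x => \int[Q n x]_y h y) = weighted_potential (exp_density n) h.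
  by apply/funext => x; exact: HQ.
by rewrite E.
Qed.

Lemma resolvent_le1 n x : Q n x setT <= 1.
Proof.
rewrite -[X in Q n x X]setIT -integral_indic// HQ; last exact: nnmfun_indic.
rewrite -(integral_exp_density n); apply: nnint_le.
- apply: nnmfunM; first exact: nnmfun_exp_density.
  by apply: nnmfun_semigroup_time; exact: nnmfun_indic.
- exact: nnmfun_exp_density.
- move=> t; rewrite -[leRHS]mule1; apply: lee_wpmul2l.
    by have [] := @nnmfun_exp_density R n.
  by rewrite /transition_op integral_indic// setIT (kernel_le1 Hp).
Qed.

(** This is V = V_k + k V_k V for the resolvent V_k at k = n+1, in a form
    without subtraction. *)
Lemma resolvent_equation n h x : nnmfun h ->
  green_operator h x =
  \int[Q n x]_y (green_operator h y + (n.+1%:R^-1)%:E * h y).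
Proof.
move=> nh; have nG := nnmfun_green_operator nh.
have ni : (0 : \bar R) <= (n.+1%:R^-1)%:E by rewrite lee_fin invr_ge0 ler0n.
have nih : nnmfun (fun y => (n.+1%:R^-1)%:E * h y).
  by apply: nnmfunM => //; exact: nnmfun_cst.
rewrite nnintD// nnintZ// !HQ//.
rewrite /green_operator (weighted_potential_comp x (nnmfun_exp_density n) nnmfun_halfline nh
  (@exp_density_lt0 R n) (@halfline_lt0 R)).
have nF := nnmfun_semigroup_time x nh.
have nE := @nnmfun_exp_density R n.
rewrite /weighted_potential -nnintZ//; last exact: nnmfunM.
rewrite -nnintD; last 2 first.
- by apply: nnmfunM => //; apply: nnmfun_convolution => //; exact: nnmfun_halfline.
- by apply: nnmfunM; [exact: nnmfun_cst|exact: nnmfunM].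
apply: eq_integral => v _; rewrite exp_density_halfline.
have [v0|v0] := ltP v 0%R.
  by rewrite halfline_lt0// exp_density_lt0// !mul0e mule0 adde0.
have F0 : 0 <= transition_op v h x by have [] := nF.
rewrite halfline_ge0// !mul1e /exp_density exponential_pdfE//.
rewrite muleA -EFinM mulrA mulVf ?pnatr_eq0// mul1r -ge0_muleDl ?lee_fin ?exp_cdf_ge0 ?expR_ge0//.
by rewrite -EFinD /exp_cdf mulNr subrK mul1e.
Qed.

(** Powers of the resolvent kernel lose the mass of any finite potential:
    [delta] lies below all the time integrals of the semigroup weighted by the
    powers of the exponential distribution function, which vanish in the
    limit. *)
Lemma resolvent_vanish (m : {measure set T -> \bar R}) n delta g :
  (forall h1 h2, nnmfun h1 -> nnmfun h2 -> (\forall x \ae m, h1 x <= h2 x) ->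
     forall x, \int[Q n x]_y h1 y <= \int[Q n x]_y h2 y) ->
  nnmfun delta -> nnmfun g ->
  (\forall x \ae m, delta x <= green_operator g x) ->
  (\forall x \ae m, green_operator g x < +oo) ->
  (\forall x \ae m, delta x <= \int[Q n x]_y delta y) ->
  \forall x \ae m, delta x = 0.
Proof.
move=> Qm nd ng dG Gfin dQ.
pose b k (s : R) : \bar R := halfline s * (exp_cdf n s ^+ k)%:E.
have nb k : nnmfun (b k).
  split; last first.
    move=> v; have [v0|v0] := ltP v 0%R; first by rewrite /b halfline_lt0// mul0e.
    by rewrite /b halfline_ge0// mul1e lee_fin exprn_ge0// exp_cdf_ge0.
  apply: emeasurable_funM; first by have [] := @nnmfun_halfline R.
  by apply/measurable_EFinP; apply: measurable_funX; exact: measurable_exp_cdf.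
have b_neg k s : (s < 0)%R -> b k s = 0 by move=> s0; rewrite /b halfline_lt0// mul0e.
have nW k := nnmfun_weighted_potential (nb k) ng.
have dW k : \forall x \ae m, delta x <= weighted_potential (b k) g x.
  elim: k => [|k IHk].
    have b0E : b 0%N = halfline by apply/funext => s; rewrite /b expr0 mule1.
    by rewrite b0E; exact: dG.
  apply: filterS dQ => x /le_trans; apply.
  apply: (le_trans (Qm _ _ nd (nW k) IHk x)).
  rewrite (HQ _ _ (nW k)).
  rewrite (weighted_potential_comp x (nnmfun_exp_density n) (nb k) ng (@exp_density_lt0 R n) (b_neg k)).
  have nF := nnmfun_semigroup_time x ng.
  have nL := nnmfunM (nnmfun_convolution (nnmfun_exp_density n) (nb k)) nF.
  apply: (nnint_le leb nL (nnmfunM (nb k.+1) nF)) => s.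
  by apply: lee_wpmul2r; [have [] := nF|exact: exp_density_cdf].
have dWall := (ae_foralln dW).
near=> x.
have dx k : delta x <= weighted_potential (b k) g x by move: k; near: x; exact: dWall.
have Gx : green_operator g x < +oo by near: x; exact: Gfin.
apply/eqP; rewrite eq_le; apply/andP; split; last by have [] := nd.
have nF := nnmfun_semigroup_time x ng.
have W0 : weighted_potential (b k) g x @[k --> \oo] --> \int[leb]_s (0 : \bar R).
  apply: (@nnint_dct _ _ R leb (fun k s => b k s * transition_op s g x) (fun=> 0)
    (fun s => halfline s * transition_op s g x)).
  - by move=> k; exact: (nnmfunM (nb k) nF).
  - exact: nnmfun_cst.
  - exact: (nnmfunM nnmfun_halfline nF).
  - have : \int[leb]_s (halfline s * transition_op s g x) < +oo by exact: Gx.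
    move=> /(@nnint_fin_ae _ _ R leb _ (nnmfunM nnmfun_halfline nF)).
    apply: filterS => s /=.
    have [s0|s0] := ltP s 0%R.
      by move=> _; under eq_fun do rewrite b_neg// mul0e; exact: cvg_cst.
    rewrite halfline_ge0// mul1e => Ffin.
    under eq_fun do rewrite /b halfline_ge0// mul1e.
    rewrite -(mul0e (transition_op s g x)).
    apply: cvgeZr => //; apply: cvg_EFin; first exact: nearW.
    by apply: cvg_expr; rewrite ger0_norm ?exp_cdf_ge0 ?exp_cdf_lt1.
  - move=> k s; apply: lee_wpmul2r; first by have [] := nF.
    have [s0|s0] := ltP s 0%R; first by rewrite b_neg// halfline_lt0.
    by rewrite /b halfline_ge0// mul1e lee_fin exprn_ile1// ?exp_cdf_ge0// ltW// exp_cdf_lt1.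
  - exact: Gx.
rewrite integral0 in W0; rewrite -(cvg_lim _ W0)//; apply: lime_ge.
  by apply/cvg_ex; exists 0.
exact: nearW.
Unshelve. all: by end_near. Qed.

Lemma exp_density_le n (s : R) : exp_density n s <= n.+1%:R%:E * halfline s.
Proof.
have [s0|s0] := ltP s 0%R; first by rewrite exp_density_lt0// halfline_lt0// mule0.
rewrite halfline_ge0// mule1 lee_fin exponential_pdfE// ler_piMr ?ler0n//.
by rewrite -[leRHS]expR0 ler_expR mulNr oppr_le0 mulr_ge0.
Qed.

(** The resolvent kernels inherit absolute continuity from the potential
    operator, whose mass they only diminish. *)
Lemma resolvent_ae_le (m : {measure set T -> \bar R}) :
  (forall N, measurable N -> m N = 0 ->
     forall x, green_operator (fun y => (\1_N y)%:E) x = 0) ->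
  forall n h1 h2, nnmfun h1 -> nnmfun h2 -> (\forall x \ae m, h1 x <= h2 x) ->
     forall x, \int[Q n x]_y h1 y <= \int[Q n x]_y h2 y.
Proof.
move=> G0 n h1 h2 n1 n2 [N [mN mN0 hN]] x; apply: nnint_ae_le => //.
have QN : \int[Q n x]_y (\1_N y)%:E = Q n x N by rewrite integral_indic// setIT.
suff QN0 : \int[Q n x]_y (\1_N y)%:E <= 0.
  by exists N; split => //; apply/eqP; rewrite eq_le measure_ge0 andbT -QN.
rewrite (HQ _ _ (nnmfun_indic R mN)).
have nF := nnmfun_semigroup_time x (nnmfun_indic R mN).
have c0 : (0 : \bar R) <= n.+1%:R%:E by rewrite lee_fin ler0n.
have nH := nnmfunM (@nnmfun_halfline R) nF.
apply: (@le_trans _ _ (n.+1%:R%:E * green_operator (fun y => (\1_N y)%:E) x)).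
  rewrite /green_operator /weighted_potential -(nnintZ leb c0 nH).
  apply: (nnint_le leb (nnmfunM (nnmfun_exp_density n) nF) (nnmfunM (nnmfun_cst _ c0) nH)) => s.
  by rewrite muleA; apply: lee_wpmul2r; [have [] := nF|exact: exp_density_le].
by rewrite G0// mule0.
Qed.

(** As [t |-> transition_op t s x] is nonincreasing, the supremum is the limit
    as t decreases to 0. *)
Record excessive_function (s : T -> \bar R) : Prop := {
  excessive_nn : nnmfun s ;
  excessive_semigroup_le : forall t x, (0 < t)%R -> transition_op t s x <= s x ;
  excessive_sup : forall x,
    s x <= ereal_sup [set transition_op t s x | t in [set t | (0 < t)%R]] }.

Lemma excessive_resolvent_le s n x : excessive_function s ->
  \int[Q n x]_y s y <= s x.
Proof.
move=> [ns Ps _]; rewrite HQ//.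
have sx0 : 0 <= s x by have [] := ns.
have nE := @nnmfun_exp_density R n.
rewrite -[leRHS]mule1 -(integral_exp_density n) -(nnintZ leb sx0 nE).
apply: (@nnint_ae_le _ _ R leb _ _ (nnmfunM nE (nnmfun_semigroup_time x ns)) (nnmfunM (nnmfun_cst _ sx0) nE)).
exists [set 0%R]; split => //; first exact: lebesgue_measure_set1.
move=> t /= tP; apply: contrapT => t0; apply: tP.
have E0 : 0 <= exp_density n t by have [] := nE.
have [tn|tp] := ltP t 0%R; first by rewrite exp_density_lt0// mul0e mule0.
rewrite muleC; apply: lee_wpmul2r => //; apply: Ps.
by rewrite lt_neqAle tp andbT eq_sym; apply/eqP.
Qed.

Lemma semigroup_nonincreasing s r t x : excessive_function s ->
  (0 < r)%R -> (r <= t)%R -> transition_op t s x <= transition_op r s x.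
Proof.
move=> [ns Ps _] r0; rewrite le_eqVlt => /predU1P[->//|rt].
rewrite -[in leLHS](subrKC r t) /transition_op (kernel_semigroup Hp)//; last 2 first.
- exact: ltW.
- by rewrite subr_ge0 ltW.
apply: nnint_le => //; first exact: nnmfun_semigroup_space.
by move=> y; apply: Ps; rewrite subr_gt0.
Qed.

(** The exponential law of rate n+1 concentrates at 0, where the transition
    operators recover an excessive function. As resolvents do not see null sets,
    inequalities between excessive functions extend in this way from almost
    every point to every point. *)
Lemma excessive_le_limn_einf s x : excessive_function s ->
  s x <= limn_einf (fun n => \int[Q n x]_y s y).
Proof.
move=> es; have [ns Ps sups] := es.
apply: (le_trans (sups x)); apply: ge_ereal_sup => _ [t t0 <-].
have nF := nnmfun_semigroup_time x ns.
have Ft0 : 0 <= transition_op t s x by have [] := nF.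
have low n : transition_op t s x * (exp_cdf n t)%:E <= \int[Q n x]_y s y.
  have nE := @nnmfun_exp_density R n.
  have nEt : nnmfun (fun v : R => exp_density n v * halfline (t - v)%R).
    apply: nnmfunM => //; apply: (nnmfun_comp (p := fun v : R => (t - v)%R) _ nnmfun_halfline).
    exact: measurable_funB.
  rewrite HQ// -[(exp_cdf n t)%:E]mul1e -(halfline_ge0 (ltW t0)).
  rewrite -exp_density_halfline /convolution -(nnintZ leb Ft0 nEt).
  have nL : nnmfun (fun v : R => transition_op t s x * (exp_density n v * halfline (t - v)%R)).
    exact: nnmfunM (nnmfun_cst _ Ft0) nEt.
  apply: (@nnint_ae_le _ _ R leb _ _ nL (nnmfunM nE nF)).
  exists [set 0%R]; split => //; first exact: lebesgue_measure_set1.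
  move=> v /= vP; apply: contrapT => v0; apply: vP.
  have [vn|vp] := ltP v 0%R; first by rewrite exp_density_lt0// !mul0e mule0.
  have E0 : 0 <= exp_density n v by have [] := nE.
  have [tv|vt] := ltP t v.
    by rewrite halfline_lt0 ?subr_lt0// !mule0 mule_ge0//; have [] := nF.
  rewrite halfline_ge0 ?subr_ge0// mule1 muleC; apply: lee_wpmul2l => //.
  apply: (semigroup_nonincreasing x es _ vt).
  by rewrite lt_neqAle vp andbT eq_sym; apply/eqP.
apply: (le_trans _ (limn_einf_le low)).
have cdf1 : (exp_cdf n t)%:E @[n --> \oo] --> (1 : \bar R).
  apply: cvg_EFin; first exact: nearW.
  rewrite -[X in _ --> X]subr0; apply: cvgB; first exact: cvg_cst.
  apply: (@cvg_comp _ _ _ (fun k : nat => (k.+1%:R * t)%R) (fun y : R => expR (- y)%R) _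
    (pinfty_nbhs R)); last exact: cvgr_expR.
  apply/cvgryPge => A; near=> n.
  rewrite -ler_pdivrMr//; apply: (@le_trans _ _ n%:R); last by rewrite ler_nat.
  by near: n; exact: nbhs_infty_ger.
case E : (transition_op t s x) => [r||].
- have rfin : r%:E \is a fin_num by [].
  by have := cvgeZl rfin cdf1; rewrite mule1 => /cvg_limn_einf_sup[-> _].
- have cdf0 n : (0 < exp_cdf n t)%R.
    by rewrite /exp_cdf subr_gt0 -[ltRHS]expR0 ltr_expR oppr_lt0 mulr_gt0.
  have -> : (fun n => +oo * (exp_cdf n t)%:E) = (fun=> +oo).
    by apply/funext => n; rewrite gt0_mulye// lte_fin.
  by have [-> _] := cvg_limn_einf_sup (@cvg_cst _ (+oo : \bar R) _ \oo _).
- exact: leNye.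
Unshelve. all: by end_near. Qed.

End Resolvent.

(** * Symmetry of the semigroup of a self-adjoint generator *)

Section L2Theory.
Context d (T : measurableType d) (R : realType) (mu : {measure set T -> \bar R}).
Implicit Types (u v w : T -> R) (c : R).
Local Notation L2 := (L2 mu).
Local Notation dot := (dotL2 mu).

Let nrm u : R := fine (normL2 mu u).

Lemma ae_eqP u v : u = v %[ae mu] <-> \forall x \ae mu, u x = v x.
Proof. by split; apply: filterS => x; [exact|move=> ->]. Qed.

Lemma L2_measurable u : L2 u -> measurable_fun setT u.
Proof. by rewrite /Defs.L2/= inE => /andP[]; rewrite inE. Qed.

Lemma L2_lin c u v : L2 u -> L2 v -> L2 (fun x => c * u x + v x)%R.
Proof.
rewrite /Defs.L2/= => uL vL.
have p1 : (1 : \bar R) <= 2%:E by rewrite lee_fin ler1n.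
exact: ((Lfun_submod_closed mu p1).2 c u v uL vL).
Qed.

Lemma normL2_fin u : L2 u -> normL2 mu u = (nrm u)%:E.
Proof.
rewrite /Defs.L2/= inE => /andP[_]; rewrite inE /= => fu.
by rewrite /nrm fineK// ge0_fin_numE// Lnorm_ge0.
Qed.

Lemma nrm_ge0 u : (0 <= nrm u)%R.
Proof. by rewrite fine_ge0// Lnorm_ge0. Qed.

Lemma normL2_ae u v : L2 u -> L2 v -> u = v %[ae mu] -> normL2 mu u = normL2 mu v.
Proof.
move=> /L2_measurable mu' /L2_measurable mv /ae_eqP uv.
rewrite /normL2 unlock /Lnorm; congr (_ `^ _).
have n2 w : measurable_fun setT w -> nnmfun (fun x => `|(EFin \o w) x| `^ 2).
  move=> mw; split; last by move=> x; rewrite poweR_ge0.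
  by apply: (measurableT_comp (measurable_poweR _)) => //; apply: measurableT_comp => //; apply: measurableT_comp.
apply: nnint_ae_eq; [exact: n2|exact: n2|].
by apply: filterS uv => x /= ->.
Qed.

Lemma integrable_mul u v : L2 u -> L2 v -> mu.-integrable setT (EFin \o (u \* v)%R).
Proof. by move=> uL vL; apply/Lfun1_integrable; exact: Lfun2_mul_Lfun1. Qed.

Lemma dotC u v : dot u v = dot v u.
Proof. by apply: eq_Rintegral => x _; rewrite mulrC. Qed.

Lemma dot_linl c u v w : L2 u -> L2 v -> L2 w ->
  dot (fun x => c * u x + v x)%R w = (c * dot u w + dot v w)%R.
Proof.
move=> uL vL wL; have iu := integrable_mul uL wL; have iv := integrable_mul vL wL.
rewrite /dotL2 -RintegralZl// -RintegralD//; last exact: (integrableZl measurableT c iu).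
by apply: eq_Rintegral => x _; rewrite mulrDl mulrA.
Qed.

Lemma dot_linr c u v w : L2 u -> L2 v -> L2 w ->
  dot w (fun x => c * u x + v x)%R = (c * dot w u + dot w v)%R.
Proof. by move=> uL vL wL; rewrite dotC dot_linl// !(dotC w). Qed.

Lemma dot_ae u v w : L2 u -> L2 v -> L2 w -> u = v %[ae mu] -> dot u w = dot v w.
Proof.
move=> /L2_measurable mu' /L2_measurable mv /L2_measurable mw /ae_eqP uv.
rewrite /dotL2 /Rintegral; congr fine; apply: ae_eq_integral => //.
- by apply/measurable_EFinP; exact: measurable_funM.
- by apply/measurable_EFinP; exact: measurable_funM.
- by apply: filterS uv => x /= -> _.
Qed.

Lemma cauchy_schwarz u v : L2 u -> L2 v -> (`|dot u v| <= nrm u * nrm v)%R.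
Proof.
move=> uL vL; have iuv := integrable_mul uL vL.
have := le_normr_Rintegral measurableT iuv; move=> /le_trans; apply.
rewrite -lee_fin EFinM -!normL2_fin// /normL2.
have half2 : (2^-1 + 2^-1 = 1 :> R)%R by rewrite [RHS]splitr !div1r.
have := @hoelder _ _ _ mu u v 2 2 (L2_measurable uL) (L2_measurable vL) _ _ half2.
move=> /(_ (ltr0n _ 2) (ltr0n _ 2)); apply: le_trans.
rewrite Lnorm1 /Rintegral fineK//.
apply: integrable_fin_num => //.
by move/integrable_abse: iuv.
Qed.

Variables (DA : set (T -> R)) (A : (T -> R) -> (T -> R)) (S : R -> (T -> R) -> (T -> R)).
Hypotheses (HA : self_adjoint mu DA A) (HS : markov_semigroup mu S)
  (HG : generator mu DA A S).

(* The difference between the difference quotient at step [h] and the generator. *)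
Let rem (h : R) u : T -> R := fun x => (h^-1 * (S h u x - u x) - A u x)%R.

Let SL t u : (0 <= t)%R -> L2 u -> L2 (S t u).
Proof. by move=> t0; exact: (op_codomain (semigroup_op HS t0)). Qed.

Let AL u : DA u -> L2 u /\ L2 (A u).
Proof.
have [HA' _ _] := HA.
by move=> Du; split; [exact: (op_domain HA')|exact: (op_codomain HA')].
Qed.

Let S_lin t c u v : (0 <= t)%R -> L2 u -> L2 v ->
  \forall x \ae mu, S t (fun x => c * u x + v x)%R x = (c * S t u x + S t v x)%R.
Proof.
by move=> t0 uL vL; apply/ae_eqP; exact: ((op_linear (semigroup_op HS t0) c uL vL).2).
Qed.

Let L2_scale c u : L2 u -> L2 (fun x => c * u x)%R.
Proof.
move=> uL; have := L2_lin (c - 1) uL uL; congr L2.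
by apply/funext => x; ring.
Qed.

Let S_scale t c u : (0 <= t)%R -> L2 u ->
  \forall x \ae mu, S t (fun x => c * u x)%R x = (c * S t u x)%R.
Proof.
move=> t0 uL; have := S_lin (c - 1) t0 uL uL.
have -> : (fun x => (c - 1) * u x + u x)%R = (fun x => c * u x)%R.
  by apply/funext => x; ring.
by apply: filterS => x ->; ring.
Qed.

Let L2_rem h u : (0 <= h)%R -> L2 u -> L2 (A u) -> L2 (rem h u).
Proof.
move=> h0 uL AuL.
have v0L := L2_lin (-1) uL (SL h0 uL).
have w1L := L2_scale (-1) AuL.
have := L2_lin h^-1 v0L w1L; congr L2.
by apply/funext => x; rewrite /rem; ring.
Qed.

Let rem_semigroup h s u : DA u -> (0 <= h)%R -> (0 <= s)%R ->
  \forall x \ae mu,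
    (h^-1 * (S h (S s u) x - S s u x) - S s (A u) x)%R = S s (rem h u) x.
Proof.
move=> Du h0 s0; have [uL AuL] := AL Du.
have v0L := L2_lin (-1) uL (SL h0 uL).
have w1L := L2_scale (-1) AuL.
have -> : rem h u = (fun x => h^-1 * (-1 * u x + S h u x) + (-1 * A u x))%R.
  by apply/funext => x; rewrite /rem; ring.
have e1 := S_lin h^-1 s0 v0L w1L.
have e2 := S_lin (-1) s0 uL (SL h0 uL).
have e3 := S_scale (-1) s0 AuL.
have /ae_eqP e4 := semigroupD HS s0 h0 uL.
have /ae_eqP e5 := semigroupD HS h0 s0 uL.
apply: filter_app e1; apply: filter_app e2; apply: filter_app e3.
apply: filter_app e4; apply: filter_app e5; apply: aeW => x e5 e4 e3 e2 ->.
by rewrite e2 e3 -e4 -e5 [(h + s)%R]addrC; ring.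
Qed.

Let rem_cvg u : DA u -> normL2 mu (rem h u) @[h --> 0%R^'+] --> 0.
Proof.
move=> Du; have [uL AuL] := AL Du.
by apply: ((HG uL AuL).1 _); split => //; apply/ae_eqP; exact: aeW.
Qed.

(** The semigroup commutes with its difference quotients and contracts, so that
    it preserves the domain and does not increase the error, uniformly in [s]. *)
Let semigroup_domain s u : DA u -> (0 <= s)%R ->
  DA (S s u) /\ forall h, (0 < h)%R -> (nrm (rem h (S s u)) <= nrm (rem h u))%R.
Proof.
move=> Du s0; have [uL AuL] := AL Du.
pose r' h x : R := (h^-1 * (S h (S s u) x - S s u x) - S s (A u) x)%R.
have r'L h : (0 < h)%R -> L2 (r' h).
  move=> /ltW h0; have v0L := L2_lin (-1) (SL s0 uL) (SL h0 (SL s0 uL)).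
  have w1L := L2_scale (-1) (SL s0 AuL).
  have := L2_lin h^-1 v0L w1L; congr L2.
  by apply/funext => x; rewrite /r'; ring.
have r'le h : (0 < h)%R -> normL2 mu (r' h) <= normL2 mu (rem h u).
  move=> h0; have rL := L2_rem (ltW h0) uL AuL.
  rewrite (@normL2_ae (r' h) (S s (rem h u)))//; last 3 first.
  - exact: r'L.
  - exact: SL.
  - by apply/ae_eqP; exact: rem_semigroup (ltW h0) s0.
  exact: (semigroup_contraction HS).
have [DSu ASu] : DA (S s u) /\ A (S s u) = S s (A u) %[ae mu].
  apply: (HG (SL s0 uL) (SL s0 AuL)).2.
  apply: (@squeeze_cvge _ _ _ _ (fun=> 0) _ (fun h => normL2 mu (rem h u))).
  - near=> h; apply/andP; split; first exact: Lnorm_ge0.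
    by apply: r'le; near: h; exact: nbhs_right_gt.
  - exact: cvg_cst.
  - exact: rem_cvg.
split=> // h h0.
have [_ ASuL] := AL DSu.
rewrite -lee_fin -!normL2_fin; last 2 first.
- exact: L2_rem (ltW h0) uL AuL.
- exact: L2_rem (ltW h0) (SL s0 uL) ASuL.
rewrite (@normL2_ae (rem h (S s u)) (r' h))//; last 3 first.
- exact: L2_rem (ltW h0) (SL s0 uL) ASuL.
- exact: r'L.
- apply/ae_eqP; move/ae_eqP : ASu; apply: filterS => x Ax.
  by rewrite /rem /r' Ax.
exact: r'le.
Unshelve. all: by end_near. Qed.

Let semigroup_nrm s u : (0 <= s)%R -> L2 u -> (nrm (S s u) <= nrm u)%R.
Proof.
move=> s0 uL; rewrite -lee_fin -!normL2_fin//; last exact: SL.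
exact: (semigroup_contraction HS).
Qed.

(** Over a time step h the defect is h times an error of difference quotients,
    because the generator is symmetric. *)
Let symmetric_step h a b : DA a -> DA b -> (0 < h)%R ->
  (`|dot (S h a) b - dot a (S h b)| <=
    h * (nrm (rem h a) * nrm b + nrm a * nrm (rem h b)))%R.
Proof.
move=> Da Db h0; have [aL AaL] := AL Da; have [bL AbL] := AL Db.
have raL := L2_rem (ltW h0) aL AaL; have rbL := L2_rem (ltW h0) bL AbL.
have SE u : S h u = (fun x => h * (1 * A u x + rem h u x) + u x)%R.
  by apply/funext => x; rewrite /rem; field; rewrite gt_eqF.
have ea : dot (S h a) b = (h * (dot (A a) b + dot (rem h a) b) + dot a b)%R.
  by rewrite [S h a]SE (dot_linl _ (L2_lin 1 AaL raL) aL bL) dot_linl// mul1r.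
have eb : dot a (S h b) = (h * (dot a (A b) + dot a (rem h b)) + dot a b)%R.
  by rewrite [S h b]SE (dot_linr _ (L2_lin 1 AbL rbL) bL aL) dot_linr// mul1r.
have sa : dot (A a) b = dot a (A b).
  have [_ _ sadj] := HA.
  by apply: (sadj b (A b) bL AbL).1 => //; split=> //; apply/ae_eqP; exact: aeW.
have -> : (dot (S h a) b - dot a (S h b) =
    h * (dot (rem h a) b - dot a (rem h b)))%R by rewrite ea eb sa; ring.
rewrite normrM gtr0_norm// ler_pM2l//.
apply: (le_trans (ler_normB _ _)); apply: lerD; exact: cauchy_schwarz.
Qed.

(** Moving the time from [u] to [v] in N+1 equal steps costs at most N+1 times
    the defect of one step, that is t times the error of the difference
    quotients at step t/(N+1). *)
Let symmetric_domain t u v : DA u -> DA v -> (0 < t)%R ->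
  dot (S t u) v = dot u (S t v).
Proof.
move=> Du Dv t0; have [uL AuL] := AL Du; have [vL AvL] := AL Dv.
pose h N : R := (t / N.+1%:R)%R.
have h0 N : (0 < h N)%R by rewrite divr_gt0.
pose eps N : R := (nrm (rem (h N) u) * nrm v + nrm u * nrm (rem (h N) v))%R.
have bound N : (`|dot (S t u) v - dot u (S t v)| <= t * eps N)%R.
  pose D j := dot (S (h N * (N.+1 - j)%:R)%R u) (S (h N * j%:R)%R v).
  have hj j : (0 <= h N * j%:R)%R by rewrite mulr_ge0// ltW.
  have step j : (j < N.+1)%N -> (`|D j - D j.+1| <= h N * eps N)%R.
    move=> jN; pose a := S (h N * (N - j)%:R)%R u; pose b := S (h N * j%:R)%R v.
    have [Da ra] := semigroup_domain Du (hj (N - j)%N).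
    have [Db rb] := semigroup_domain Dv (hj j).
    have [aL _] := AL Da; have [bL _] := AL Db.
    have hN0 := ltW (h0 N).
    have -> : D j = dot (S (h N) a) b.
      apply: dot_ae => //; [exact: SL|exact: SL|].
      rewrite (_ : h N * _ = h N + h N * (N - j)%:R)%R; last first.
        by rewrite subSn// -natr1; ring.
      exact: (semigroupD HS hN0 (hj (N - j)%N) uL).
    have -> : D j.+1 = dot a (S (h N) b).
      rewrite /D subSS -/a dotC [RHS]dotC.
      apply: dot_ae => //; [exact: SL|exact: SL|].
      rewrite (_ : h N * _ = h N + h N * j%:R)%R; last by rewrite -natr1; ring.
      exact: (semigroupD HS hN0 (hj j) vL).
    apply: (le_trans (symmetric_step Da Db (h0 N))).
    rewrite ler_pM2l//; apply: lerD; apply: ler_pM; rewrite ?nrm_ge0//.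
    - exact: ra.
    - exact: semigroup_nrm.
    - exact: semigroup_nrm.
    - exact: rb.
  have tele j : (j <= N.+1)%N -> (`|D 0%N - D j| <= j%:R * (h N * eps N))%R.
    elim: j => [|j IHj] jN; first by rewrite subrr normr0 mul0r.
    rewrite -(subrKA (D j)); apply: (le_trans (ler_normD _ _)).
    by rewrite -natr1 mulrDl mul1r lerD ?step// IHj// ltnW.
  have /tele : (N.+1 <= N.+1)%N by [].
  have -> : D 0%N = dot (S t u) v.
    rewrite /D subn0 mulr0 /h divfK// dotC [RHS]dotC.
    by apply: dot_ae => //; [exact: SL|exact: SL (ltW t0) _|exact: semigroup0].
  have -> : D N.+1 = dot u (S t v).
    rewrite /D subnn mulr0 /h divfK//.
    by apply: dot_ae => //; [exact: SL|exact: SL (ltW t0) _|exact: semigroup0].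
  by rewrite mulrA [(_ * h N)%R]mulrC /h divfK.
have hcvg : h N @[N --> \oo] --> 0%R^'+.
  have hn : h N @[N --> \oo] --> (0%R : R).
    rewrite -(mulr0 t); apply: cvgM; first exact: cvg_cst.
    exact: cvg_harmonic.
  move=> U [e /= e0 eU]; have /cvgrPdist_lt/(_ e e0) := hn.
  by apply: filterS => N hNe; exact: eU.
have rcvg w : DA w -> nrm (rem (h N) w) @[N --> \oo] --> (0%R : R).
  move=> Dw; have [wL AwL] := AL Dw.
  have := @cvg_comp _ _ _ h (fun k => normL2 mu (rem k w)) _ _ _ hcvg (rem_cvg Dw).
  by move=> /fine_cvg.
have ecvg : (t * eps N)%R @[N --> \oo] --> (t * (0 * nrm v + nrm u * 0))%R.
  apply: cvgM; first exact: cvg_cst.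
  apply: cvgD.
    by apply: cvgM; [exact: rcvg|exact: cvg_cst].
  by apply: cvgM; [exact: cvg_cst|exact: rcvg].
apply/eqP; rewrite -subr_eq0 -normr_le0.
rewrite -(_ : t * (0 * nrm v + nrm u * 0) = 0)%R; last by ring.
rewrite -(cvg_lim _ ecvg)//; apply: limr_ge; first by apply/cvg_ex; eexists; exact: ecvg.
exact: nearW.
Qed.

(** The defect <S_t u, v> - <u, S_t v> vanishes on the domain of the generator
    and is continuous in u and v, the domain being dense. *)
Lemma semigroup_symmetric t u v : L2 u -> L2 v -> (0 <= t)%R ->
  dot (S t u) v = dot u (S t v).
Proof.
have [_ dense _] := HA.
have small (x c : R) : (forall e : R, 0 < e -> `|x| <= c * e)%R -> x = 0%R.
  move=> xc; apply/eqP; rewrite -normr_le0; apply/ler_addgt0Pl => e e0.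
  rewrite addr0; have [c0|c0] := ltP 0%R c.
    by have := xc (e / c)%R (divr_gt0 e0 c0); rewrite mulrCA divff ?mulr1// gt_eqF.
  apply: (le_trans (xc e e0)); apply: (@le_trans _ _ 0%R); last exact: ltW.
  by rewrite mulr_le0_ge0// ltW.
have defect w1 w2 : L2 w1 -> L2 w2 -> (0 <= t)%R ->
    (`|dot (S t w1) w2 - dot w1 (S t w2)| <= 2 * (nrm w1 * nrm w2))%R.
  move=> w1L w2L t0; apply: (le_trans (ler_normB _ _)).
  rewrite mulr_natl mulr2n; apply: lerD.
    apply: (le_trans (cauchy_schwarz (SL t0 w1L) w2L)).
    by apply: ler_wpM2r; [exact: nrm_ge0|exact: semigroup_nrm].
  apply: (le_trans (cauchy_schwarz w1L (SL t0 w2L))).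
  by apply: ler_wpM2l; [exact: nrm_ge0|exact: semigroup_nrm].
have lin w1 w2 w3 : L2 w1 -> L2 w2 -> L2 w3 -> (0 <= t)%R ->
    (dot (S t (w1 \- w2)) w3 - dot (w1 \- w2) (S t w3) =
     (dot (S t w1) w3 - dot w1 (S t w3)) - (dot (S t w2) w3 - dot w2 (S t w3)))%R.
  move=> L1 L2' L3 t0.
  have -> : (w1 \- w2)%R = (fun x => -1 * w2 x + w1 x)%R.
    by apply/funext => x /=; ring.
  rewrite (@dot_ae (S t (fun x => -1 * w2 x + w1 x)%R) (fun x => -1 * S t w2 x + S t w1 x)%R)//; last 3 first.
  - by apply: SL => //; exact: L2_lin.
  - by apply: L2_lin; exact: SL.
  - by apply/ae_eqP; exact: S_lin.
  by rewrite !dot_linl//; try exact: SL; ring.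
have sub w1 w2 : L2 w1 -> L2 w2 -> L2 (w1 \- w2)%R.
  move=> L1 L2'; have := L2_lin (-1) L2' L1; congr L2.
  by apply/funext => x /=; ring.
have [HA' _ _] := HA.
move=> uL vL; rewrite le_eqVlt => /predU1P[<-|t0].
  have eu := semigroup0 HS uL; have ev := semigroup0 HS vL.
  rewrite (dot_ae (SL (lexx _) uL) uL vL eu) [RHS]dotC.
  by rewrite (dot_ae (SL (lexx _) vL) vL uL ev) dotC.
have t0' := ltW t0.
have half w1 w2 : DA w1 -> L2 w2 -> dot (S t w1) w2 = dot w1 (S t w2).
  move=> Dw1 w2L; have w1L := op_domain HA' Dw1.
  apply/eqP; rewrite -subr_eq0; apply/eqP.
  apply: (@small _ (2 * nrm w1)%R) => e e0.
  have [w3 Dw3 w23] := dense w2 w2L e e0.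
  have w3L := op_domain HA' Dw3.
  have := defect _ _ (sub _ _ w2L w3L) w1L t0'.
  rewrite lin// [X in (_ - X)%R](_ : _ = 0%R) ?subr0; last by rewrite symmetric_domain// subrr.
  rewrite distrC [dot w2 _]dotC [dot (S t w2) _]dotC => /le_trans; apply.
  rewrite -mulrA ler_pM2l// mulrC; apply: ler_wpM2l; first exact: nrm_ge0.
  by move: w23; rewrite normL2_fin ?lte_fin => [/ltW|]//; exact: sub.
apply/eqP; rewrite -subr_eq0; apply/eqP.
apply: (@small _ (2 * nrm v)%R) => e e0.
have [w Dw uw] := dense u uL e e0.
have wL := op_domain HA' Dw.
have := defect _ _ (sub _ _ uL wL) vL t0'.
rewrite lin// [X in (_ - X)%R](_ : _ = 0%R) ?subr0; last by rewrite half// subrr.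
move=> /le_trans; apply.
rewrite -mulrA ler_pM2l// mulrC; apply: ler_wpM2l; first exact: nrm_ge0.
by move: uw; rewrite normL2_fin ?lte_fin => [/ltW|]//; exact: sub.
Qed.

End L2Theory.

(** * Symmetry of the potential operator *)

Section WeightedLimits.
Context {R : realType}.
Implicit Types (a l : \bar R) (u : (\bar R)^nat).

Lemma nondecreasing_cvgeZ a u l : 0 <= a -> (forall n, 0 <= u n) ->
  nondecreasing_seq u -> u n @[n --> \oo] --> l -> a * u n @[n --> \oo] --> a * l.
Proof.
move=> a0 u0 ndu ul.
have ul' n : u n <= l.
  rewrite -(cvg_lim _ ul)// (cvg_lim _ (ereal_nondecreasing_cvgn ndu))//.
  by apply: ereal_sup_ubound; exists n.
case: a a0 => [r _|_|//]; first exact: cvgeZl.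
have := le_trans (u0 0%N) (ul' 0%N); rewrite le_eqVlt => /predU1P[l0|l0].
  have -> : u = fun=> 0.
    by apply/funext => n; apply/eqP; rewrite eq_le u0 andbT l0 ul'.
  by rewrite -l0 mule0; exact: cvg_cst.
rewrite gt0_mulye//; apply: cvg_near_cst.
have [n un] : exists n, 0 < u n.
  apply: contrapT => /forallNP un; move: l0; apply/negP; rewrite -leNgt.
  rewrite -(cvg_lim _ ul)//; apply: lime_le; first by apply/cvg_ex; exists l.
  by apply: nearW => n; rewrite leNgt; apply/negP/un.
near=> k; rewrite gt0_mulye//; apply: (lt_le_trans un); apply: ndu.
by near: k; exact: nbhs_infty_ge.
Unshelve. all: by end_near. Qed.

Lemma limn_einfZ (c : R) u : (0 <= c)%R ->
  c%:E * limn_einf u <= limn_einf (fun n => c%:E * u n).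
Proof.
move=> c0; rewrite !limn_einf_lim.
have cu : c%:E * einfs u n @[n --> \oo] --> c%:E * limn (einfs u).
  by apply: cvgeZl => //; exact: is_cvg_einfs.
rewrite -(cvg_lim _ cu)//; apply: lee_lim.
- by apply/cvg_ex; eexists; exact: cu.
- exact: is_cvg_einfs.
- apply: nearW => n; apply: le_ereal_inf_tmp => _ [k/= nk <-].
  apply: lee_wpmul2l; first by rewrite lee_fin.
  by apply: ereal_inf_lbound; exists k.
Qed.

Lemma nnmfun_limn_einf d (T : measurableType d) (f : nat -> T -> \bar R) :
  (forall n, nnmfun (f n)) -> nnmfun (fun x => limn_einf (f ^~ x)).
Proof.
move=> nf; have mf n : measurable_fun setT (f n) by have [] := nf n.
have f0 x n : 0 <= f n x by have [] := nf n.
split.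
  apply: (@emeasurable_fun_cvg _ _ _ _ (fun n x => einfs (f ^~ x) n)).
    by move=> n; exact: measurable_fun_einfs.
  by move=> x _; rewrite limn_einf_lim; exact: is_cvg_einfs.
move=> x; rewrite limn_einf_lim; apply: lime_ge; first exact: is_cvg_einfs.
by apply: nearW => n; apply: le_ereal_inf_tmp => _ [k _ <-].
Qed.

End WeightedLimits.

Lemma weighted_integral_functional d (T : measurableType d) (R : realType)
    (mu : {measure set T -> \bar R}) (a : T -> \bar R) : nnmfun a ->
  positive_functional (fun h => \int[mu]_x (a x * h x)).
Proof.
move=> na; have a0 x : 0 <= a x by have [] := na.
split.
- by move=> h nh; exact: (nnint_ge0 mu (nnmfunM na nh)).
- move=> g h ng nh; rewrite -(nnintD mu (nnmfunM na ng) (nnmfunM na nh)).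
  by apply: eq_integral => x _; rewrite ge0_muleDr//; [have [] := ng|have [] := nh].
- move=> c h c0 nh; rewrite -(nnintZ mu _ (nnmfunM na nh))//.
  by apply: eq_integral => x _; rewrite muleCA.
- move=> u_ h nu nd uh; apply: nnint_mct.
  + by move=> n; exact: nnmfunM.
  + by move=> x i j ij; apply: lee_wpmul2l => //; exact: nd.
  + by move=> x; apply: nondecreasing_cvgeZ => // n; have [] := nu n.
Qed.

(** The truncations min(h, n w) increase to [h]. With [w] bounded and square
    integrable, they give access to the operators on L^2, which describe the
    transition kernels only on bounded square integrable functions. *)
Lemma functional_truncation d (T : measurableType d) (R : realType)
    (w : T -> R) (I J : (T -> \bar R) -> \bar R) :
  measurable_fun setT w -> (forall x, 0 < w x)%R ->
  positive_functional I -> positive_functional J ->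
  (forall (phi : T -> R) (c : R), measurable_fun setT phi -> (0 <= c)%R ->
    (forall x, 0 <= phi x <= c * w x)%R -> I (EFin \o phi) = J (EFin \o phi)) ->
  forall h, nnmfun h -> I h = J h.
Proof.
move=> mw w0 II JJ IJ h [mh h0].
pose g n x : \bar R := mine (h x) (n%:R * w x)%:E.
have g0 n x : 0 <= g n x by rewrite /g le_min h0 lee_fin mulr_ge0// ltW.
have gle n x : g n x <= (n%:R * w x)%:E by rewrite ge_min lexx orbT.
have gE n : g n = EFin \o (fine \o g n).
  apply/funext => x; rewrite /= fineK// ge0_fin_numE//.
  exact: le_lt_trans (gle n x) (ltry _).
have mg n : measurable_fun setT (g n).
  apply: measurable_mine => //; apply/measurable_EFinP.
  exact: measurable_funM.
have ng n : nnmfun (g n) by [].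
have ndg x : nondecreasing_seq (g ^~ x).
  move=> i j ij; rewrite /g le_min ge_min lexx/= ge_min; apply/orP; right.
  by rewrite lee_fin ler_wpM2r ?ler_nat// ltW.
have gh x : g n x @[n --> \oo] --> h x.
  case hE : (h x) => [r||].
  - apply: cvg_near_cst; near=> n; rewrite /g hE; apply/min_idPl.
    rewrite lee_fin -ler_pdivrMr//; near: n; exact: nbhs_infty_ger.
  - apply/cvgeyPge => A; near=> n; rewrite /g hE minye lee_fin.
    by rewrite -ler_pdivrMr//; near: n; exact: nbhs_infty_ger.
  - by have := h0 x; rewrite hE.
have Ig := functional_cvg II ng ndg gh.
have Jg := functional_cvg JJ ng ndg gh.
have IJg : (fun n => I (g n)) = (fun n => J (g n)).
  apply/funext => n; rewrite gE; apply: (IJ _ n%:R) => //.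
    exact: (measurableT_comp (fine_measurable measurableT) (mg n)).
  move=> x; rewrite -!lee_fin /= -[(fine _)%:E]/((EFin \o (fine \o g n)) x) -gE.
  by rewrite g0 gle.
by rewrite IJg in Ig; exact: (cvg_unique _ Ig Jg).
Unshelve. all: by end_near. Qed.

Section Symmetry.
Context d (T : measurableType d) (R : realType) (mu : {measure set T -> \bar R}).
Variables (p : R -> T -> {measure set T -> \bar R}) (w : T -> R).
Hypotheses (Hp : markov_kernels p) (smu : sigma_finite setT mu).
Hypotheses (w_gt0 : forall x, (0 < w x)%R) (wL2 : L2 mu w)
  (w_bounded : exists C, forall x, (w x <= C)%R).

Lemma L2_dominated (phi : T -> R) (c : R) : measurable_fun setT phi ->
  (0 <= c)%R -> (forall x, 0 <= phi x <= c * w x)%R -> L2 mu phi.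
Proof.
move=> mphi c0 phiw; rewrite /Defs.L2/= inE; apply/andP; split; rewrite inE//=.
have cwL : L2 mu (fun x => c * w x)%R.
  have := L2_lin (c - 1) wL2 wL2; congr (L2 mu).
  by apply/funext => x; ring.
have mcw := L2_measurable cwL.
have : normL2 mu (fun x => c * w x)%R < +oo.
  by move: cwL; rewrite /Defs.L2/= inE => /andP[_]; rewrite inE.
apply: le_lt_trans; rewrite /normL2 unlock /Lnorm.
have n2 (v : T -> R) : measurable_fun setT v -> nnmfun (fun x => `|(EFin \o v) x| `^ 2).
  move=> mv; split; last by move=> x; rewrite poweR_ge0.
  by apply: (measurableT_comp (measurable_poweR _)) => //; apply: measurableT_comp => //; apply: measurableT_comp.
have i0 (v : T -> R) : 0 <= \int[mu]_x (`|(EFin \o v) x| `^ 2).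
  by apply: integral_ge0 => x _; rewrite poweR_ge0.
rewrite gt0_ler_poweR//.
- by rewrite in_itv/= leey i0.
- by rewrite in_itv/= leey i0.
- apply: nnint_le; [exact: n2|exact: n2|].
  move=> x; have /andP[p0 pw] := phiw x.
  rewrite gt0_ler_poweR//.
  + by rewrite in_itv/= leey andbT lee_fin.
  + by rewrite in_itv/= leey andbT lee_fin.
  + by rewrite /= lee_fin !ger0_norm// (le_trans p0).
Qed.

Variable S : R -> (T -> R) -> (T -> R).
Hypothesis S_L2 : forall t u, (0 <= t)%R -> L2 mu u -> L2 mu (S t u).
Hypothesis S_sym : forall t u v, L2 mu u -> L2 mu v -> (0 <= t)%R ->
  dotL2 mu (S t u) v = dotL2 mu u (S t v).
Hypothesis S_kernel : forall t (h : T -> R), (0 <= t)%R ->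
  measurable_fun setT h -> (forall x, (0 <= h x)%R) ->
  (exists C, forall x, (h x <= C)%R) -> L2 mu h ->
  \forall x \ae mu, (S t h x)%:E = transition_op p t (EFin \o h) x.

Let dotE t (phi psi : T -> R) (c e : R) : (0 <= t)%R ->
  measurable_fun setT phi -> (0 <= c)%R -> (forall x, 0 <= phi x <= c * w x)%R ->
  measurable_fun setT psi -> (0 <= e)%R -> (forall x, 0 <= psi x <= e * w x)%R ->
  \int[mu]_x ((psi x)%:E * transition_op p t (EFin \o phi) x) = (dotL2 mu (S t phi) psi)%:E.
Proof.
move=> t0 mphi c0 phiw mpsi e0 psiw.
have phiL := L2_dominated mphi c0 phiw; have psiL := L2_dominated mpsi e0 psiw.
have SpL := S_L2 t0 phiL.
have phi0 x : (0 <= phi x)%R by have /andP[] := phiw x.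
have psi0 x : (0 <= psi x)%R by have /andP[] := psiw x.
have nphi : nnmfun (EFin \o phi).
  by split; [exact/measurable_EFinP|move=> x; rewrite lee_fin].
have npsi : nnmfun (EFin \o psi).
  by split; [exact/measurable_EFinP|move=> x; rewrite lee_fin].
have [C wC] := w_bounded.
have phib : exists C, forall x, (phi x <= C)%R.
  exists (c * C)%R => x; have /andP[_] := phiw x.
  by move=> /le_trans; apply; rewrite ler_wpM2l.
have Spae := S_kernel t0 mphi phi0 phib phiL.
have iSp := integrable_mul SpL psiL.
rewrite /dotL2 /Rintegral fineK; last exact: integrable_fin_num.
apply: ae_eq_integral => //.
- have nsp := nnmfun_semigroup_space Hp t nphi.
  by have [] := nnmfunM npsi nsp.
- exact: (measurable_int _ iSp).
- by apply: filterS Spae => x Sx _; rewrite -Sx muleC.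
Qed.

Lemma semigroup_kernel_symmetric t g h : (0 <= t)%R -> nnmfun g -> nnmfun h ->
  \int[mu]_x (g x * transition_op p t h x) = \int[mu]_x (h x * transition_op p t g x).
Proof.
move=> t0 ng nh; have mw := L2_measurable wL2.
have sem_fun a : nnmfun a ->
    positive_functional (fun k => \int[mu]_x (a x * transition_op p t k x)).
  move=> na; have II := weighted_integral_functional mu na.
  have nS k : nnmfun k -> nnmfun (transition_op p t k) by exact: nnmfun_semigroup_space.
  split.
  - by move=> k nk; exact: (functional_ge0 II (nS _ nk)).
  - move=> k1 k2 n1 n2; rewrite -(functionalD II (nS _ n1) (nS _ n2)).
    by apply: eq_integral => x _; rewrite /transition_op nnintD.
  - move=> c k c0 nk; rewrite -(functionalZ II c0 (nS _ nk)).
    by apply: eq_integral => x _; rewrite /transition_op nnintZ.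
  - move=> u_ k nu nd uk; apply: (functional_cvg II).
    + by move=> n; exact: nS.
    + by move=> x i j ij; apply: nnint_le => // y; exact: nd.
    + by move=> x; exact: nnint_mct.
have rev_fun a : nnmfun a ->
    positive_functional (fun k => \int[mu]_x (k x * transition_op p t a x)).
  move=> na; have := weighted_integral_functional mu (nnmfun_semigroup_space Hp t na).
  congr positive_functional; apply/funext => k.
  by apply: eq_integral => x _; rewrite muleC.
suff H (phi : T -> R) (c : R) : measurable_fun setT phi -> (0 <= c)%R -> (forall x, 0 <= phi x <= c * w x)%R ->
    \int[mu]_x (g x * transition_op p t (EFin \o phi) x) =
    \int[mu]_x ((phi x)%:E * transition_op p t g x).
  exact: (functional_truncation mw w_gt0 (sem_fun g ng) (rev_fun g ng) H nh).
move=> mphi c0 phiw.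
have nphi : nnmfun (EFin \o phi).
  split; first exact/measurable_EFinP.
  by move=> x; rewrite lee_fin; have /andP[] := phiw x.
suff H (psi : T -> R) (e : R) : measurable_fun setT psi -> (0 <= e)%R -> (forall x, 0 <= psi x <= e * w x)%R ->
    \int[mu]_x ((phi x)%:E * transition_op p t (EFin \o psi) x) =
    \int[mu]_x ((psi x)%:E * transition_op p t (EFin \o phi) x).
  exact/esym/(functional_truncation mw w_gt0 (sem_fun _ nphi) (rev_fun _ nphi) H ng).
move=> mpsi e0 psiw.
rewrite (dotE t0 mphi c0 phiw mpsi e0 psiw) (dotE t0 mpsi e0 psiw mphi c0 phiw).
rewrite S_sym//; first by rewrite dotC.
- exact: L2_dominated mpsi e0 psiw.
- exact: L2_dominated mphi c0 phiw.
Qed.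

(** Tonelli writes both sides as time integrals, of which the integrands agree
    by symmetry of the transition kernels. *)
Lemma green_operator_symmetric g h : nnmfun g -> nnmfun h ->
  \int[mu]_x (g x * green_operator p h x) = \int[mu]_x (h x * green_operator p g x).
Proof.
have expand a b : nnmfun a -> nnmfun b ->
    \int[mu]_x (a x * green_operator p b x) =
    \int[lebesgue_measure]_t (halfline t * \int[mu]_x (a x * transition_op p t b x)).
  move=> na nb.
  pose F (z : T * R) := a z.1 * (halfline z.2 * transition_op p z.2 b z.1).
  have sw : measurable_fun setT (fun z : T * R => (z.2, z.1)) by exact: measurable_swap.
  have nF : nnmfun F.
    apply: nnmfunM; first exact: (nnmfun_comp measurable_fst na).
    apply: nnmfunM; first exact: (nnmfun_comp measurable_snd nnmfun_halfline).
    exact: (nnmfun_comp sw (nnmfun_semigroup Hp nb)).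
  have [_ _ tF] := tonelli smu (@sigma_finiteT _ _ _ (@lebesgue_measure R)) nF.
  transitivity (\int[mu]_x \int[lebesgue_measure]_t F (x, t)).
    apply: eq_integral => x _.
    have ax : 0 <= a x by have [] := na.
    have nbx := nnmfunM (@nnmfun_halfline R) (nnmfun_semigroup_time Hp x nb).
    exact/esym/(nnintZ (@lebesgue_measure R) ax nbx).
  rewrite tF; apply: eq_integral => t _.
  have ht : 0 <= halfline t by have [] := @nnmfun_halfline R.
  rewrite -(nnintZ mu ht (nnmfunM na (nnmfun_semigroup_space Hp t nb))).
  by apply: eq_integral => x _; rewrite /F/= muleCA.
move=> ng nh; rewrite (expand g h ng nh) (expand h g nh ng); apply: eq_integral => t _.
have [t0|t0] := ltP t 0%R; first by rewrite (halfline_lt0 t0) mul0e mul0e.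
by rewrite (semigroup_kernel_symmetric t0 ng nh).
Qed.

End Symmetry.

(** * Potentials of measures *)

Section GreenFunction.
Context d (T : measurableType d) (R : realType) (mu : {measure set T -> \bar R}).
Variables (p : R -> T -> {measure set T -> \bar R}) (w rho : T -> R).
Variables (Q : nat -> T -> {measure set T -> \bar R}) (G : T * T -> \bar R).
Hypotheses (Hp : markov_kernels p) (HQ : resolvent_kernels p Q).
Hypotheses (smu : sigma_finite setT mu) (mw : measurable_fun setT w)
  (w_gt0 : forall x, (0 < w x)%R) (iw : \int[mu]_x (w x)%:E < +oo).
Hypotheses (nG : nnmfun G)
  (Gl : forall y, excessive_function p (fun x => G (x, y)))
  (Gr : forall x, excessive_function p (fun y => G (x, y)))
  (GE : forall h x, nnmfun h -> green_operator p h x = \int[mu]_y (G (x, y) * h y)).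
Hypothesis symmetric : forall g h, nnmfun g -> nnmfun h ->
  \int[mu]_x (g x * green_operator p h x) = \int[mu]_x (h x * green_operator p g x).
Hypotheses (rho_gt0 : forall x, (0 < rho x)%R)
  (rho_excessive : excessive_function p (EFin \o rho))
  (Gw_bounded : exists C : R, forall x, green_operator p (EFin \o w) x <= C%:E)
  (Gw_rho : \forall x \ae mu, green_operator p (EFin \o w) x <= (rho x)%:E).

Let nw : nnmfun (EFin \o w).
Proof. by split; [exact/measurable_EFinP|move=> x; rewrite lee_fin ltW]. Qed.

Let nrho : nnmfun (EFin \o rho).
Proof. by case: rho_excessive. Qed.

Let sQ n x : sigma_finite setT (Q n x).
Proof. exact/sigma_finite_le1/(resolvent_le1 Hp HQ). Qed.

(* The potential of the measure w.mu, with the arguments of the Green function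
   exchanged. *)
Let S y := \int[mu]_x ((w x)%:E * G (x, y)).

Let nGx x : nnmfun (fun y => G (x, y)).
Proof. by case: (Gr x). Qed.

Let nGy y : nnmfun (fun x => G (x, y)).
Proof. by case: (Gl y). Qed.

Let nwG : nnmfun (fun z : T * T => (w z.1)%:E * G z).
Proof. by apply: nnmfunM => //; exact: (nnmfun_comp measurable_fst nw). Qed.

Let nS : nnmfun S.
Proof. by have [_ + _] := tonelli smu smu nwG. Qed.

Lemma green_operator_null N : measurable N -> mu N = 0 ->
  forall x, green_operator p (fun y => (\1_N y)%:E) x = 0.
Proof.
move=> mN N0 x; have nN := nnmfun_indic R mN.
rewrite (GE _ nN).
rewrite (nnint_ae_eq (h := fun=> 0) (nnmfunM (nGx x) nN)); last 2 first.
- exact: nnmfun_cst.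
- exists N; split=> // y /= hy; apply: contrapT => Ny; apply: hy.
  by rewrite indicE memNset// mule0.
exact: integral0.
Qed.

Lemma resolvent_ae_mono n h1 h2 : nnmfun h1 -> nnmfun h2 ->
  (\forall x \ae mu, h1 x <= h2 x) ->
  forall x, \int[Q n x]_y h1 y <= \int[Q n x]_y h2 y.
Proof. exact: (resolvent_ae_le Hp HQ green_operator_null). Qed.

(** By symmetry, w.S and w.Vw, where Vw is the potential of [w], have the same
    integral over every measurable set, so S and Vw agree almost everywhere; and
    Vw is below [rho]. *)
Let S_le_rho_ae : \forall x \ae mu, S x <= (rho x)%:E.
Proof.
have nGw := nnmfun_green_operator Hp nw.
have n1 := nnmfunM nw nGw; have n2 := nnmfunM nw nS.
have iGw : mu.-integrable setT (fun x => (w x)%:E * green_operator p (EFin \o w) x).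
  apply/integrableP; split; first by case: n1.
  under eq_integral do rewrite gee0_abs ?(n1.2)//.
  have [C wC] := Gw_bounded.
  have C0 : 0 <= C%:E by apply: le_trans (wC point); have [] := nGw.
  apply: (@le_lt_trans _ _ (C%:E * \int[mu]_x (w x)%:E)).
    rewrite -(nnintZ mu C0 nw); apply: (nnint_le mu n1 (nnmfunM (nnmfun_cst _ C0) nw)) => x.
    by rewrite muleC; apply: lee_wpmul2r => //; rewrite lee_fin ltW.
  by apply: lte_mul_pinfty.
have : ae_eq mu setT (fun x => (w x)%:E * green_operator p (EFin \o w) x)
    (fun x => (w x)%:E * S x).
  apply: (integral_ae_eq measurableT iGw n2.1) => A _ mA.
  have nA := nnmfun_indic R mA.
  have nAw : nnmfun (fun x => (\1_A x)%:E * (w x)%:E) := nnmfunM nA nw.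
  have restr (h : T -> \bar R) :
      \int[mu]_(x in A) ((w x)%:E * h x) = \int[mu]_x (((\1_A x)%:E * (w x)%:E) * h x).
    rewrite integral_mkcond; apply: eq_integral => x _.
    by rewrite patchE indicE; case: ifPn => _; rewrite ?mul1e ?mul0e.
  rewrite !restr (symmetric nAw nw).
  transitivity (\int[mu]_x \int[mu]_y ((w x)%:E * G (x, y) * ((\1_A y)%:E * (w y)%:E))).
    apply: eq_integral => x _; rewrite (GE _ nAw).
    have wx0 : 0 <= (w x)%:E by rewrite lee_fin ltW.
    rewrite -(nnintZ mu wx0 (nnmfunM (nGx x) nAw)).
    by apply: eq_integral => y _; rewrite muleA.
  have nF : nnmfun (fun z : T * T => (w z.1)%:E * G z * ((\1_A z.2)%:E * (w z.2)%:E)).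
    by apply: nnmfunM => //; exact: (nnmfun_comp measurable_snd nAw).
  have [_ _ ->] := tonelli smu smu nF.
  apply: eq_integral => y _.
  have Ay0 : 0 <= (\1_A y)%:E * (w y)%:E by have [] := nAw.
  rewrite -(nnintZ mu Ay0 (nnmfunM nw (nGy y))).
  by apply: eq_integral => x _; rewrite muleC.
have [C wC] := Gw_bounded.
move=> wS; apply: filter_app Gw_rho; apply: filterS wS => x wSx.
apply: le_trans; move: wSx => /(_ Logic.I).
have Gfin : green_operator p (EFin \o w) x \is a fin_num.
  by rewrite ge0_fin_numE; [exact: le_lt_trans (wC x) (ltry _)|have [] := nGw].
have := n2.2 x; rewrite /=; case: (S x) => [s|_|].
- move=> _; rewrite -(fineK Gfin) -!EFinM => -[] /(mulfI (lt0r_neq0 (w_gt0 x))) ->.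
  by [].
- by rewrite gt0_muley ?lte_fin// -(fineK Gfin) -EFinM.
- by rewrite leNye.
Qed.

(** The inequality extends from almost every to every point, because excessive
    functions are recovered from their resolvents, which do not see null
    sets. *)
Let S_le_rho y : S y <= (rho y)%:E.
Proof.
pose F n x := (w x)%:E * \int[Q n y]_z G (x, z).
have nGQ n : nnmfun (fun x => \int[Q n y]_z G (x, z)).
  by have [+ _ _] := tonelli smu (sQ n y) nG.
have nF n : nnmfun (F n) := nnmfunM nw (nGQ n).
have nlim : nnmfun (fun x => limn_einf (F ^~ x)) by exact: nnmfun_limn_einf.
apply: (@le_trans _ _ (\int[mu]_x limn_einf (F ^~ x))).
  apply: (nnint_le mu (nnmfunM nw (nGy y)) nlim) => x.
  apply: (le_trans _ (limn_einfZ _ (ltW (w_gt0 x)))).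
  apply: lee_wpmul2l; first by rewrite lee_fin ltW.
  exact: (excessive_le_limn_einf Hp HQ).
have mF n : measurable_fun setT (F n) by have [] := nF n.
have F0 n x : setT x -> 0 <= F n x by move=> _; have [] := nF n.
apply: (le_trans (fatou mu measurableT mF F0)).
apply: (@le_trans _ _ (limn_einf (fun=> (rho y)%:E))); last first.
  by have [-> _] := cvg_limn_einf_sup (@cvg_cst _ ((rho y)%:E) _ \oo _).
apply: limn_einf_le => n.
have nwG' : nnmfun (fun z : T * T => (w z.1)%:E * G z) by [].
have [_ _ tF] := tonelli smu (sQ n y) nwG'.
have -> : \int[mu]_x F n x = \int[Q n y]_z S z.
  rewrite -tF; apply: eq_integral => x _; rewrite /F.
  have wx0 : 0 <= (w x)%:E by rewrite lee_fin ltW.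
  exact/esym/(nnintZ (Q n y) wx0 (nGx x)).
apply: (le_trans (resolvent_ae_mono n nS nrho S_le_rho_ae y)).
exact: (excessive_resolvent_le Hp HQ).
Qed.

Definition measure_potential (nu : {measure set T -> \bar R}) x : \bar R :=
  \int[nu]_y G (x, y).

Section MeasurePotential.
Variable nu : {measure set T -> \bar R}.
Hypothesis nu_rho : \int[nu]_x (rho x)%:E < +oo.

Let snu : sigma_finite setT nu.
Proof.
apply: (sigma_finite_integrable_gt0 _ rho_gt0 nu_rho).
by apply/measurable_EFinP; case: nrho.
Qed.

Lemma nnmfun_measure_potential : nnmfun (measure_potential nu).
Proof. by have [+ _ _] := tonelli smu snu nG. Qed.

(** By Tonelli, the left-hand side is the integral of [S] with respect to
    [nu]. The bound of [S] by [rho] is needed at every point here, as [nu] may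
    charge null sets of [mu]. *)
Lemma integral_measure_potential_lty :
  \int[mu]_x ((w x)%:E * measure_potential nu x) < +oo.
Proof.
have [_ nS' tF] := tonelli smu snu nwG.
apply: (le_lt_trans _ nu_rho).
have -> : \int[mu]_x ((w x)%:E * measure_potential nu x) = \int[nu]_y S y.
  rewrite -tF; apply: eq_integral => x _; rewrite /measure_potential.
  have wx0 : 0 <= (w x)%:E by rewrite lee_fin ltW.
  exact/esym/(nnintZ nu wx0 (nGx x)).
exact: (nnint_le nu nS nrho).
Qed.

Lemma resolvent_measure_potential_le n x :
  \int[Q n x]_y measure_potential nu y <= measure_potential nu x.
Proof.
rewrite /measure_potential; have [_ nQ ->] := tonelli (sQ n x) snu nG.
apply: (nnint_le nu nQ (nGx x)) => y.
exact: (excessive_resolvent_le Hp HQ n x (Gl y)).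
Qed.

End MeasurePotential.

(** Symmetry moves the potential operator from [h] to [w], whose potential is
    below [rho]. *)
Lemma integral_green_operator_le h : nnmfun h ->
  \int[mu]_x ((w x)%:E * green_operator p h x) <= \int[mu]_x ((rho x)%:E * h x).
Proof.
move=> nh; rewrite (symmetric nw nh).
have nGw := nnmfun_green_operator Hp nw.
apply: (nnint_ae_le (nnmfunM nh nGw) (nnmfunM nrho nh)).
apply: filterS Gw_rho => x Gx; rewrite muleC; apply: lee_wpmul2r => //.
by have [] := nh.
Qed.

Lemma weighted_lty_ae h : nnmfun h -> \int[mu]_x ((w x)%:E * h x) < +oo ->
  \forall x \ae mu, h x \is a fin_num.
Proof.
move=> nh /(nnint_fin_ae (nnmfunM nw nh)); apply: filterS => x.
have := nh.2 x; case: (h x) => //= _.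
by rewrite gt0_muley ?lte_fin.
Qed.

End GreenFunction.

Local Close Scope ereal_scope.

(** * Regularization of the nonlinearity *)

Section Regularization.
Context {R : realType}.
Implicit Types (g : R -> R) (a b y z c k : R).

(** The least function above [g] on [[a, b]] whose sum with [y |-> k * y] is
    nondecreasing: subtracting [k * y] from the running maximum of
    [z |-> g z + k * z]. *)
Definition running_sup g a k y : R :=
  sup [set g z - k * (y - z) | z in [set z | a <= z <= y]].

Section Bounded.
Variables (g : R -> R) (a b h : R).
Hypotheses (gcont : continuous g) (gh : forall z, a <= z <= b -> `|g z| <= h).

Let ubound k y z : 0 <= k -> a <= z <= y -> y <= b -> g z - k * (y - z) <= h.
Proof.
move=> k0 /andP[az zy] yb; apply: (@le_trans _ _ (g z)).
  by rewrite gerBl mulr_ge0// subr_ge0.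
by apply: (le_trans (ler_norm _)); apply: gh; rewrite az (le_trans zy).
Qed.

Lemma running_sup_ge k y z : 0 <= k -> a <= z <= y -> y <= b ->
  g z - k * (y - z) <= running_sup g a k y.
Proof.
move=> k0 azy yb; apply: ub_le_sup; last by exists z.
by exists h => _ [x /= axy <-]; exact: ubound.
Qed.

Lemma running_sup_le k y c : a <= y -> (forall z, a <= z <= y -> g z - k * (y - z) <= c) ->
  running_sup g a k y <= c.
Proof.
move=> ay gc; apply: ge_sup; first by exists (g y - k * (y - y)), y; rewrite //= ay lexx.
by move=> _ [z /= azy <-]; exact: gc.
Qed.

Lemma le_running_sup k y : 0 <= k -> a <= y <= b -> g y <= running_sup g a k y.
Proof.
move=> k0 /andP[ay yb]; have := @running_sup_ge k y y k0.
by rewrite subrr mulr0 subr0 ay lexx => /(_ isT yb).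
Qed.

Lemma running_sup_norm k y : 0 <= k -> a <= y <= b -> `|running_sup g a k y| <= h.
Proof.
move=> k0 ayb; have /andP[ay yb] := ayb; rewrite ler_norml; apply/andP; split.
  apply: (le_trans _ (le_running_sup k0 ayb)).
  by have := gh ayb; rewrite ler_norml => /andP[].
by apply: running_sup_le => // z azy; exact: ubound.
Qed.

Lemma running_sup_mono k y y' : 0 <= k -> a <= y -> y <= y' -> y' <= b ->
  running_sup g a k y + k * y <= running_sup g a k y' + k * y'.
Proof.
move=> k0 ay yy' y'b; rewrite -lerBrDr; apply: running_sup_le => // z /andP[az zy].
have := @running_sup_ge k y' z k0; rewrite az (le_trans zy yy') => /(_ isT y'b).
lra.
Qed.

Lemma running_sup_antitone k k' y : 0 <= k -> k <= k' -> a <= y <= b ->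
  running_sup g a k' y <= running_sup g a k y.
Proof.
move=> k0 kk' /andP[ay yb]; apply: running_sup_le => // z azy.
apply: (le_trans _ (running_sup_ge k0 azy yb)).
by rewrite lerD2l lerN2 ler_wpM2r// subr_ge0; case/andP: azy.
Qed.

Let near_g y e : 0 < e -> exists2 d : R, 0 < d & forall z, `|y - z| < d -> `|g y - g z| <= e.
Proof.
move=> e0; have /cvgrPdist_le/(_ e e0) := @gcont y.
by move=> [d /= d0 dg]; exists d => // z zd; exact: dg.
Qed.

(** Passing from y to a nearby y' > y only adds to the supremum points z with
    [g z] close to [g y], and moves the penalty by little. *)
Lemma running_sup_right_continuous k y (u : nat -> R) : 0 <= k -> a <= y ->
  (forall n, y <= u n <= b) -> u n @[n --> \oo] --> y ->
  running_sup g a k (u n) @[n --> \oo] --> running_sup g a k y.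
Proof.
move=> k0 ay yu uy; apply/cvgrPdist_le => e e0.
have yb : y <= b by have /andP[yu0 ub0] := yu 0%N; exact: le_trans ub0.
have [d d0 dg] := @near_g y _ (divr_gt0 e0 (ltr0Sn _ 1)).
have e2 : 0 < e / (2 * (k + 1)) by rewrite divr_gt0// mulr_gt0// ltr_wpDl.
near=> n.
have un_d : `|y - u n| < d by near: n; move/cvgrPdist_lt : uy; exact.
have un_e : `|y - u n| < e / (2 * (k + 1)) by near: n; move/cvgrPdist_lt : uy; exact.
have /andP[yun unb] := yu n.
have ke : k * (u n - y) <= e.
  move: un_e; rewrite distrC ger0_norm ?subr_ge0// => un_e.
  apply: (@le_trans _ _ (k * (e / (2 * (k + 1))))); first by rewrite ler_wpM2l// ltW.
  have k1 : 0 < 2 * (k + 1) by rewrite mulr_gt0// ltr_wpDl.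
  by rewrite mulrA ler_pdivrMr//; nra.
have low := running_sup_mono k0 ay yun unb.
have up : running_sup g a k (u n) <= running_sup g a k y + e.
  apply: running_sup_le => [|z /andP[az zu]]; first exact: le_trans yun.
  have [zy|yz] := leP z y.
    have := @running_sup_ge k y z k0; rewrite az zy => /(_ isT yb).
    have : k * y <= k * u n by rewrite ler_wpM2l.
    lra.
  have : `|g y - g z| <= e / 2.
    apply: dg; apply: le_lt_trans un_d.
    by rewrite !(distrC y) !ger0_norm ?subr_ge0// ?(ltW yz)// lerD2r.
  have ayb : a <= y <= b by rewrite ay yb.
  have := le_running_sup k0 ayb.
  have : 0 <= k * (u n - z) by rewrite mulr_ge0// subr_ge0.
  rewrite ler_norml => ? ? /andP[? ?]; lra.
rewrite ler_norml; apply/andP; split; lra.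
Unshelve. all: by end_near. Qed.

(** A steep slope penalizes all points z away from y, and those near y give
    values near [g y]. *)
Lemma running_sup_cvg y (u : nat -> R) : a <= y ->
  (forall n, y <= u n <= b) -> u n @[n --> \oo] --> y ->
  running_sup g a n.+1%:R (u n) @[n --> \oo] --> g y.
Proof.
move=> ay yu uy; apply/cvgrPdist_le => e e0.
have yb : y <= b by have /andP[yu0 ub0] := yu 0%N; exact: le_trans ub0.
have [d d0 dg] := @near_g y _ e0.
near=> n.
have un_d : `|y - u n| < d by near: n; move/cvgrPdist_lt : uy; exact.
have nd : (h - g y) / d <= n%:R by near: n; exact: nbhs_infty_ger.
have /andP[yun unb] := yu n.
have n0 : 0 <= n.+1%:R :> R by exact: ler0n.
have aub : a <= u n <= b by rewrite (le_trans ay yun) unb.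
have := le_running_sup n0 aub.
have := dg _ un_d; rewrite ler_norml => /andP[g1 g2] low.
have up : running_sup g a n.+1%:R (u n) <= g y + e.
  apply: running_sup_le => [|z /andP[az zu]]; first exact: le_trans yun.
  have nz : 0 <= n.+1%:R * (u n - z) by rewrite mulr_ge0// subr_ge0.
  have [zd|zd] := ltP (y - d) z.
    have : `|g y - g z| <= e.
      apply: dg; move: un_d; rewrite !ltr_norml => /andP[? ?]; apply/andP; split; lra.
    rewrite ler_norml => /andP[? ?]; lra.
  have gz : g z <= h.
    by apply: (le_trans (ler_norm _)); apply: gh; rewrite az (le_trans zu).
  move: nd; rewrite ler_pdivrMr// => nd.
  have : n%:R * d <= n.+1%:R * (u n - z).
    apply: ler_pM; rewrite ?ler0n ?ler_nat ?(ltW d0)//; lra.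
  lra.
rewrite ler_norml; apply/andP; split; lra.
Unshelve. all: by end_near. Qed.

End Bounded.

(** By continuity, rational points of the segment from y to [a] suffice for the
    supremum. A parameter q in [0, 1], and not the point itself, is rational, so
    that q does not depend on the endpoints: this yields measurability when [g],
    [a] and [y] vary measurably. *)
Lemma running_sup_gtP g a k y c b h : continuous g ->
  (forall z, a <= z <= b -> `|g z| <= h) -> 0 <= k -> a <= y <= b ->
  c < running_sup g a k y <->
  exists q : rat, 0 <= (ratr q : R) <= 1 /\
    c < g (y + ratr q * (a - y)) - k * (y - (y + ratr q * (a - y))).
Proof.
move=> gc gh k0 /andP[ay yb]; split; last first.
  move=> [q [/andP[q0 q1] cq]]; apply: (lt_le_trans cq).
  apply: (running_sup_ge gh k0) => //.
  have : 0 <= ratr q * (y - a) by rewrite mulr_ge0// subr_ge0.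
  have : ratr q * (y - a) <= 1 * (y - a) by rewrite ler_wpM2r// subr_ge0.
  by move=> h1 h2; apply/andP; split; lra.
move=> csup.
have [z /andP[az zy] cz] : exists2 z, a <= z <= y & c < g z - k * (y - z).
  apply: contrapT => /forall2NP nz; move: csup; apply/negP; rewrite -leNgt.
  apply: running_sup_le => // z azy; rewrite leNgt; apply/negP => cz.
  by case: (nz z) => [|]; [exact|apply].
move: ay; rewrite le_eqVlt => /predU1P[ay|ay].
  exists 0; rewrite rmorph0 lexx ler01 mul0r addr0; split => //.
  have zE : z = y by apply/eqP; rewrite eq_le zy -ay az.
  by move: cz; rewrite zE.
pose G t := g (y + t * (a - y)) - k * (y - (y + t * (a - y))).
have Gc : continuous G.
  move=> t; have lin : {for t, continuous (fun t : R => y + t * (a - y) : R)}.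
    by apply: cvgD; [exact: cvg_cst|apply: cvgM; [exact: cvg_id|exact: cvg_cst]].
  apply: cvgB; first exact: (continuous_comp lin (@gc _)).
  by apply: cvgM; [exact: cvg_cst|apply: cvgB; [exact: cvg_cst|exact: lin]].
pose t0 := (y - z) / (y - a).
have ya0 : 0 < y - a by rewrite subr_gt0.
have t01 : 0 <= t0 <= 1.
  by rewrite divr_ge0 ?subr_ge0 ?(ltW ay)//= ler_pdivrMr// mul1r lerD2l lerN2.
have Gt0 : c < G t0.
  rewrite /G (_ : y + t0 * (a - y) = z)//.
  by rewrite /t0 -[a - y]opprB mulrN divfK ?gt_eqF//; lra.
have : \forall t \near t0, c < G t.
  have := Gc t0 => /cvgrPdist_lt/(_ (G t0 - c)); rewrite subr_gt0 => /(_ Gt0).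
  by apply: filterS => t; rewrite ltr_norml => /andP[_ ?]; lra.
move=> [d /= d0 dG].
have lo_hi : Num.max 0 (t0 - d) < Num.min 1 (t0 + d).
  by rewrite lt_min !gt_max; have /andP[? ?] := t01; apply/andP; split; apply/andP; split; lra.
have [q] := rat_in_itvoo lo_hi.
rewrite in_itv/= lt_min gt_max => /andP[/andP[q0 q1] /andP[q2 q3]].
exists q; split; first by rewrite (ltW q0) (ltW q2).
by apply: dG; rewrite /= ltr_norml; apply/andP; split; lra.
Qed.

End Regularization.

Section Caratheodory.
Context d (T : measurableType d) (R : realType).
Variable f : T -> R -> R.
Hypotheses (mf : forall y, measurable_fun setT (f ^~ y)) (cf : forall x, continuous (f x)).

(** Continuity in the second variable gives joint measurability of [f]. *)
Lemma measurable_superposition (v : T -> R) : measurable_fun setT v ->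
  measurable_fun setT (fun x => f x (v x)).
Proof.
move=> mv.
have mf2 : measurable_fun setT (fun z : R * T => f z.2 z.1).
  apply: (@right_continuous_measurable _ T R (fun t x => f x t)) => // x t.
  by apply: cvg_at_right_filter; exact: cf.
have mp : measurable_fun setT (fun x => (v x, x)) by exact: measurable_fun_pair.
exact: (measurableT_comp mf2 mp).
Qed.

Lemma measurable_running_sup (lo v h : T -> R) k : measurable_fun setT lo ->
  measurable_fun setT v -> (forall x, lo x <= v x) -> 0 <= k ->
  (forall x y, lo x <= y <= v x -> `|f x y| <= h x) ->
  measurable_fun setT (fun x => running_sup (f x) (lo x) k (v x)).
Proof.
move=> mlo mv lov k0 fh.
apply: (measurability _ (RGenOInfty.measurableE R)) => _ [_ [c ->] <-].
rewrite setTI (_ : _ @^-1` _ = \bigcup_(q in [set q : rat | 0 <= (ratr q : R) <= 1])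
  [set x | c < f x (v x + ratr q * (lo x - v x)) -
    k * (v x - (v x + ratr q * (lo x - v x)))]); last first.
  have E x := @running_sup_gtP R (f x) (lo x) k (v x) c (v x) (h x) (@cf x) (fh x) k0.
  apply/seteqP; split => x /=; rewrite ?in_itv/= ?andbT.
    by rewrite E ?lov ?lexx// => -[q [q01 qc]]; exists q.
  by move=> [q q01 qc]; rewrite E ?lov ?lexx//; exists q.
rewrite bigcup_mkcond; apply: bigcupT_measurable_rat => q.
case: ifPn => // _.
have mvq : measurable_fun setT (fun x => v x + ratr q * (lo x - v x)).
  by apply: measurable_funD => //; apply: measurable_funM => //; exact: measurable_funB.
have mF : measurable_fun setT (fun x => f x (v x + ratr q * (lo x - v x)) -
    k * (v x - (v x + ratr q * (lo x - v x)))).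
  apply: measurable_funB; first exact: measurable_superposition.
  by apply: measurable_funM => //; exact: measurable_funB.
have := mF measurableT _ (measurable_itv `]c, +oo[).
rewrite setTI; congr (measurable _); apply/seteqP; split => x /=; by rewrite in_itv/= andbT.
Qed.
End Caratheodory.

(** * Truncated nonlinearity *)

Section Clamp.
Context {R : realType}.
Implicit Types a b y : R.

Definition clamp a b y : R := Num.max a (Num.min b y).

Lemma clamp_between a b y : a <= b -> a <= clamp a b y <= b.
Proof. by move=> ab; rewrite /clamp le_max lexx/= ge_max ab ge_min lexx. Qed.

Lemma clamp_id a b y : a <= y <= b -> clamp a b y = y.
Proof. by move=> /andP[ay yb]; rewrite /clamp (min_idPr yb) (max_idPr ay). Qed.

Lemma clamp_above a b y : a <= b -> b <= y -> clamp a b y = b.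
Proof. by move=> ab yb; rewrite /clamp (min_idPl yb) (max_idPr ab). Qed.

Lemma clamp_homo a b y y' : y <= y' ->
  clamp a b y <= clamp a b y' <= clamp a b y + (y' - y).
Proof.
move=> yy'; rewrite /clamp; apply/andP.
by case: (leP b y) => ?; case: (leP b y') => ?; case: (leP a b) => ?; case: (leP a y) => ?;
  case: (leP a y') => ?; split; lra.
Qed.

Lemma clamp_cvg a b y (u : nat -> R) : u n @[n --> \oo] --> y ->
  clamp a b (u n) @[n --> \oo] --> clamp a b y.
Proof.
move=> uy; apply/cvgrPdist_le => e e0.
move/cvgrPdist_le : uy => /(_ e e0); apply: filterS => n; apply: le_trans.
have [yu|uy] := leP y (u n).
  have /andP[? ?] := clamp_homo a b yu.
  by rewrite distrC [in leRHS]distrC !ger0_norm ?subr_ge0//; lra.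
have /andP[? ?] := clamp_homo a b (ltW uy).
by rewrite !ger0_norm ?subr_ge0 ?(ltW uy)//; lra.
Qed.

Lemma measurable_clamp d (T : measurableType d) (a b v : T -> R) :
  measurable_fun setT a -> measurable_fun setT b -> measurable_fun setT v ->
  measurable_fun setT (fun x => clamp (a x) (b x) (v x)).
Proof. by move=> ma mb mv; apply: measurable_maxr => //; exact: measurable_minr. Qed.

End Clamp.

Section Truncation.
Context d (T : measurableType d) (R : realType).
Variables (f : T -> R -> R) (lo hi H : T -> R).
Hypotheses (mf : forall y, measurable_fun setT (f ^~ y)) (cf : forall x, continuous (f x)).
Hypotheses (mlo : measurable_fun setT lo) (mhi : measurable_fun setT hi).
Hypotheses (lohi : forall x, lo x <= hi x)
  (fH : forall x y, lo x <= y <= hi x -> `|f x y| <= H x).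

(** Truncation confines the argument to the interval on which [f x] is bounded
    by [H x]; the slope n+1 will be matched by the resolvent at n+1. *)
Definition truncated n x y : R :=
  running_sup (f x) (lo x) n.+1%:R (clamp (lo x) (hi x) y).

Let n0 n : 0 <= n.+1%:R :> R. Proof. exact: ler0n. Qed.

Let between x y := clamp_between y (lohi x).

Lemma truncated_norm n x y : `|truncated n x y| <= H x.
Proof. exact: (running_sup_norm (@fH x) (n0 n) (between x y)). Qed.

Lemma truncated_ge n x y : lo x <= y <= hi x -> f x y <= truncated n x y.
Proof.
move=> yb; rewrite /truncated clamp_id//; exact: (le_running_sup (@fH x) (n0 n) yb).
Qed.

Lemma truncated_above n x y : hi x <= y -> truncated n x y = truncated n x (hi x).
Proof. by move=> xy; rewrite /truncated !clamp_above. Qed.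

Lemma truncated_slope n x y y' : y <= y' ->
  truncated n x y + n.+1%:R * y <= truncated n x y' + n.+1%:R * y'.
Proof.
move=> yy'; have /andP[c1 c2] := clamp_homo (lo x) (hi x) yy'.
have /andP[b1 b2] := between x y; have /andP[b3 b4] := between x y'.
have := running_sup_mono (@fH x) (n0 n) b1 c1 b4; rewrite -!/(truncated _ _ _).
have : n.+1%:R * (clamp (lo x) (hi x) y' - clamp (lo x) (hi x) y) <= n.+1%:R * (y' - y).
  by apply: ler_wpM2l => //; lra.
lra.
Qed.

Lemma truncated_antitone n x y : truncated n.+1 x y <= truncated n x y.
Proof.
apply: (running_sup_antitone (@fH x) (n0 n) _ (between x y)).
by rewrite ler_nat.
Qed.

Lemma truncated_right_continuous n x y (u : nat -> R) : (forall k, y <= u k) ->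
  u k @[k --> \oo] --> y -> truncated n x (u k) @[k --> \oo] --> truncated n x y.
Proof.
move=> yu uy; apply: (running_sup_right_continuous (@cf x) (@fH x) (n0 n)).
- by have /andP[] := between x y.
- by move=> k; have /andP[-> _] := clamp_homo (lo x) (hi x) (yu k); have /andP[] := between x (u k).
- exact: clamp_cvg.
Qed.

Lemma truncated_cvg x y (u : nat -> R) : lo x <= y <= hi x -> (forall k, y <= u k) ->
  u k @[k --> \oo] --> y -> truncated k x (u k) @[k --> \oo] --> f x y.
Proof.
move=> yb yu uy; have cy := clamp_id yb.
apply: (running_sup_cvg (@cf x) (@fH x) (u := fun k => clamp (lo x) (hi x) (u k))).
- by have /andP[] := yb.
- move=> k; have /andP[+ _] := clamp_homo (lo x) (hi x) (yu k); rewrite cy => ->.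
  by have /andP[] := between x (u k).
- by rewrite -cy; exact: clamp_cvg.
Qed.

Lemma measurable_truncated n v : measurable_fun setT v ->
  measurable_fun setT (fun x => truncated n x (v x)).
Proof.
move=> mv; apply: (measurable_running_sup mf cf (h := H)) => //.
- exact: measurable_clamp.
- by move=> x; have /andP[] := between x (v x).
- move=> x y /andP[ly yc]; apply: fH; rewrite ly/=; apply: (le_trans yc).
  by have /andP[] := between x (v x).
Qed.

End Truncation.

Local Open Scope ereal_scope.

(** * The regularized equations *)

Section MaximumPrinciple.
Context d (T : measurableType d) (R : realType) (mu : {measure set T -> \bar R}).
Variables (p : R -> T -> {measure set T -> \bar R}).
Variable Q : nat -> T -> {measure set T -> \bar R}.
Hypotheses (Hp : markov_kernels p) (HQ : resolvent_kernels p Q).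
Hypothesis V_null : forall N, measurable N -> mu N = 0 ->
  forall x, green_operator p (fun y => (\1_N y)%:E) x = 0.
Local Notation V := (green_operator p).
Implicit Types g h z a b : T -> \bar R.

Lemma green_kernel x : exists nu : {measure set T -> \bar R},
  forall h, nnmfun h -> \int[nu]_y h y = V h x.
Proof.
apply/functional_measure/(weighted_potential_functional Hp) => //.
exact: nnmfun_halfline.
Qed.

Lemma green_operatorD g h x : nnmfun g -> nnmfun h ->
  V (fun y => g y + h y) x = V g x + V h x.
Proof.
move=> ng nh; have [nu nuV] := green_kernel x.
by rewrite -!nuV//; [exact: nnintD|exact: nnmfunD].
Qed.

Lemma green_operator_ae_le g h : nnmfun g -> nnmfun h ->
  (\forall x \ae mu, g x <= h x) -> forall x, V g x <= V h x.
Proof.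
move=> ng nh [N [mN N0 gh]] x; have [nu nuV] := green_kernel x.
rewrite -!nuV//; apply: nnint_ae_le => //; exists N; split => //.
by rewrite -(V_null mN N0 x) -nuV; [rewrite integral_indic// setIT|exact: nnmfun_indic].
Qed.

Lemma green_operator_ae_eq g h : nnmfun g -> nnmfun h ->
  (\forall x \ae mu, g x = h x) -> forall x, V g x = V h x.
Proof.
move=> ng nh gh x; apply/eqP; rewrite eq_le; apply/andP; split;
  by apply: green_operator_ae_le => //; apply: filterS gh => y ->.
Qed.

Lemma green_operator_dct (u_ : nat -> T -> \bar R) h g x :
  (forall n, nnmfun (u_ n)) -> nnmfun h -> nnmfun g ->
  (\forall x \ae mu, u_ n x @[n --> \oo] --> h x) ->
  (forall n x, u_ n x <= g x) -> V g x < +oo ->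
  V (u_ n) x @[n --> \oo] --> V h x.
Proof.
move=> nu nh ng [N [mN N0 uh]] ug Vg; have [nu_ nuV] := green_kernel x.
rewrite -nuV//; under eq_fun do rewrite -nuV//.
apply: (nnint_dct nu nh ng _ ug); last by rewrite nuV.
exists N; split => //.
by rewrite -(V_null mN N0 x) -nuV; [rewrite integral_indic// setIT|exact: nnmfun_indic].
Qed.

Let Q_le := resolvent_ae_le Hp HQ V_null.

Lemma resolvent_null n N x : measurable N -> mu N = 0 -> Q n x N = 0.
Proof.
move=> mN N0; apply/eqP; rewrite eq_le measure_ge0 andbT.
have N1 : \forall y \ae mu, (\1_N y)%:E <= (0 : \bar R).
  exists N; split => // y /=; apply: contra_notP => Ny.
  by rewrite indicE memNset.
have := Q_le n (nnmfun_indic R mN) (nnmfun_cst T (lexx 0)) N1 x.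
by rewrite integral_indic// setIT integral0.
Qed.

(** A subsolution [z] of the resolvent equation lies below a supersolution
    [a] as soon as the excess of the source of [z] over that of [a] is absorbed
    by [a - z] where [z <= a], and is nonpositive elsewhere, because [(z - a)^+]
    is then subinvariant and below a finite potential. *)
Lemma resolvent_comparison n z a b b' g :
  nnmfun z -> nnmfun a -> nnmfun b -> nnmfun b' -> nnmfun g ->
  (\forall x \ae mu, V g x < +oo) -> (\forall x \ae mu, a x \is a fin_num) ->
  (\forall x \ae mu, z x <= V g x) ->
  (\forall x \ae mu, z x <= \int[Q n x]_y (z y + b y)) ->
  (\forall x \ae mu, \int[Q n x]_y (a y + b' y) <= a x) ->
  (\forall x \ae mu, z x + b x <= a x + b' x + maxe 0 (z x - a x)) ->
  \forall x \ae mu, z x <= a x.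
Proof.
move=> nz na nb nb' ng Vg afin zg zQ Qa zba.
pose e x := maxe 0 (z x - a x).
have ne : nnmfun e.
  split; last by move=> x; rewrite le_max lexx.
  apply: measurable_maxe => //; apply: emeasurable_funB; [by case: nz|by case: na].
have e0 : \forall x \ae mu, e x = 0.
  apply: (@resolvent_vanish _ _ _ p Hp Q HQ mu n e g) => //.
  - exact: (@Q_le n).
  - near=> x.
    have zx : z x <= V g x by near: x.
    rewrite /e ge_max (le_trans (nz.2 x) zx)/=.
    by apply: (le_trans _ zx); rewrite leeBlDr//; [rewrite leeDl//; exact: na.2|near: x].
  - near=> x; rewrite /e ge_max nnint_ge0//=.
    have ax : a x \is a fin_num by near: x.
    rewrite leeBlDr//; apply: (@le_trans _ _ (\int[Q n x]_y (z y + b y))); first by near: x.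
    apply: (@le_trans _ _ (\int[Q n x]_y (a y + b' y + e y))).
      by apply: Q_le => //; do ?apply: nnmfunD.
    rewrite (nnintD _ (nnmfunD na nb') ne) addeC leeD2l//.
    by near: x.
near=> x.
have ax : a x \is a fin_num by near: x.
have : e x = 0 by near: x.
rewrite /e => ex; have : z x - a x <= 0 by rewrite -ex le_max lexx orbT.
by rewrite sube_le0.
Unshelve. all: by end_near. Qed.

End MaximumPrinciple.

Section RegularizedEquation.
Context d (T : measurableType d) (R : realType) (mu : {measure set T -> \bar R}).
Variables (p : R -> T -> {measure set T -> \bar R}).
Variable Q : nat -> T -> {measure set T -> \bar R}.
Hypotheses (Hp : markov_kernels p) (HQ : resolvent_kernels p Q).
Hypothesis V_null : forall N, measurable N -> mu N = 0 ->
  forall x, green_operator p (fun y => (\1_N y)%:E) x = 0.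
Local Notation V := (green_operator p).
Variables (f : T -> R -> R) (lo hi H K : T -> R).
Hypotheses (mf : forall y, measurable_fun setT (f ^~ y)) (cf : forall x, continuous (f x)).
Hypotheses (mlo : measurable_fun setT lo) (mhi : measurable_fun setT hi)
  (mH : measurable_fun setT H) (mK : measurable_fun setT K).
Hypotheses (lohi : forall x, (lo x <= hi x)%R)
  (fH : forall x y, (lo x <= y <= hi x)%R -> (`|f x y| <= H x)%R).
Hypothesis VH_fin : \forall x \ae mu, V (EFin \o H) x < +oo.
Implicit Types (z w a b q : T -> \bar R) (v : T -> R).

(** Adding [H] makes the source nonnegative. *)
Definition source n v x : \bar R := (truncated f lo hi n x (v x) + H x)%:E.

(** The unknown is z = u - K, where [K] collects the potential of the data and
    the correction for the addition of [H]; then z is a potential of a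
    nonnegative source. *)
Definition translate z x : R := (fine (z x) + K x)%R.

Definition source_bound x : \bar R := (H x)%:E + (H x)%:E.

Let c n : \bar R := (n.+1%:R^-1)%:E.

Let c0 n : (0 : \bar R) <= c n. Proof. by rewrite lee_fin invr_ge0 ler0n. Qed.

Let H0 x : (0 <= H x)%R.
Proof. by apply: le_trans (fH (y := lo x) _); rewrite ?lexx ?lohi. Qed.

Lemma nnmfun_source_bound : nnmfun source_bound.
Proof.
have nH : nnmfun (EFin \o H) by split; [exact/measurable_EFinP|move=> x; rewrite lee_fin].
exact: nnmfunD.
Qed.

Lemma green_source_bound_lty : \forall x \ae mu, V source_bound x < +oo.
Proof.
have nH : nnmfun (EFin \o H) by split; [exact/measurable_EFinP|move=> x; rewrite lee_fin].
apply: filterS VH_fin => x Vx; rewrite /source_bound (green_operatorD Hp x nH nH).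
by rewrite lte_add_pinfty.
Qed.

Lemma source_le n v x : source n v x <= source_bound x.
Proof.
rewrite /source /source_bound -EFinD lee_fin lerD2r.
by apply: (le_trans (ler_norm _)); exact: truncated_norm.
Qed.

Lemma nnmfun_source n v : measurable_fun setT v -> nnmfun (source n v).
Proof.
move=> mv; split.
  by apply/measurable_EFinP/measurable_funD => //; exact: (measurable_truncated (H := H)).
move=> x; rewrite lee_fin -lerBlDr sub0r.
by have := truncated_norm lohi fH n x (v x); rewrite ler_norml => /andP[].
Qed.

Lemma measurable_translate z : nnmfun z -> measurable_fun setT (translate z).
Proof. by move=> [mz _]; apply: measurable_funD => //; exact: measurableT_comp. Qed.

Let nsource n z : nnmfun z -> nnmfun (source n (translate z)).
Proof. by move=> nz; exact/nnmfun_source/measurable_translate. Qed.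

Let ncsource n z : nnmfun z -> nnmfun (fun y => c n * source n (translate z) y).
Proof. by move=> nz; apply: nnmfunM; [exact: nnmfun_cst|exact: nsource]. Qed.

(** The map y |-> y + source / (n+1) is nondecreasing, by the choice of the
    regularization; hence the iteration map [step] below is order
    preserving. *)
Lemma truncated_step n x (y y' : R) : (y <= y')%R ->
  (y + n.+1%:R^-1 * (truncated f lo hi n x y + H x) <=
   y' + n.+1%:R^-1 * (truncated f lo hi n x y' + H x))%R.
Proof.
move=> yy'; have := truncated_slope lohi fH n x yy'.
set i := (n.+1%:R^-1)%R; have i0 : (0 <= i)%R by rewrite invr_ge0 ler0n.
have ii : (i * n.+1%:R = 1)%R by rewrite mulVf// pnatr_eq0.
move=> /(ler_wpM2l i0); rewrite !mulrDr !(mulrA i n.+1%:R%R) ii !mul1r.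
lra.
Qed.

Let step n z x := \int[Q n x]_y (z y + c n * source n (translate z) y).

Let nstep n z : nnmfun z -> nnmfun (step n z).
Proof.
by move=> nz; apply: (nnmfun_resolvent Hp HQ); apply: nnmfunD => //; exact: ncsource.
Qed.

Let step_le n z w : nnmfun z -> nnmfun w -> (\forall x \ae mu, w x < +oo) ->
  (\forall x \ae mu, z x <= w x) -> forall x, step n z x <= step n w x.
Proof.
move=> nz nw wfin zw; apply: (resolvent_ae_le Hp HQ V_null).
- by apply: nnmfunD => //; exact: ncsource.
- by apply: nnmfunD => //; exact: ncsource.
- near=> x.
  have zwx : z x <= w x by near: x.
  have wx : w x \is a fin_num by rewrite ge0_fin_numE; [near: x|exact: nw.2].
  have zx : z x \is a fin_num.
    by rewrite ge0_fin_numE ?(le_lt_trans zwx)// ?nz.2// -ge0_fin_numE// nw.2.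
  rewrite /source /translate /c -{1}(fineK zx) -{1}(fineK wx) -!EFinM -!EFinD lee_fin.
  have := @truncated_step n x (fine (z x) + K x) (fine (w x) + K x).
  by rewrite lerD2r fine_le// => /(_ isT); rewrite !(addrAC _ (K x)) lerD2r.
Unshelve. all: by end_near. Qed.

Let it n k : T -> \bar R := iter k (step n) (V source_bound).

Let nit n k : nnmfun (it n k).
Proof.
elim: k => [|k IH]; first exact/(nnmfun_green_operator Hp)/nnmfun_source_bound.
exact: nstep.
Qed.

Let it_nonincreasing n k x : it n k.+1 x <= it n k x.
Proof.
have it0 y : it n 1 y <= it n 0 y.
  rewrite /= [leRHS](resolvent_equation Hp HQ n y nnmfun_source_bound).
  apply: nnint_le.
  - by apply: nnmfunD; [exact: (nit n 0)|apply: ncsource; exact: (nit n 0)].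
  - apply: nnmfunD; first exact: (nit n 0).
    by apply: nnmfunM; [exact: nnmfun_cst|exact: nnmfun_source_bound].
  - by move=> t; apply: leeD2l; apply: lee_wpmul2l => //; exact: source_le.
have fin l : (forall j y, (j < l)%N -> it n j.+1 y <= it n j y) ->
    \forall y \ae mu, it n l y < +oo.
  move=> dec; apply: filterS green_source_bound_lty => y; apply: le_lt_trans.
  elim: l dec => [//|l IH] dec; apply: (le_trans (dec l y (ltnSn l))).
  by apply: IH => j z jk; apply: dec; exact: ltnW.
suff main : forall j y, it n j.+1 y <= it n j y by exact: main.
apply: ltn_ind => -[_|i IH] y; first exact: it0.
rewrite -[leLHS]/(step n (it n i.+1) y) -[leRHS]/(step n (it n i) y).
apply: step_le; [exact: nit|exact: nit| |].
- by apply: fin => j t ji; apply: IH; exact: ltnW.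
- by apply: aeW => t; exact: IH.
Qed.

Let it_le n k x : it n k x <= V source_bound x.
Proof. by elim: k => [//|k]; apply: le_trans; exact: it_nonincreasing. Qed.

Let it_fin n k : \forall x \ae mu, it n k x < +oo.
Proof. by apply: filterS green_source_bound_lty => x; exact/le_lt_trans/it_le. Qed.

Let lim n x : \bar R := limn (it n ^~ x).

Let it_cvg n x : it n k x @[k --> \oo] --> lim n x.
Proof.
apply: ereal_nonincreasing_is_cvgn; apply/nonincreasing_seqP => k.
exact: it_nonincreasing.
Qed.

Let lim_le_it n k x : lim n x <= it n k x.
Proof.
apply: lime_le; first by apply/cvg_ex; exists (lim n x); exact: it_cvg.
near=> j; have : (k <= j)%N by near: j; exact: nbhs_infty_ge.
move=> kj; have dec : nonincreasing_seq (it n ^~ x).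
  by apply/nonincreasing_seqP => i; exact: it_nonincreasing.
exact: dec.
Unshelve. all: by end_near. Qed.

Let nlim n : nnmfun (lim n).
Proof. exact: (@nnmfun_cvg _ _ _ (it n) (lim n) (nit n) (@it_cvg n)). Qed.

Let translate_cvg n x : it n 0 x < +oo ->
  translate (it n k) x @[k --> \oo] --> translate (lim n) x.
Proof.
move=> it0; apply: cvgD; last exact: cvg_cst.
apply: fine_cvg; rewrite fineK; first exact: it_cvg.
by rewrite ge0_fin_numE ?(nlim n).2// (le_lt_trans (lim_le_it n 0 x)).
Qed.

Let source_cvg n x : it n 0 x < +oo ->
  it n k x + c n * source n (translate (it n k)) x @[k --> \oo] -->
  lim n x + c n * source n (translate (lim n)) x.
Proof.
move=> it0; have tc := translate_cvg it0.
have limfin : lim n x \is a fin_num.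
  by rewrite ge0_fin_numE ?(nlim n).2// (le_lt_trans (lim_le_it n 0 x)).
apply: cvgeD; [by rewrite fin_num_adde_defl|exact: it_cvg|].
apply: cvgeZl => //; apply: cvg_EFin; first by apply: nearW.
apply: cvgD; last exact: cvg_cst.
apply: (truncated_right_continuous cf lohi fH) => // k.
rewrite /translate lerD2r fine_le ?lim_le_it//.
by rewrite ge0_fin_numE ?(nit n k).2// (le_lt_trans (it_le n k x)).
Qed.

(** The limit is attained from above, where the source is continuous. *)
Let lim_resolvent n : \forall x \ae mu, step n (lim n) x = lim n x.
Proof.
apply: filterS green_source_bound_lty => x Vx.
have ntot k : nnmfun (fun y => it n k y + c n * source n (translate (it n k)) y).
  by apply: nnmfunD => //; exact: ncsource.
have nlimtot : nnmfun (fun y => lim n y + c n * source n (translate (lim n)) y).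
  by apply: nnmfunD => //; exact: ncsource.
have nV := nnmfun_green_operator Hp nnmfun_source_bound.
have nbound : nnmfun (fun y => V source_bound y + c n * source_bound y).
  by apply: nnmfunD => //; apply: nnmfunM; [exact: nnmfun_cst|exact: nnmfun_source_bound].
have dct : step n (it n k) x @[k --> \oo] --> step n (lim n) x.
  apply: (@nnint_dct _ _ _ (Q n x)
    (fun k y => it n k y + c n * source n (translate (it n k)) y) _ _ ntot nlimtot nbound).
  - have [N [mN N0 VN]] := green_source_bound_lty.
    exists N; split => //; first exact: (resolvent_null Hp HQ V_null).
    by move=> y /= ny; apply: VN => /= Vy; apply: ny; exact: source_cvg.
  - by move=> k y; apply: leeD => //; apply: lee_wpmul2l => //; exact: source_le.
  - by rewrite -(resolvent_equation Hp HQ n x nnmfun_source_bound).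
have dct' : it n k.+1 x @[k --> \oo] --> lim n x.
  by rewrite (cvg_shiftS (it n ^~ x)); exact: it_cvg.
by rewrite -(cvg_lim _ dct)// -(cvg_lim _ dct').
Qed.

Let le_pos_part (a b : \bar R) : b \is a fin_num -> a <= b + maxe 0 (a - b).
Proof. by move=> bf; rewrite -leeBlDl// le_max lexx orbT. Qed.

Let ae_fin (a b : T -> \bar R) : nnmfun a -> (forall x, a x <= b x) ->
  (\forall x \ae mu, b x < +oo) -> \forall x \ae mu, a x \is a fin_num.
Proof.
move=> na ab; apply: filterS => x bx.
by rewrite ge0_fin_numE ?(le_lt_trans (ab x))// na.2.
Qed.

Let green_source_le n v x : measurable_fun setT v -> V (source n v) x <= V source_bound x.
Proof.
move=> mv; apply: (green_operator_ae_le Hp V_null) => //.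
- exact: nnmfun_source.
- exact: nnmfun_source_bound.
- by apply: aeW => y; exact: source_le.
Qed.

(** Both sides solve the resolvent equation with the same source, so the
    comparison applies in both directions. *)
Let lim_green n : \forall x \ae mu, lim n x = V (source n (translate (lim n))) x.
Proof.
have ns := nsource n (nlim n); have nVs := nnmfun_green_operator Hp ns.
have ncs := ncsource n (nlim n).
have Vs_le x : V (source n (translate (lim n))) x <= V source_bound x.
  by apply: green_source_le; exact: measurable_translate.
have lfin := ae_fin (nlim n) (lim_le_it n 0) green_source_bound_lty.
have Vfin := ae_fin nVs Vs_le green_source_bound_lty.
have le1 := resolvent_comparison Hp HQ V_null (n := n) (nlim n) nVs ncs ncs
  nnmfun_source_bound green_source_bound_lty Vfin.
have le2 := resolvent_comparison Hp HQ V_null (n := n) nVs (nlim n) ncs ncs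
  nnmfun_source_bound green_source_bound_lty lfin.
have {}le1 : \forall x \ae mu, lim n x <= V (source n (translate (lim n))) x.
  apply: le1.
  - by apply: aeW => x; exact: (lim_le_it n 0).
  - by apply: filterS (lim_resolvent n) => x <-.
  - by apply: aeW => x; rewrite [leRHS](resolvent_equation Hp HQ n x ns).
  - apply: filterS Vfin => x Vx; rewrite [leRHS]addeAC; apply: leeD2r; exact: le_pos_part.
have {}le2 : \forall x \ae mu, V (source n (translate (lim n))) x <= lim n x.
  apply: le2.
  - by apply: aeW => x; exact: Vs_le.
  - by apply: aeW => x; rewrite [leLHS](resolvent_equation Hp HQ n x ns).
  - by apply: filterS (lim_resolvent n) => x lx; rewrite -[leRHS]lx; exact: lexx.
  - apply: filterS lfin => x lx; rewrite [leRHS]addeAC; apply: leeD2r; exact: le_pos_part.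
by apply: filterS2 le1 le2 => x l1 l2; apply/eqP; rewrite eq_le l1 l2.
Qed.

(** The comparison principle does not apply here, as [truncated] need not be
    monotone; but order preservation propagates the inequality along the
    iteration, which starts above every subsolution. *)
Let subsolution_le_it n b q k : nnmfun b -> nnmfun q ->
  (\forall x \ae mu, q x \is a fin_num) -> (forall x, \int[Q n x]_y q y <= q x) ->
  (\forall x \ae mu, b x <= source n (fun y => fine (V b y) - fine (q y) + K y)%R x) ->
  forall x, V b x <= it n k x + q x.
Proof.
move=> nb nq qfin Qq bs.
have nV := nnmfun_green_operator Hp nb.
have V0 x : V b x <= V source_bound x.
  apply: (green_operator_ae_le Hp V_null) => //; first exact: nnmfun_source_bound.
  by apply: filterS bs => y /le_trans; apply; exact: source_le.
have Vfin := ae_fin nV V0 green_source_bound_lty.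
elim: k => [|k IH] x; first by apply: (le_trans (V0 x)); rewrite leeDl// nq.2.
rewrite [leLHS](resolvent_equation Hp HQ n x nb).
have ns : nnmfun (fun y => it n k y + c n * source n (translate (it n k)) y).
  by apply: nnmfunD => //; exact: ncsource.
apply: (@le_trans _ _ (\int[Q n x]_y
    ((it n k y + c n * source n (translate (it n k)) y) + q y))).
  apply: (resolvent_ae_le Hp HQ V_null).
  - by apply: nnmfunD => //; apply: nnmfunM => //; exact: nnmfun_cst.
  - exact: nnmfunD.
  - near=> y.
    have Vy : V b y \is a fin_num by near: y.
    have qy : q y \is a fin_num by near: y.
    have iy : it n k y \is a fin_num by rewrite ge0_fin_numE ?(nit n k).2//; near: y; exact: it_fin.
    have by_ : b y <= source n (fun y => fine (V b y) - fine (q y) + K y)%R y by near: y.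
    apply: (le_trans (leeD2l _ (lee_wpmul2l (c0 n) by_))).
    have := IH y; rewrite /source /translate /c.
    rewrite -{1}(fineK Vy) -{1}(fineK qy) -{1}(fineK iy) -!EFinD !lee_fin => Viq.
    rewrite -{1}(fineK Vy) -{2}(fineK qy) -{1}(fineK iy) -!EFinM -!EFinD lee_fin.
    have := @truncated_step n y (fine (V b y) - fine (q y) + K y) (fine (it n k y) + K y).
    rewrite lerD2r lerBlDr => /(_ Viq).
    by rewrite !(addrAC _ (K y)) lerD2r -[in X in _ -> X]lerBlDr [in X in _ -> X]addrAC.
by rewrite (nnintD _ ns nq); apply: leeD.
Unshelve. all: by end_near. Qed.

(** Largest solution of the regularized equation, as the limit of a decreasing
    iteration. In the fourth clause [b] is the source of a subsolution
    V b - q + K, which stays below; in the fifth, V (source hi) + q + K is a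
    supersolution, and comparison applies because the truncated source is
    constant above [hi]. *)
Lemma regularized_solution n : exists w, [/\ nnmfun w,
  (forall x, w x <= V source_bound x),
  (\forall x \ae mu, w x = V (source n (translate w)) x),
  (forall b q, nnmfun b -> nnmfun q ->
    (\forall x \ae mu, q x \is a fin_num) -> (forall x, \int[Q n x]_y q y <= q x) ->
    (\forall x \ae mu, b x <= source n (fun y => fine (V b y) - fine (q y) + K y)%R x) ->
    forall x, V b x <= w x + q x) &
  (forall q, nnmfun q ->
    (\forall x \ae mu, q x \is a fin_num) -> (forall x, \int[Q n x]_y q y <= q x) ->
    (\forall x \ae mu, (hi x <= fine (V (source n hi) x) + fine (q x) + K x)%R) ->
    \forall x \ae mu, w x <= V (source n hi) x + q x)].
Proof.
exists (lim n); split.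
- exact: nlim.
- exact: (lim_le_it n 0).
- exact: lim_green.
- move=> b q nb nq qfin Qq bs x.
  have ic : it n k x + q x @[k --> \oo] --> lim n x + q x.
    apply: cvgeD; [|exact: it_cvg|exact: cvg_cst].
    by apply: ge0_adde_def; rewrite inE ?(nlim n).2 ?nq.2.
  rewrite -(cvg_lim _ ic)//; apply: lime_ge; first by apply/cvg_ex; eexists; exact: ic.
  by apply: nearW => k; exact: subsolution_le_it.
- move=> q nq qfin Qq hiq.
  have ns : nnmfun (source n hi) := nnmfun_source n mhi.
  have nV := nnmfun_green_operator Hp ns.
  have nVq : nnmfun (fun x => V (source n hi) x + q x) := nnmfunD nV nq.
  have Vfin := ae_fin nV (fun x => green_source_le n x mhi) green_source_bound_lty.
  have lfin := ae_fin (nlim n) (lim_le_it n 0) green_source_bound_lty.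
  have Vqfin : \forall x \ae mu, V (source n hi) x + q x \is a fin_num.
    by apply: filterS2 Vfin qfin => x Vx qx; rewrite fin_numD Vx qx.
  have ncs : nnmfun (fun y => c n * source n hi y).
    by apply: nnmfunM => //; exact: nnmfun_cst.
  apply: (resolvent_comparison Hp HQ V_null (n := n) (nlim n) nVq
    (ncsource n (nlim n)) ncs nnmfun_source_bound green_source_bound_lty Vqfin).
  + by apply: aeW => x; exact: (lim_le_it n 0).
  + by apply: filterS (lim_resolvent n) => x <-.
  + apply: aeW => x.
    rewrite (_ : \int[Q n x]_y _ = \int[Q n x]_y ((V (source n hi) y + c n * source n hi y) + q y));
      last by apply: eq_integral => y _; rewrite addeAC.
    rewrite (nnintD _ (nnmfunD nV ncs) nq) [in leRHS](resolvent_equation Hp HQ n x ns).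
    exact: leeD2l.
  + near=> x.
    have Vx : V (source n hi) x \is a fin_num by near: x.
    have qx : q x \is a fin_num by near: x.
    have lx : lim n x \is a fin_num by near: x.
    have hx : (hi x <= fine (V (source n hi) x) + fine (q x) + K x)%R by near: x.
    have [lV|Vl] := leP (fine (lim n x)) (fine (V (source n hi) x) + fine (q x))%R.
      apply: (@le_trans _ _ (V (source n hi) x + q x + c n * source n hi x)); last first.
        by rewrite leeDl// le_max lexx.
      rewrite /source /translate /c -{1}(fineK lx).
      rewrite -{1}(fineK Vx) -(fineK qx) -!EFinM -!EFinD lee_fin.
      have := @truncated_step n x (fine (lim n x) + K x)
        (fine (V (source n hi) x) + fine (q x) + K x).
      rewrite lerD2r => /(_ lV); rewrite (truncated_above f lohi n hx).
      by rewrite !(addrAC _ (K x)) lerD2r.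
    have -> : source n (translate (lim n)) x = source n hi x.
      rewrite /source (truncated_above f lohi n (y := translate (lim n) x))//.
      by apply: (le_trans hx); rewrite /translate lerD2r ltW.
    by rewrite [leRHS]addeAC; apply: leeD2r; apply: le_pos_part; rewrite fin_numD Vx qx.
Unshelve. all: by end_near. Qed.

End RegularizedEquation.

(** * The maximal solution *)

Section MaximalSolution.
Context d (T : measurableType d) (R : realType) (mu : {measure set T -> \bar R}).
Variables (p : R -> T -> {measure set T -> \bar R}).
Variable Q : nat -> T -> {measure set T -> \bar R}.
Hypotheses (Hp : markov_kernels p) (HQ : resolvent_kernels p Q).
Hypothesis V_null : forall N, measurable N -> mu N = 0 ->
  forall x, green_operator p (fun y => (\1_N y)%:E) x = 0.
Local Notation V := (green_operator p).
Variables (f : T -> R -> R) (lo hi H K : T -> R).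
Hypotheses (mf : forall y, measurable_fun setT (f ^~ y)) (cf : forall x, continuous (f x)).
Hypotheses (mlo : measurable_fun setT lo) (mhi : measurable_fun setT hi)
  (mH : measurable_fun setT H) (mK : measurable_fun setT K).
Hypotheses (lohi : forall x, (lo x <= hi x)%R)
  (fH : forall x y, (lo x <= y <= hi x)%R -> (`|f x y| <= H x)%R).
Hypothesis VH_fin : \forall x \ae mu, V (EFin \o H) x < +oo.
Implicit Types (v : T -> R).

Definition shifted_rhs v x : \bar R := (f x (v x) + H x)%:E.

Lemma nnmfun_shifted_rhs v : measurable_fun setT v -> (forall x, lo x <= v x <= hi x)%R ->
  nnmfun (shifted_rhs v).
Proof.
move=> mv vb; split.
  by apply/measurable_EFinP/measurable_funD => //; exact: (measurable_superposition mf cf mv).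
move=> x; rewrite lee_fin -lerBlDr sub0r.
by have := fH (vb x); rewrite ler_norml => /andP[].
Qed.

Lemma shifted_rhs_le v x : (lo x <= v x <= hi x)%R -> shifted_rhs v x <= source_bound H x.
Proof.
move=> vb; rewrite /shifted_rhs /source_bound -EFinD lee_fin lerD2r.
by apply: (le_trans (ler_norm _)); exact: fH.
Qed.

Let V_bound_lty := green_source_bound_lty Hp mH lohi fH VH_fin.

Let n_bound := nnmfun_source_bound mH lohi fH.

Lemma green_shifted_rhs_fin v : measurable_fun setT v -> (forall x, lo x <= v x <= hi x)%R ->
  \forall x \ae mu, V (shifted_rhs v) x \is a fin_num.
Proof.
move=> mv vb; have nv := nnmfun_shifted_rhs mv vb.
have nV := nnmfun_green_operator Hp nv.
apply: filterS V_bound_lty => x Vx; rewrite ge0_fin_numE; last exact: nV.2.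
apply: (le_lt_trans _ Vx).
apply: (green_operator_ae_le Hp V_null) => //.
by apply: aeW => y; exact: shifted_rhs_le.
Qed.

Variables q1 q2 : T -> \bar R.
Hypotheses (nq1 : nnmfun q1) (q1_fin : \forall x \ae mu, q1 x \is a fin_num)
  (Qq1 : forall n x, \int[Q n x]_y q1 y <= q1 x).
Hypotheses (nq2 : nnmfun q2) (q2_fin : \forall x \ae mu, q2 x \is a fin_num)
  (Qq2 : forall n x, \int[Q n x]_y q2 y <= q2 x).
Hypotheses
  (lo_eq : \forall x \ae mu, lo x = (fine (V (shifted_rhs lo) x) - fine (q1 x) + K x)%R)
  (hi_eq : \forall x \ae mu, hi x = (fine (V (shifted_rhs hi) x) + fine (q2 x) + K x)%R).

(** The solutions of the regularized equations decrease with n, as each one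
    is a subsolution of the preceding equation. Their limit lies between [lo]
    and [hi], where the sources converge to f(., u) + H. *)
Theorem maximal_solution_between : exists u,
  [/\ measurable_fun setT u, forall x, (lo x <= u x <= hi x)%R,
      \forall x \ae mu, u x = (fine (V (shifted_rhs u) x) + K x)%R &
      forall v, measurable_fun setT v -> (forall x, lo x <= v x <= hi x)%R ->
        (\forall x \ae mu, v x = (fine (V (shifted_rhs v) x) + K x)%R) ->
        \forall x \ae mu, (v x <= u x)%R].
Proof.
have [w_ wP] := choice (fun n => regularized_solution Hp HQ V_null mf cf mlo mhi mH mK
  lohi fH VH_fin n).
have nw n : nnmfun (w_ n) by case: (wP n).
have w_le n x : w_ n x <= V (source_bound H) x by case: (wP n).
have w_eq n : \forall x \ae mu, w_ n x = V (source f lo hi H n (translate K (w_ n))) x.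
  by case: (wP n).
have mtr z : nnmfun z -> measurable_fun setT (translate K z).
  by move=> nz; exact: measurable_translate.
have ntr n z : nnmfun z -> nnmfun (source f lo hi H n (translate K z)).
  by move=> nz; exact/nnmfun_source/mtr.
pose z x : \bar R := limn_einf (w_ ^~ x).
have nz : nnmfun z by exact: nnmfun_limn_einf.
have n0 : nnmfun (fun _ : T => 0 : \bar R) by exact: nnmfun_cst.
have w_dec : \forall x \ae mu, forall n, w_ n.+1 x <= w_ n x.
  apply: ae_foralln => n; have [_ _ _ subs _] := wP n.
  have Vw x : V (source f lo hi H n.+1 (translate K (w_ n.+1))) x <= w_ n x + 0.
    apply: subs => //; [exact: ntr|exact: aeW|by move=> y; rewrite integral0|].
    apply: filterS (w_eq n.+1) => y wy; rewrite /source fine0 subr0 -wy lee_fin lerD2r.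
    exact: (truncated_antitone lohi fH).
  by apply: filterS (w_eq n.+1) => x ->; rewrite -[leRHS]adde0.
have w_cvg : \forall x \ae mu, w_ n x @[n --> \oo] --> z x.
  apply: filterS w_dec => x dec.
  have cw : cvgn (w_ ^~ x) by apply: ereal_nonincreasing_is_cvgn; exact/nonincreasing_seqP.
  by rewrite /z; have [-> _] := cvg_limn_einf_sup cw.
have z_le : \forall x \ae mu, forall n, z x <= w_ n x.
  apply: filterS2 w_dec w_cvg => x dec wz n.
  rewrite -(cvg_lim _ wz)//; apply: lime_le; first by apply/cvg_ex; eexists; exact: wz.
  have {}dec : nonincreasing_seq (w_ ^~ x) by exact/nonincreasing_seqP.
  by near=> k; apply: dec; near: k; exact: nbhs_infty_ge.
have w_fin n : \forall x \ae mu, w_ n x \is a fin_num.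
  apply: filterS V_bound_lty => x Vx; have w0 := (nw n).2 x.
  by rewrite ge0_fin_numE//; exact: le_lt_trans (w_le n x) Vx.
have z_fin : \forall x \ae mu, z x \is a fin_num.
  apply: filterS2 z_le (w_fin 0%N) => x zw; have z0 := nz.2 x; have w0 := (nw 0%N).2 x.
  by rewrite !ge0_fin_numE//; exact: le_lt_trans (zw 0%N).
(* The lower barrier and any competing solution are subsolutions of every
   regularized equation, f being below its regularizations. *)
have sub_le v q : measurable_fun setT v -> (forall x, lo x <= v x <= hi x)%R ->
    nnmfun q -> (\forall x \ae mu, q x \is a fin_num) ->
    (forall n x, \int[Q n x]_y q y <= q x) ->
    (\forall x \ae mu, v x = (fine (V (shifted_rhs v) x) - fine (q x) + K x)%R) ->
    \forall x \ae mu, V (shifted_rhs v) x <= z x + q x.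
  move=> mv vb nq qfin Qq veq; apply: filterS w_cvg => x wz.
  have nv := nnmfun_shifted_rhs mv vb.
  have le_n n : V (shifted_rhs v) x <= w_ n x + q x.
    have [_ _ _ subs _] := wP n; apply: (subs _ q nv nq qfin (Qq n)).
    apply: filterS veq => y vy; rewrite /source -vy lee_fin lerD2r.
    by apply: (truncated_ge fH).
  have wc : w_ n x + q x @[n --> \oo] --> z x + q x.
    apply: cvgeD; [|exact: wz|exact: cvg_cst].
    by apply: ge0_adde_def; rewrite inE ?nz.2 ?nq.2.
  rewrite -(cvg_lim _ wc)//; apply: lime_ge; first by apply/cvg_ex; eexists; exact: wc.
  exact: nearW.
have z_lo : \forall x \ae mu, (lo x <= translate K z x)%R.
  have nlo : forall x, (lo x <= lo x <= hi x)%R by move=> x; rewrite lexx lohi.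
  have lez := sub_le lo q1 mlo nlo nq1 q1_fin Qq1 lo_eq.
  have Vfin := green_shifted_rhs_fin mlo nlo.
  near=> x.
  have Vx : V (shifted_rhs lo) x \is a fin_num by near: x.
  have qx : q1 x \is a fin_num by near: x.
  have zx : z x \is a fin_num by near: x.
  have -> : lo x = (fine (V (shifted_rhs lo) x) - fine (q1 x) + K x)%R by near: x.
  rewrite lerD2r lerBlDr -fineD//; apply: fine_le => //; first by rewrite fin_numD zx qx.
  by near: x.
have z_hi : \forall x \ae mu, (translate K z x <= hi x)%R.
  have nhi : forall x, (lo x <= hi x <= hi x)%R by move=> x; rewrite lexx lohi.
  have Vfin := green_shifted_rhs_fin mhi nhi.
  have src_hi y : source f lo hi H n hi y @[n --> \oo] --> shifted_rhs hi y.
    apply: cvg_EFin; first exact: nearW.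
    apply: cvgD; last exact: cvg_cst.
    by apply: (truncated_cvg cf lohi fH) => //; exact: cvg_cst.
  have rh n : nnmfun (source f lo hi H n hi) by exact: nnmfun_source.
  have w_hi n : \forall x \ae mu, w_ n x <= V (source f lo hi H n hi) x + q2 x.
    have [_ _ _ _ sups] := wP n; apply: (sups q2 nq2 q2_fin (Qq2 n)).
    have Vge : forall x, V (shifted_rhs hi) x <= V (source f lo hi H n hi) x.
      apply: (green_operator_ae_le Hp V_null) => //; first exact: nnmfun_shifted_rhs.
      apply: aeW => y; rewrite lee_fin lerD2r.
      by apply: (truncated_ge fH).
    have Vle x : V (source f lo hi H n hi) x <= V (source_bound H) x.
      by apply: (green_operator_ae_le Hp V_null) => //; apply: aeW => y; exact: source_le.
    near=> x.
    have -> : hi x = (fine (V (shifted_rhs hi) x) + fine (q2 x) + K x)%R by near: x.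
    rewrite !lerD2r; apply: fine_le => //; first by near: x.
    rewrite ge0_fin_numE ?(nnmfun_green_operator Hp (rh n)).2//.
    by apply: (le_lt_trans (Vle x)); near: x.
  have {}w_hi := ae_foralln w_hi.
  near=> x.
  have qx : q2 x \is a fin_num by near: x.
  have zx : z x \is a fin_num by near: x.
  have Vx : V (shifted_rhs hi) x \is a fin_num by near: x.
  have Vc : V (source f lo hi H n hi) x + q2 x @[n --> \oo] --> V (shifted_rhs hi) x + q2 x.
    apply: cvgeD; [by rewrite fin_num_adde_defl| |exact: cvg_cst].
    apply: (green_operator_dct Hp V_null rh (nnmfun_shifted_rhs mhi nhi) n_bound).
    - by apply: aeW => y; exact: src_hi.
    - by move=> n y; exact: source_le.
    - by near: x.
  have wx : forall n, w_ n x <= V (source f lo hi H n hi) x + q2 x by near: x.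
  have -> : hi x = (fine (V (shifted_rhs hi) x) + fine (q2 x) + K x)%R by near: x.
  rewrite lerD2r -fineD//; apply: fine_le => //; first by rewrite fin_numD Vx qx.
  rewrite -(cvg_lim _ Vc)//; apply: lime_ge; first by apply/cvg_ex; eexists; exact: Vc.
  have zw : forall n, z x <= w_ n x by near: x.
  by apply: nearW => n; exact: le_trans (zw n) (wx n).
pose u x := clamp (lo x) (hi x) (translate K z x).
have mu_ : measurable_fun setT u by apply: measurable_clamp => //; exact: mtr.
have ub x : (lo x <= u x <= hi x)%R by exact: clamp_between.
have uE : \forall x \ae mu, u x = translate K z x.
  by apply: filterS2 z_lo z_hi => x zl zh; apply: clamp_id; rewrite zl.
have z_eq : \forall x \ae mu, z x = V (shifted_rhs u) x.
  have src_u : \forall y \ae mu,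
      source f lo hi H n (translate K (w_ n)) y @[n --> \oo] --> shifted_rhs u y.
    have {}w_fin := ae_foralln w_fin.
    near=> y.
    have zy : z y \is a fin_num by near: y.
    have wy : forall n, w_ n y \is a fin_num by near: y.
    have uy : u y = translate K z y by near: y.
    apply: cvg_EFin; first exact: nearW.
    apply: cvgD; last exact: cvg_cst.
    apply: (truncated_cvg cf lohi fH) => //.
    - have zw : forall n, z y <= w_ n y by near: y.
      by move=> n; rewrite uy lerD2r fine_le.
    - rewrite uy; apply: cvgD; last exact: cvg_cst.
      by apply: fine_cvg; rewrite fineK//; near: y.
  have {}w_eq := ae_foralln w_eq.
  near=> x.
  have wx : forall n, w_ n x = V (source f lo hi H n (translate K (w_ n))) x by near: x.
  have Vc : V (source f lo hi H n (translate K (w_ n))) x @[n --> \oo] --> V (shifted_rhs u) x.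
    apply: (green_operator_dct Hp V_null (fun n => ntr n _ (nw n))
      (nnmfun_shifted_rhs mu_ ub) n_bound src_u).
    - by move=> n y; exact: source_le.
    - by near: x.
  have wz : w_ n x @[n --> \oo] --> z x by near: x.
  rewrite -(cvg_lim _ Vc)// -(cvg_lim _ wz)//.
  by congr (limn _); apply/funext => n.
exists u; split => //.
- near=> x.
  have -> : u x = translate K z x by near: x.
  have <- : z x = V (shifted_rhs u) x by near: x.
  by [].
- move=> v mv vb veq.
  have veq0 : \forall x \ae mu, v x = (fine (V (shifted_rhs v) x) - fine (0 : \bar R) + K x)%R.
    by apply: filterS veq => x; rewrite fine0 subr0.
  have Vle : \forall x \ae mu, V (shifted_rhs v) x <= z x + 0.
    apply: sub_le veq0 => //; first by apply: aeW.
    by move=> n x; rewrite integral0.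
  have Vfin := green_shifted_rhs_fin mv vb.
  near=> x.
  have -> : u x = translate K z x by near: x.
  have -> : v x = (fine (V (shifted_rhs v) x) + K x)%R by near: x.
  rewrite lerD2r; apply: fine_le; [by near: x|by near: x|].
  by rewrite -[leRHS]adde0; near: x.
Unshelve. all: by end_near. Qed.
End MaximalSolution.

(** * The potential theory of the given process *)

Lemma ae_imply d (T : measurableType d) (R : realType) (mu : {measure set T -> \bar R})
    (A B : T -> Prop) : (forall x, A x -> B x) ->
  (\forall x \ae mu, A x) -> \forall x \ae mu, B x.
Proof. by move=> AB; apply: filterS. Qed.

Section Process.
Context {R : realType} (E : pmetricType R) (m : {measure set (borel E) -> \bar R}).
Variables (DA : set (E -> R)) (A : (E -> R) -> (E -> R)) (S : R -> (E -> R) -> (E -> R)).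
Context dO (Omega : measurableType dO).
Variables (X : R -> Omega -> one_point_compactification E)
  (P : one_point_compactification E -> probability Omega R).
Variables (G : E * E -> \bar R) (rho w : E -> R).

(** All that the nonlinear part uses of the process, of the operator and of the
    Green function. *)
Lemma process_kernels : self_adjoint m DA A -> markov_semigroup m S -> generator m DA A S ->
  hunt_process X P -> associated X P m S -> green_function X P m G ->
  (forall x, 0 < rho x)%R -> excessive X P (EFin \o rho) ->
  (forall x, 0 < w x)%R -> (exists C, forall x, w x <= C)%R ->
  (w : borel E -> R) \in Lfun m 1%E -> (w : borel E -> R) \in Lfun m 2%:E ->
  (exists C : R, forall x, (potential X P (EFin \o w) x <= C%:E)%E) ->
  (\forall x \ae m, (potential X P (EFin \o w) x <= (rho x)%:E)%E) ->
  exists (p : R -> E -> {measure set (borel E) -> \bar R})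
    (Q : nat -> E -> {measure set (borel E) -> \bar R}),
  [/\ markov_kernels (T := borel E) p /\ resolvent_kernels (T := borel E) p Q,
    forall (h : borel E -> \bar R) x, nnmfun h -> potential X P h x = green_operator (T := borel E) p h x,
    forall N : set (borel E), measurable N -> m N = 0 ->
      forall x, green_operator (T := borel E) p (fun y => (\1_N y)%:E) x = 0,
    forall h : borel E -> \bar R, nnmfun h ->
      \int[m]_x ((w x)%:E * green_operator (T := borel E) p h x) <= \int[m]_x ((rho x)%:E * h x) &
    forall nu : {measure set (borel E) -> \bar R}, \int[nu]_x (rho x)%:E < +oo ->
      [/\ nnmfun (potential_measure G nu : borel E -> \bar R),
        \int[m]_x ((w x)%:E * potential_measure G nu x) < +oo &
        forall n x, \int[Q n x]_y potential_measure G nu y <= potential_measure G nu x]].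
Proof.
move=> HA HS HG HX assoc [mG G0 Gr Gl Gpot] rho0 rho_exc w0 wb w1 w2 Vw_b Vw_rho.
have [p [Hp transE potE']] := hunt_kernels HX.
have potE (h : borel E -> \bar R) x : nnmfun h -> potential X P h x = green_operator (T := borel E) p h x.
  exact: potE'.
have [Q HQ] := resolvent_kernels_exist Hp.
have exc (h : borel E -> \bar R) : excessive X P h -> excessive_function (T := borel E) p h.
  move=> [mh h0 hsup]; have nh : nnmfun h by [].
  split => // [t x t0|x].
    rewrite /transition_op -transE//; last exact: ltW.
    by rewrite -(hsup x); apply: ereal_sup_ubound; exists t.
  rewrite -{1}(hsup x); apply: ge_ereal_sup => _ [t t0 <-].
  rewrite transE//; last exact: ltW.
  by apply: ereal_sup_ubound; exists t.
have mw : measurable_fun [set: borel E] (w : borel E -> R) by exact: L2_measurable w2.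
have iw : \int[m]_x (w x)%:E < +oo.
  have /integrableP[_] := (Lfun1_integrable m (w : borel E -> R)).1 w1.
  under eq_integral => x _ do rewrite gee0_abs ?lee_fin ?(ltW (w0 x))//.
  exact.
have nw : nnmfun (EFin \o (w : borel E -> R)).
  by split; [exact/measurable_EFinP|move=> x; rewrite lee_fin ltW].
have smu : sigma_finite setT m := sigma_finite_integrable_gt0 mw w0 iw.
have S_L2 t u : (0 <= t)%R -> L2 m u -> L2 m (S t u).
  by move=> t0 uL; exact: (op_codomain (semigroup_op HS t0)).
have S_sym := semigroup_symmetric HA HS HG.
have S_kernel t (h : borel E -> R) : (0 <= t)%R -> measurable_fun setT h ->
    (forall x, (0 <= h x)%R) -> (exists C, forall x, (h x <= C)%R) -> L2 m h ->
    \forall x \ae m, (S t h x)%:E = transition_op (T := borel E) p t (EFin \o h) x.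
  move=> t0 mh h0 [C hC] hL.
  have nh : nnmfun (EFin \o h) by split; [exact/measurable_EFinP|move=> x; rewrite lee_fin].
  have hb : exists C, forall x, (`|h x| <= C)%R by exists C => x; rewrite ger0_norm.
  apply: ae_imply (assoc t h t0 mh hb hL) => x ->; exact: transE.
have sym := green_operator_symmetric Hp smu w0 w2 wb S_L2 S_sym S_kernel.
have nG : nnmfun (G : borel E * borel E -> \bar R) by [].
have Gl' y : excessive_function (T := borel E) p (fun x : borel E => G (x, y)) := exc _ (Gl y).
have Gr' x : excessive_function (T := borel E) p (fun y : borel E => G (x, y)) := exc _ (Gr x).
have GE (h : borel E -> \bar R) x : nnmfun h ->
    green_operator (T := borel E) p h x = \int[m]_y (G (x, y) * h y).
  by move=> nh; rewrite -potE//; case: nh => mh h0; exact: Gpot.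
have Gw_b : exists C : R, forall x, green_operator (T := borel E) p (EFin \o (w : borel E -> R)) x <= C%:E.
  by have [C VC] := Vw_b; exists C => x; rewrite -potE.
have Gw_rho : \forall x \ae m, green_operator (T := borel E) p (EFin \o (w : borel E -> R)) x <= (rho x)%:E.
  by apply: (@filterS _ (almost_everywhere m) _ _ _ _ Vw_rho) => x; rewrite potE.
exists p, Q; split => //.
- move=> N mN N0 x. exact: (green_operator_null (T := borel E) (G := G) Gr' GE mN N0).
- by move=> h nh; exact: (integral_green_operator_le Hp mw w0 sym (exc _ rho_exc) Gw_rho nh).
- move=> nu nurho; split.
  + exact: (nnmfun_measure_potential (T := borel E) (G := G) smu nG rho0 (exc _ rho_exc) nurho).
  + exact: (integral_measure_potential_lty (T := borel E) (G := G) Hp HQ smu mw w0 iw nG Gl' Gr' GE sym rho0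
      (exc _ rho_exc) Gw_b Gw_rho nurho).
  + exact: (resolvent_measure_potential_le (T := borel E) (G := G) Hp HQ nG Gl' Gr' rho0 (exc _ rho_exc) nurho).
Qed.

End Process.

(** * From the regular to the general nonlinearity *)

Lemma fin_numB_fine (R : realType) (a b c e : \bar R) : a + b = c + e ->
  c \is a fin_num -> b \is a fin_num -> e \is a fin_num ->
  c - b = (fine a - fine e)%:E.
Proof.
move: a b c e => [a| |] [b| |] [c| |] [e| |] //= + _ _ _.
by rewrite -!EFinD => -[abce]; congr EFin; lra.
Qed.

Section WeightedPotentials.
Context d (T : measurableType d) (R : realType) (mu : {measure set T -> \bar R}).
Variables (p : R -> T -> {measure set T -> \bar R}).
Variable Q : nat -> T -> {measure set T -> \bar R}.
Hypotheses (Hp : markov_kernels p) (HQ : resolvent_kernels p Q).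
Hypothesis V_null : forall N, measurable N -> mu N = 0 ->
  forall x, green_operator p (fun y => (\1_N y)%:E) x = 0.
Local Notation V := (green_operator p).
Variables w rho : T -> R.
Hypotheses (mw : measurable_fun setT w) (w_gt0 : forall x, (0 < w x)%R)
  (mrho : measurable_fun setT rho) (rho_gt0 : forall x, (0 < rho x)%R).
Hypothesis V_rho : forall h : T -> \bar R, nnmfun h ->
  \int[mu]_x ((w x)%:E * V h x) <= \int[mu]_x ((rho x)%:E * h x).

Definition weighted_L1 (a h : T -> R) : Prop :=
  measurable_fun setT h /\ mu.-integrable setT (fun x => (h x * a x)%:E).

Definition weighted_lty (a : T -> R) (g : T -> \bar R) : Prop :=
  nnmfun g /\ \int[mu]_x ((a x)%:E * g x) < +oo.

Definition signed_green (h : T -> R) x : \bar R :=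
  V (EFin \o h)^\+ x - V (EFin \o h)^\- x.

Lemma weighted_L1_lty (a : T -> R) (h : T -> R) (g : T -> \bar R) :
  measurable_fun setT a -> (forall x, (0 < a x)%R) ->
  weighted_L1 a h -> nnmfun g -> (\forall x \ae mu, g x <= `|h x|%:E) -> weighted_lty a g.
Proof.
move=> ma a0 [mh /integrableP[_ ih]] ng gh; split => //.
have na : nnmfun (EFin \o a) by split; [exact/measurable_EFinP|move=> x; rewrite lee_fin ltW].
apply: le_lt_trans ih; apply: (nnint_ae_le (nnmfunM na ng)).
  split; last by move=> x; exact: abse_ge0.
  by apply: measurableT_comp => //; apply/measurable_EFinP; exact: measurable_funM.
apply: filterS gh => x ghx; rewrite abse_EFin normrM (gtr0_norm (a0 x)) mulrC EFinM.
by apply: lee_wpmul2l => //; rewrite lee_fin ltW.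
Qed.

Lemma weighted_lty_L1 (a : T -> R) (h : T -> R) (g : T -> \bar R) :
  measurable_fun setT a -> (forall x, (0 < a x)%R) ->
  measurable_fun setT h -> weighted_lty a g -> (\forall x \ae mu, `|h x|%:E <= g x) ->
  weighted_L1 a h.
Proof.
move=> ma a0 mh [ng ig] hg; split => //.
have na : nnmfun (EFin \o a) by split; [exact/measurable_EFinP|move=> x; rewrite lee_fin ltW].
have mah : measurable_fun setT (fun x => (h x * a x)%:E).
  by apply/measurable_EFinP; exact: measurable_funM.
apply/integrableP; split => //.
apply: le_lt_trans ig; apply: nnint_ae_le (nnmfunM na ng) _.
  split; last by move=> x; exact: abse_ge0.
  exact: measurableT_comp.
apply: filterS hg => x hgx; rewrite abse_EFin normrM (gtr0_norm (a0 x)) mulrC EFinM.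
by apply: lee_wpmul2l => //; rewrite lee_fin ltW.
Qed.

Lemma weighted_ltyD (a : T -> R) (g h : T -> \bar R) :
  measurable_fun setT a -> (forall x, (0 < a x)%R) ->
  weighted_lty a g -> weighted_lty a h -> weighted_lty a (fun x => g x + h x).
Proof.
move=> ma a0 [ng ig] [nh ih]; split; first exact: nnmfunD.
have na : nnmfun (EFin \o a) by split; [exact/measurable_EFinP|move=> x; rewrite lee_fin ltW].
have -> : \int[mu]_x ((a x)%:E * (g x + h x)) = \int[mu]_x ((a x)%:E * g x + (a x)%:E * h x).
  by apply: eq_integral => x _; rewrite ge0_muleDr ?ng.2 ?nh.2.
by rewrite (nnintD mu (nnmfunM na ng) (nnmfunM na nh)) lte_add_pinfty.
Qed.

Lemma weighted_lty_green g : weighted_lty rho g -> weighted_lty w (V g).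
Proof.
move=> [ng ig]; split; first exact: nnmfun_green_operator.
exact: le_lt_trans (V_rho ng) ig.
Qed.

Lemma weighted_lty_fin g : weighted_lty w g -> \forall x \ae mu, g x \is a fin_num.
Proof. by move=> [ng]; exact: (weighted_lty_ae mw w_gt0). Qed.

Let nnpos (h : T -> R) : measurable_fun setT h -> nnmfun (EFin \o h)^\+.
Proof.
by move=> mh; split; [apply: measurable_funepos; exact/measurable_EFinP|].
Qed.

Let nnneg (h : T -> R) : measurable_fun setT h -> nnmfun (EFin \o h)^\-.
Proof.
by move=> mh; split; [apply: measurable_funeneg; exact/measurable_EFinP|].
Qed.

Lemma green_parts_lty (h : T -> R) : weighted_L1 rho h ->
  weighted_lty w (V (EFin \o h)^\+) /\ weighted_lty w (V (EFin \o h)^\-).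
Proof.
move=> hL; have mh := hL.1.
split; apply/weighted_lty_green/(weighted_L1_lty mrho rho_gt0 hL); [exact: nnpos| |exact: nnneg|].
- by apply: aeW => x; rewrite funeposE ge_max /= !lee_fin normr_ge0 ler_norm.
- by apply: aeW => x; rewrite funenegE ge_max /= !lee_fin normr_ge0 ler_normr lexx orbT.
Qed.

(** This rests on h^+ + H = (h + H) + h^-, whose potentials are all finite. *)
Lemma signed_green_shift (h H : T -> R) (g : T -> \bar R) : weighted_L1 rho h ->
  weighted_lty rho (EFin \o H) -> nnmfun g ->
  (\forall x \ae mu, g x = (h x + H x)%:E) ->
  \forall x \ae mu, signed_green h x = (fine (V g x) - fine (V (EFin \o H) x))%:E.
Proof.
move=> hL HL ng gE; have mh := hL.1; have nH := HL.1.
have [Wp Wn] := green_parts_lty hL.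
have fp := weighted_lty_fin Wp; have fn := weighted_lty_fin Wn.
have fH := weighted_lty_fin (weighted_lty_green HL).
have np := nnpos mh; have nn := nnneg mh.
have E x : V g x + V (EFin \o h)^\- x = V (EFin \o h)^\+ x + V (EFin \o H) x.
  rewrite -(green_operatorD Hp x ng nn) -(green_operatorD Hp x np nH); apply: (green_operator_ae_eq Hp V_null).
  - exact: nnmfunD.
  - exact: nnmfunD.
  - apply: filterS gE => y ->; rewrite funeposE funenegE /= -EFin_max -EFin_max -!EFinD.
    by congr EFin; case: (leP (h y) 0%R) => hy; case: (leP (- h y)%R 0%R) => hy'; lra.
move: fp fn fH; apply: filterS3 => x Vp Vn VH.
exact: (fin_numB_fine (E x) Vp Vn VH).
Qed.

End WeightedPotentials.

Section ExtendedArithmetic.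
Context {R : realType}.
Implicit Types (s a b c e q : \bar R) (r : R).

Lemma fine_norm_le s a b c e q : c \is a fin_num -> e \is a fin_num ->
  a \is a fin_num -> b \is a fin_num -> q \is a fin_num ->
  0 <= c -> 0 <= e -> 0 <= a -> 0 <= b -> 0 <= q ->
  s = c - e + (a - b) - q \/ s = c - e + (a - b) + q ->
  `|fine s|%:E <= c + e + (a + b) + q.
Proof.
move: c e a b q => [c| |] [e| |] [a| |] [b| |] [q| |]//= _ _ _ _ _.
rewrite !lee_fin => c0 e0 a0 b0 q0 [] ->;
by rewrite /= ler_norml; apply/andP; split; lra.
Qed.

Lemma fine_shiftB s a b q r : a \is a fin_num -> b \is a fin_num -> q \is a fin_num ->
  s = r%:E + (a - b) - q -> fine s = (r + (fine a - fine b) - fine q)%R.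
Proof. by move: a b q => [a| |] [b| |] [q| |]//= _ _ _ ->. Qed.

Lemma fine_shiftD s a b q r : a \is a fin_num -> b \is a fin_num -> q \is a fin_num ->
  s = r%:E + (a - b) + q -> fine s = (r + (fine a - fine b) + fine q)%R.
Proof. by move: a b q => [a| |] [b| |] [q| |]//= _ _ _ ->. Qed.

Lemma EFin_shift a b r : a \is a fin_num -> b \is a fin_num ->
  r%:E + (a - b) = (r + (fine a - fine b))%:E.
Proof. by move: a b => [a| |] [b| |]. Qed.

End ExtendedArithmetic.

Section GeneralEquation.
Context d (T : measurableType d) (R : realType) (mu : {measure set T -> \bar R}).
Variables (p : R -> T -> {measure set T -> \bar R}).
Variable Q : nat -> T -> {measure set T -> \bar R}.
Hypotheses (Hp : markov_kernels p) (HQ : resolvent_kernels p Q).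
Hypothesis V_null : forall N, measurable N -> mu N = 0 ->
  forall x, green_operator p (fun y => (\1_N y)%:E) x = 0.
Local Notation V := (green_operator p).
Variables w rho : T -> R.
Hypotheses (mw : measurable_fun setT w) (w_gt0 : forall x, (0 < w x)%R)
  (mrho : measurable_fun setT rho) (rho_gt0 : forall x, (0 < rho x)%R).
Hypothesis V_rho : forall h : T -> \bar R, nnmfun h ->
  \int[mu]_x ((w x)%:E * V h x) <= \int[mu]_x ((rho x)%:E * h x).
Variable f : T -> R -> R.
Hypotheses (mf : forall y, measurable_fun setT (f ^~ y))
  (cf : \forall x \ae mu, continuous (f x)).

Definition represents (v : T -> \bar R) (h : T -> R) : Prop :=
  [/\ measurable_fun setT v, \forall x \ae mu, v x \is a fin_num,
      weighted_L1 mu rho h & \forall x \ae mu, h x = f x (fine (v x))].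

Variables a b q1 q2 : T -> \bar R.
Hypotheses (Wa : weighted_lty mu w a) (Wb : weighted_lty mu w b)
  (Wq1 : weighted_lty mu w q1) (Wq2 : weighted_lty mu w q2)
  (Qq1 : forall n x, \int[Q n x]_y q1 y <= q1 x)
  (Qq2 : forall n x, \int[Q n x]_y q2 y <= q2 x).
Variables (usub usup : T -> \bar R) (h1 h2 : T -> R).
Hypotheses (sub_rep : represents usub h1) (sup_rep : represents usup h2).
Hypothesis sub_eq : \forall x \ae mu, usub x = signed_green p h1 x + (a x - b x) - q1 x.
Hypothesis sup_eq : \forall x \ae mu, usup x = signed_green p h2 x + (a x - b x) + q2 x.
Hypothesis sub_sup : \forall x \ae mu, usub x <= usup x.
Hypothesis bounded_between :
  weighted_L1 mu w (fine \o usub) -> weighted_L1 mu w (fine \o usup) ->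
  exists2 H0, weighted_L1 mu rho H0 &
    \forall x \ae mu, forall y, (fine (usub x) <= y <= fine (usup x))%R ->
      (`|f x y| <= H0 x)%R.

Let fin_a := weighted_lty_fin mw w_gt0 Wa.
Let fin_b := weighted_lty_fin mw w_gt0 Wb.

(** A barrier is a combination of potentials whose integrals against [w] are
    finite; this is what gives access to the bound of [f] between the
    barriers. *)
Let barrier_L1 v h q : represents v h -> weighted_lty mu w q ->
  (\forall x \ae mu, v x = signed_green p h x + (a x - b x) - q x \/
                     v x = signed_green p h x + (a x - b x) + q x) ->
  weighted_L1 mu w (fine \o v).
Proof.
move=> [mv vfin hL _] Wq veq.
have [Wp Wn] := green_parts_lty Hp mrho rho_gt0 V_rho hL.
have fp := weighted_lty_fin mw w_gt0 Wp; have fn := weighted_lty_fin mw w_gt0 Wn.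
have fq := weighted_lty_fin mw w_gt0 Wq.
have W := weighted_ltyD mw w_gt0 (weighted_ltyD mw w_gt0 (weighted_ltyD mw w_gt0 Wp Wn)
  (weighted_ltyD mw w_gt0 Wa Wb)) Wq.
apply: (weighted_lty_L1 mw w_gt0 _ W); first exact: measurableT_comp.
have pos g : weighted_lty mu w g -> forall x, 0 <= g x by move=> [[]].
apply: filter_app veq; apply: filter_app fq; apply: filter_app fin_b;
apply: filter_app fin_a; apply: filter_app fn; apply: filter_app fp; apply: aeW.
move=> x Vp Vn ax bx qx vx.
exact: (fine_norm_le Vp Vn ax bx qx (pos _ Wp x) (pos _ Wn x) (pos _ Wa x) (pos _ Wb x)
  (pos _ Wq x) vx).
Qed.

(** The hypotheses on [f] and on the barriers hold almost everywhere. Setting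
    all data to 0 on a measurable null set makes them hold everywhere without
    affecting the equation, as potentials do not see null sets. *)
Theorem maximal_solution : exists u h, [/\ represents u h,
  \forall x \ae mu, u x = signed_green p h x + (a x - b x),
  \forall x \ae mu, usub x <= u x <= usup x &
  forall v k, represents v k -> (\forall x \ae mu, v x = signed_green p k x + (a x - b x)) ->
    (\forall x \ae mu, usub x <= v x <= usup x) -> \forall x \ae mu, v x <= u x].
Proof.
have [m1 fin1 h1L h1E] := sub_rep; have [m2 fin2 h2L h2E] := sup_rep.
have fin_q1 := weighted_lty_fin mw w_gt0 Wq1; have fin_q2 := weighted_lty_fin mw w_gt0 Wq2.
have [H0 H0L fH0] : exists2 H0, weighted_L1 mu rho H0 &
    \forall x \ae mu, forall y, (fine (usub x) <= y <= fine (usup x))%R -> (`|f x y| <= H0 x)%R.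
  apply: bounded_between.
  - by apply: (barrier_L1 sub_rep Wq1); apply: filterS sub_eq => x; left.
  - by apply: (barrier_L1 sup_rep Wq2); apply: filterS sup_eq => x; right.
pose good x := [/\ continuous (f x), usub x \is a fin_num, usup x \is a fin_num,
  usub x <= usup x &
  forall y, (fine (usub x) <= y <= fine (usup x))%R -> (`|f x y| <= H0 x)%R].
have [N [mN N0 NP]] : \forall x \ae mu, good x.
  apply: filter_app fH0; apply: filter_app sub_sup; apply: filter_app fin2;
  apply: filter_app fin1; apply: filter_app cf; apply: aeW.
  by move=> x ? ? ? ? ?; split.
(* Multiplication by [chi] sets the data to 0 on the exceptional null set. *)
pose chi x : R := \1_(~` N) x.
have mchi : measurable_fun setT chi by apply: measurable_indic; exact: measurableC.
have chiP x : chi x = 0%R \/ chi x = 1%R /\ good x.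
  rewrite /chi indicE; case: (pselect (N x)) => Nx.
    by left; rewrite memNset.
  right; rewrite mem_set//; split => //.
  by apply: contrapT => ngx; apply: Nx; exact: NP.
have chi1 : \forall x \ae mu, chi x = 1%R.
  exists N; split => // x /=; apply: contra_notP => Nx.
  by rewrite /chi indicE mem_set.
pose g x y : R := (chi x * f x y)%R.
pose lo x : R := (chi x * fine (usub x))%R.
pose hi x : R := (chi x * fine (usup x))%R.
pose H x : R := (chi x * H0 x)%R.
have regroup (r s c : R) : (r - s + c = r + (c - s))%R by lra.
pose K x : R := (fine (a x) - fine (b x) - fine (V (EFin \o H) x))%R.
have mg y : measurable_fun setT (g ^~ y) by exact: measurable_funM.
have mlo : measurable_fun setT lo by apply: measurable_funM => //; exact: measurableT_comp.
have mhi : measurable_fun setT hi by apply: measurable_funM => //; exact: measurableT_comp.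
have mH : measurable_fun setT H by apply: measurable_funM => //; exact: H0L.1.
have cg x : continuous (g x).
  have [cx|[cx [fx _ _ _ _]]] := chiP x.
    have -> : g x = fun=> 0%R by apply/funext => y; rewrite /g cx mul0r.
    by move=> y; exact: cvg_cst.
  by have -> : g x = f x by apply/funext => y; rewrite /g cx mul1r.
have lohi x : (lo x <= hi x)%R.
  rewrite /lo /hi; have [->|[-> [_ ? ? ? _]]] := chiP x; first by rewrite !mul0r.
  by rewrite !mul1r fine_le.
have gH x y : (lo x <= y <= hi x -> `|g x y| <= H x)%R.
  rewrite /lo /hi /g /H; have [->|[-> [_ _ _ _ fx]]] := chiP x; first by rewrite !mul0r normr0.
  by rewrite !mul1r; exact: fx.
have H_ge0 x : (0 <= H x)%R.
  by apply: le_trans (gH x (lo x) _); rewrite ?lexx ?lohi.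
have nH : nnmfun (EFin \o H) by split; [exact/measurable_EFinP|move=> x; rewrite lee_fin].
have HL : weighted_lty mu rho (EFin \o H).
  apply: (weighted_L1_lty mrho rho_gt0 H0L nH).
  by apply: filterS chi1 => x cx; rewrite /= lee_fin /H cx mul1r ler_norm.
have fin_VH := weighted_lty_fin mw w_gt0 (weighted_lty_green Hp V_rho HL).
have VH_lty : \forall x \ae mu, V (EFin \o H) x < +oo.
  by apply: filterS fin_VH => x; rewrite fin_numElt => /andP[].
have mK : measurable_fun setT K.
  have nVH := nnmfun_green_operator Hp nH.
  apply: measurable_funB; last exact: (measurableT_comp _ nVH.1).
  by apply: measurable_funB; apply: measurableT_comp => //; [case: Wa.1|case: Wb.1].
have shift v k : measurable_fun setT v -> (forall x, lo x <= v x <= hi x)%R ->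
    weighted_L1 mu rho k -> (\forall x \ae mu, k x = g x (v x)) ->
    \forall x \ae mu, signed_green p k x =
      (fine (V (shifted_rhs g H v) x) - fine (V (EFin \o H) x))%:E.
  move=> mv vb kL kE.
  apply: (signed_green_shift Hp V_null mw w_gt0 mrho rho_gt0 V_rho kL HL).
    exact: (nnmfun_shifted_rhs mg cg mH gH).
  by apply: filterS kE => x kx; rewrite kx.
have lo_lo x : (lo x <= lo x <= hi x)%R by rewrite lexx lohi.
have hi_hi x : (lo x <= hi x <= hi x)%R by rewrite lexx lohi.
have shift1 : \forall x \ae mu, signed_green p h1 x =
    (fine (V (shifted_rhs g H lo) x) - fine (V (EFin \o H) x))%:E.
  apply: shift => //; apply: filterS2 chi1 h1E => x cx ->.
  by rewrite /g /lo cx !mul1r.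
have shift2 : \forall x \ae mu, signed_green p h2 x =
    (fine (V (shifted_rhs g H hi) x) - fine (V (EFin \o H) x))%:E.
  apply: shift => //; apply: filterS2 chi1 h2E => x cx ->.
  by rewrite /g /hi cx !mul1r.
have lo_eq : \forall x \ae mu,
    lo x = (fine (V (shifted_rhs g H lo) x) - fine (q1 x) + K x)%R.
  apply: filter_app shift1; apply: filter_app sub_eq; apply: filter_app fin_q1;
  apply: filter_app fin_b; apply: filter_app fin_a; apply: filter_app chi1; apply: aeW.
  move=> x cx ax bx qx ux sx; rewrite sx in ux.
  by rewrite {1}/lo cx mul1r (fine_shiftB ax bx qx ux) regroup addrAC.
have hi_eq : \forall x \ae mu,
    hi x = (fine (V (shifted_rhs g H hi) x) + fine (q2 x) + K x)%R.
  apply: filter_app shift2; apply: filter_app sup_eq; apply: filter_app fin_q2;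
  apply: filter_app fin_b; apply: filter_app fin_a; apply: filter_app chi1; apply: aeW.
  move=> x cx ax bx qx ux sx; rewrite sx in ux.
  by rewrite {1}/hi cx mul1r (fine_shiftD ax bx qx ux) regroup addrAC.
have [u [mu_ ub ueq umax]] := maximal_solution_between Hp HQ V_null mg cg mlo mhi mH mK lohi gH
  VH_lty Wq1.1 fin_q1 Qq1 Wq2.1 fin_q2 Qq2 lo_eq hi_eq.
pose h x := g x (u x).
have mh : measurable_fun setT h by exact: (measurable_superposition mg cg mu_).
have hL : weighted_L1 mu rho h.
  apply: (weighted_lty_L1 mrho rho_gt0 mh HL).
  by apply: aeW => x; rewrite lee_fin; exact: gH.
exists (EFin \o u), h; split.
- split => //; [exact/measurable_EFinP|exact: aeW|].
  by apply: filterS chi1 => x cx; rewrite /h /g cx mul1r.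
- have hu : \forall x \ae mu, h x = g x (u x) by exact: aeW.
  have sh := shift u h mu_ ub hL hu.
  apply: filter_app sh; apply: filter_app ueq;
  apply: filter_app fin_b; apply: filter_app fin_a; apply: aeW.
  by move=> x ax bx ux ->; rewrite (EFin_shift _ ax bx) /= ux regroup.
- apply: filter_app fin2; apply: filter_app fin1; apply: filter_app chi1; apply: aeW.
  move=> x cx f1 f2; rewrite /= -(fineK f1) -(fineK f2) !lee_fin.
  by have := ub x; rewrite /lo /hi cx !mul1r.
- move=> v k [mv vfin kL kE] veq vb.
  pose v' x := clamp (lo x) (hi x) (fine (v x)).
  have mv' : measurable_fun setT v' by apply: measurable_clamp => //; exact: measurableT_comp.
  have v'b x : (lo x <= v' x <= hi x)%R by exact: clamp_between.
  have v'E : \forall x \ae mu, v' x = fine (v x).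
    apply: filter_app vb; apply: filter_app vfin; apply: filter_app fin2;
    apply: filter_app fin1; apply: filter_app chi1; apply: aeW.
    move=> x cx f1 f2 fv /andP[v1 v2]; apply: clamp_id.
    by rewrite /lo /hi cx !mul1r !fine_le.
  have kE' : \forall x \ae mu, k x = g x (v' x).
    apply: filter_app kE; apply: filter_app v'E; apply: filter_app chi1; apply: aeW.
    by move=> x cx -> ->; rewrite /g cx mul1r.
  have sh := shift v' k mv' v'b kL kE'.
  have v'eq : \forall x \ae mu, v' x = (fine (V (shifted_rhs g H v') x) + K x)%R.
    apply: filter_app sh; apply: filter_app veq; apply: filter_app v'E;
    apply: filter_app fin_b; apply: filter_app fin_a; apply: aeW.
    by move=> x ax bx vE ve sx; rewrite vE ve sx (EFin_shift _ ax bx) /= regroup.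
  have := umax v' mv' v'b v'eq.
  apply: filter_app; apply: filter_app v'E; apply: filter_app vfin; apply: aeW.
  by move=> x vx vE vu; rewrite /= -(fineK vx) lee_fin -vE.
Qed.

End GeneralEquation.

Local Close Scope ereal_scope.

Theorem theorem1 (R : realType) (E : pmetricType R)
    (m : {measure set (borel E) -> \bar R})
    (DA : set (E -> R)) (A : (E -> R) -> (E -> R))
    (T : R -> (E -> R) -> (E -> R))
    (DE : set (E -> R)) (sqrtA : (E -> R) -> (E -> R))
    (dO : measure_display) (Omega : measurableType dO)
    (X : R -> Omega -> one_point_compactification E)
    (P : one_point_compactification E -> probability Omega R)
    (G : E * E -> \bar R)
    (rho varrho : E -> R)
    (f : E -> R -> R)
    (mu : signed_measure R (borel E))
    (usub usup : E -> \bar R) :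
  lc_separable E -> radon m -> full_support m ->
  self_adjoint m DA A -> markov_semigroup m T -> generator m DA A T ->
  sqrt_opp m DA A DE sqrtA -> regular m DE sqrtA ->
  transient m T ->
  hunt_process X P -> associated X P m T ->
  green_function X P m G ->
  (forall x, 0 < rho x) -> excessive X P (EFin \o rho) ->
  (forall x, 0 < varrho x) -> (exists C, forall x, varrho x <= C) ->
  (varrho : borel E -> R) \in Lfun m 1%E ->
  (varrho : borel E -> R) \in Lfun m 2%:E ->
  (exists C : R, forall x, (potential X P (EFin \o varrho) x <= C%:E)%E) ->
  (\forall x \ae m, (potential X P (EFin \o varrho) x <= (rho x)%:E)%E) ->
  Car m f -> Sig m f -> Int m rho varrho f ->
  M_rho rho mu ->
  subsolution m X P G rho f mu usub ->
  supersolution m X P G rho f mu usup ->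
  (\forall x \ae m, (usub x <= usup x)%E) ->
  exists u : E -> \bar R,
    [/\ solution m X P G rho f mu u,
        (\forall x \ae m, (usub x <= u x <= usup x)%E) &
        forall v : E -> \bar R, solution m X P G rho f mu v ->
          (\forall x \ae m, (usub x <= v x <= usup x)%E) ->
          \forall x \ae m, (v x <= u x)%E].
Proof.
move=> _ _ _ HA HS HG _ _ _ HX assoc green rho0 rho_exc w0 wb w1 w2 Vwb Vwrho [mf cf] _ int
  Mrho [nu1 nu1r [h1 rep1 eq1]] [nu2 nu2r [h2 rep2 eq2]] subsup.
have [p [Q [[Hp HQ] potE Vnull Vrho Upot]]] := process_kernels HA HS HG HX assoc green
  rho0 rho_exc w0 wb w1 w2 Vwb Vwrho.
have mw : measurable_fun [set: borel E] (varrho : borel E -> R) := L2_measurable w2.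
have mrho : measurable_fun [set: borel E] (rho : borel E -> R).
  by apply/measurable_EFinP; case: rho_exc.
have rho_ge0 (nu : {measure set (borel E) -> \bar R}) : (0 <= \int[nu]_x (rho x)%:E)%E.
  by apply: integral_ge0 => x _; rewrite lee_fin ltW.
have posr : (\int[pos_part mu]_x (rho x)%:E < +oo)%E.
  by apply: le_lt_trans Mrho; rewrite leeDl.
have negr : (\int[neg_part mu]_x (rho x)%:E < +oo)%E.
  by apply: le_lt_trans Mrho; rewrite leeDr.
have [nUp iUp QUp] := Upot _ posr; have [nUn iUn QUn] := Upot _ negr.
have [nU1 iU1 QU1] := Upot _ nu1r; have [nU2 iU2 QU2] := Upot _ nu2r.
have signedE (h : borel E -> R) x : measurable_fun setT h ->
    potential_signed X P h x = signed_green (T := borel E) p h x.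
  move=> mh; rewrite /potential_signed /signed_green !potE//.
  - by split; [apply: measurable_funeneg; exact/measurable_EFinP|].
  - by split; [apply: measurable_funepos; exact/measurable_EFinP|].
have bounded : weighted_L1 (T := borel E) m varrho (fine \o usub) ->
    weighted_L1 (T := borel E) m varrho (fine \o usup) ->
    exists2 H0, weighted_L1 (T := borel E) m rho H0 &
      \forall x \ae m, forall y, fine (usub x) <= y <= fine (usup x) -> `|f x y| <= H0 x.
  move=> L1 L2; have [_ _ h1L h1E] := rep1; have [_ _ h2L h2E] := rep2.
  have [H0 H0L H0E] : L1w_class m rho (sup_between f (fine \o usub) (fine \o usup)).
    apply: int => //.
    - by exists h1 => //; apply: ae_imply h1E => x /= -> _.
    - by exists h2 => //; apply: ae_imply h2E => x /= -> _.
  exists H0 => //; apply: ae_imply H0E => x /(_ Logic.I) H0x y yb.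
  rewrite -lee_fin -[leRHS]/((EFin \o H0) x) -H0x /sup_between le_max; apply/orP; right.
  by apply: ereal_sup_ubound; exists y.
have sub_eq : \forall x \ae m, usub x = (signed_green (T := borel E) p h1 x +
    (potential_measure G (pos_part mu) x - potential_measure G (neg_part mu) x) -
    potential_measure G nu1 x)%E.
  by have [_ _ [mh1 _] _] := rep1; apply: ae_imply eq1 => x ->; rewrite signedE.
have sup_eq : \forall x \ae m, usup x = (signed_green (T := borel E) p h2 x +
    (potential_measure G (pos_part mu) x - potential_measure G (neg_part mu) x) +
    potential_measure G nu2 x)%E.
  by have [_ _ [mh2 _] _] := rep2; apply: ae_imply eq2 => x ->; rewrite signedE.
have [u [h [urep ueq ub umax]]] := maximal_solution (T := borel E) Hp HQ Vnull mw w0 mrho rho0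
  Vrho mf cf (conj nUp iUp) (conj nUn iUn) (conj nU1 iU1) (conj nU2 iU2) QU1 QU2 rep1 rep2
  sub_eq sup_eq subsup bounded.
exists u; split => //.
- exists h => //; have [_ _ [mh _] _] := urep.
  by apply: ae_imply ueq => x ->; rewrite signedE.
- move=> v [k vrep veq] vb; apply: (umax v k vrep _ vb).
  by have [_ _ [mk _] _] := vrep; apply: ae_imply veq => x ->; rewrite signedE.
Qed.
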